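(* Fix an integer $D\ge1$, and fix an edge weight distribution and a vertex weight distribution with finite fourth moments. Then there exists $\epsilon>0$, depending only on $D$ and the weight distributions, such that for all constants $\delta>0$ and $A>0$ there are constants $c,C>0$, depending only on $D,\delta,A$ and the weight distributions, for which the following holds. Let $G$ be any finite graph with maximum degree bounded above by $D$, with $|E(G)|\ge\delta|V(G)|$ and $G\in\mathsf{Growth}(A,\epsilon)$, and suppose that for the disordered monomer-dimer model on $G$ with these weights there is $c_0>0$ such that $$\mathrm{Var}(\langle|\mathsf{M}_G|\rangle)\ge c_0|E(G)|.$$ Then for all $R\ge1$, $$\sup_{s\in\mathbb{R}}\left|\mathbf{P}\left(\frac{\langle|\mathsf{M}_G|\rangle-\mathbf{E}\langle|\mathsf{M}_G|\rangle}{\sqrt{\mathrm{Var}(\langle|\mathsf{M}_G|\rangle)}}\le s\right)-\Phi(s)\right|\le Cc_0^{-1/2}\left(e^{-cR}+|E(G)|^{-1/4}|\Psi_G(R)|^2\right)+Cc_0^{-3/4}|E(G)|^{-1/4}.$$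
   Context: Let $G=(V(G),E(G))$ be a finite graph. A (partial) matching of $G$ is a set of edges of $G$ no two of which share a vertex; $\mathcal{M}_G$ is the set of all matchings of $G$ (including the empty one). For $x\in V(G)$ and $M\in\mathcal{M}_G$, $x\notin M$ means that $x$ is not an endpoint of any edge of $M$ (it is unmatched). The edges carry i.i.d. real weights $(w_e)_{e\in E(G)}$ and the vertices carry i.i.d. real weights $(\nu_x)_{x\in V(G)}$; the edge weights are independent of the vertex weights, and the two distributions may differ. The disordered monomer-dimer model on $G$ (with inverse temperature normalized to $1$, absorbed in the weights) is the random Gibbs measure $\mu_G(M)=Z_G^{-1}\exp(\sum_{e\in M}w_e+\sum_{x\notin M}\nu_x)$, $M\in\mathcal{M}_G$, where $Z_G$ is the normalizing constant. $\mathsf{M}_G$ denotes a random matching sampled from $\mu_G$ given the weights, $|\mathsf{M}_G|$ its number of edges, and $\langle\cdot\rangle$ the Gibbs expectation with respect to $\mu_G$ (for fixed weights). $\mathbf{P},\mathbf{E},\mathrm{Var}$ refer to the randomness of the weights. For $x\in V(G)$, $\mathbb{B}^x_R$ is the subgraph of $G$ induced by all vertices at graph distance at most $R$ from $x$, and the volume growth function is $\Psi_G(R)=\max_{x\in V(G)}|V(\mathbb{B}^x_R)|$. For positive constants $A,\epsilon$, $\mathsf{Growth}(A,\epsilon)$ is the class of finite graphs $G$ with $\Psi_G(R)\le A\exp(\epsilon R)$ for all $R\ge1$. $\Phi$ is the cumulative distribution function of the standard Gaussian distribution. *)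

(* Defs.v *)
From mathcomp Require Export all_boot all_order all_algebra.
From mathcomp Require Export all_classical all_reals all_analysis.
Export Order.TTheory GRing.Theory Num.Theory.
Export numFieldNormedType.Exports.

Set Implicit Arguments.
Unset Strict Implicit.
Unset Printing Implicit Defensive.

#[export] Set Implicit Arguments.
#[export] Unset Strict Implicit.
#[export] Unset Printing Implicit Defensive.

Local Open Scope classical_set_scope.
Local Open Scope ring_scope.

Record sgraph := SGraph {
  vertex :> finType;
  adj : rel vertex;
  adj_sym : symmetric adj;
  adj_irrefl : irreflexive adj }.

Section Graph.
Variable G : sgraph.

Definition edge_set : {set {set G}} :=
  [set E | [exists x : G, exists y : G, adj x y && (E == [set x; y])]]%SET.

Definition edge : finType := {E : {set G} | E \in edge_set}.

Definition degree (x : G) : nat := #|[set y | adj x y]%SET|.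

Definition is_matching (M : {set edge}) : bool :=
  [forall e in M, forall f in M, (e != f) ==> [disjoint val e & val f]].

Definition matched (M : {set edge}) (x : G) : bool :=
  [exists e in M, x \in val e].

End Graph.

Section Growth.
Variables (R : realType) (G : sgraph).

(* Infimum of the lengths of the walks from x to y; it is +oo when x and y lie
   in different connected components. *)
Definition gdist (x y : G) : \bar R :=
  ereal_inf [set (size p)%:R%:E | p in
    [set p : seq G | path (@adj G) x p /\ last x p = y]].

Definition ball_vertices (x : G) (r : R) : {set G} :=
  [set y | (gdist x y <= r%:E)%E]%SET.

Definition volume_growth (r : R) : nat :=
  \max_(x : G) #|ball_vertices x r|.

Definition in_Growth (A eps : R) : Prop :=
  forall r : R, 1 <= r -> (volume_growth r)%:R <= A * expR (eps * r).

End Growth.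

Section Gibbs.
Variables (R : realType) (G : sgraph) (w : edge G -> R) (nu : G -> R).

(* Only meaningful on matchings; the sums below range over matchings. *)
Definition boltzmann (M : {set edge G}) : R :=
  expR (\sum_(e in M) w e + \sum_(x : G | ~~ matched M x) nu x).

Definition partition_function : R :=
  \sum_(M : {set edge G} | is_matching M) boltzmann M.

Definition gibbs (M : {set edge G}) : R := partition_function^-1 * boltzmann M.

Definition gibbs_mean (f : {set edge G} -> R) : R :=
  \sum_(M : {set edge G} | is_matching M) f M * gibbs M.

End Gibbs.

Section Weights.
Variables (R : realType) (d : measure_display) (T : measurableType d).
Variable P : probability T R.

Definition mutually_independent (I : finType) (X : I -> {RV P >-> R}) : Prop :=
  forall (J : {set I}) (B : I -> set R), (forall i, measurable (B i)) ->
    P [set t | forall i, i \in J -> B i (X i t)] =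
    (\prod_(i in J) P (X i @^-1` B i))%E.

(* Laws are compared on measurable sets only: the value of a measure on other
   sets carries no meaning. *)
Definition has_law (X : {RV P >-> R}) (mu : probability R R) : Prop :=
  forall B : set R, measurable B -> distribution P X B = mu B.

Definition weight_family (G : sgraph) (w : edge G -> {RV P >-> R})
    (nu : G -> {RV P >-> R}) (i : edge G + G) : {RV P >-> R} :=
  match i with inl e => w e | inr x => nu x end.

Definition iid_weights (G : sgraph) (muE muV : probability R R)
    (w : edge G -> {RV P >-> R}) (nu : G -> {RV P >-> R}) : Prop :=
  [/\ forall e, has_law (w e) muE,
      forall x, has_law (nu x) muV
    & mutually_independent (weight_family w nu)].

Definition mean_matching_size (G : sgraph) (w : edge G -> {RV P >-> R})
    (nu : G -> {RV P >-> R}) (t : T) : R :=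
  gibbs_mean (fun e => w e t) (fun x => nu x t) (fun M => #|M|%:R).

Definition standardize (X : T -> R) (t : T) : R :=
  (X t - fine 'E_P[X]) / Num.sqrt (fine 'V_P[X]).

End Weights.

Definition finite_fourth_moment (R : realType) (mu : probability R R) : Prop :=
  mu.-integrable setT (fun x : R => (x ^+ 4)%:E).

Definition Phi (R : realType) (s : R) : \bar R := normal_prob 0 1 `]-oo, s].

(* Main.v *)
From HB Require Import structures.
Require Import Defs.
From mathcomp Require Import ring lra measurable_realfun.

(** Write F for the Gibbs mean of the number of dimers, seen as a function of
    the independent weights x_i, i ranging over edges and vertices, and let
    N = #|E(G)|.  The proof bounds the Kolmogorov distance by a constant times
    c0^(-1/2) N^(-1/4) + c0^(-3/4) N^(-1/4), and the right-hand side of the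
    theorem dominates this because a ball around a vertex is never empty.
    Three ingredients produce the bound.

    Locality of F.  Deleting a vertex changes the mean number of dimers by a
    number between 0 and 1 ([dimers_setD1], an induction on the vertex set).
    Both the original and the resampled configuration can be compared with the
    graph deprived of an endpoint of the resampled weight, so F moves by at most
    1 when one weight is resampled.  Moreover F is half the sum over x of
    1 - r_x, where r_x is the probability that x is a monomer, and the recursion
    r_x(S) = 1 / (1 + sum_y lambda_xy r_y(S \ x)) contracts the relative
    distance |a - b| / max a b by a factor smaller than 1 that depends on the
    weights around x only ([reldist_contract]).  Hence deleting a vertex at
    distance n from x changes r_x by at most the product of the contraction
    factors along some self-avoiding walk of length n ([monomer_decay]).

    Decay in mean.  The weights are unbounded, so the factors are not bounded
    away from 1.  A large power of them is nevertheless at most a small constant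
    times a penalty, a product of functions of single weights that differ from 1
    only at atypically large weights ([contraction_penalty]).  Independence
    makes the mean of this power along a fixed walk at most (2 D)^(-n), which
    beats the D^n walks ([Ex_walks]).  The resulting exponential rate depends on
    D and on the two laws, and it is the admissible growth exponent: below it,
    influences are summable over the graph ([sum_exp_capdist]).

    Normal approximation.  Let A_i average over the i-th weight.  Telescoping
    over these averages expresses a covariance with F as a sum over the weights
    ([covariance_mart_diff]), so that for the standardized W, with variance V of
    F, the mean of W f(W) is that of f'(W) T / V up to a second-order error, T
    being a sum of products of first-order differences of F.  The same identity
    applied to T bounds Var T by second-order differences
    (1 - A_i)(1 - A_k) F; these are small because each r_x feels one of the two
    weights only weakly, and Var T is of order N.  This gives
    |E (f'(W) - W f(W))| <= a sup|f'| + b Lip(f') with a of order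
    c0^(-1) N^(-1/2) and b of order c0^(-3/2) N^(-1/2)
    ([dimers_stein_discrepancy]).  Taking for f the solution of Stein's equation
    for an indicator smoothed at scale eta, which has |f'| <= 2 and
    Lip(f') <= 12 / eta, the Kolmogorov distance is at most
    2 a + 12 b / eta + eta ([kolmogorov_bound]); the choice of eta as the square
    root of the bound on b finishes the proof. *)

Local Open Scope ring_scope.

(** * Edges and matchings of a vertex subset *)

Section EdgeBasics.
Variable G : sgraph.
Implicit Types (e f : edge G) (x y : G) (S : {set G}) (M : {set edge G}).

Lemma edgeP e : exists x y, adj x y /\ val e = [set x; y].
Proof.
have := valP e; rewrite inE => /existsP[x /existsP[y /andP[xy /eqP ->]]].
by exists x, y.
Qed.

(** The fallback value x is never reached when x is an endpoint of e. *)
Definition other_end e x : G := odflt x [pick y in val e :\ x].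

Lemma other_end_spec e x : x \in val e ->
  [/\ val e = [set x; other_end e x], other_end e x != x & adj x (other_end e x)].
Proof.
have [a [b [ab eE]]] := edgeP e.
have neq : a != b by apply: contraTneq ab => ->; rewrite adj_irrefl.
rewrite /other_end eE !inE => /orP[]/eqP ->.
  case: pickP => [y|/(_ b)]; rewrite !inE ?(eq_sym b) ?neq ?eqxx ?orbT//=.
  move=> /andP[ya /orP[]/eqP yE]; first by rewrite yE eqxx in ya.
  by rewrite yE eq_sym.
case: pickP => [y|/(_ a)]; rewrite !inE ?neq ?eqxx ?orbT//=.
move=> /andP[yb /orP[]/eqP yE]; last by rewrite yE eqxx in yb.
by rewrite yE finset.setUC adj_sym; split.
Qed.

Lemma other_end_inj x : {in [pred e : edge G | x \in val e] &, injective (fun e => other_end e x)}.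
Proof.
move=> e f; rewrite !inE => /other_end_spec[eE _ _] /other_end_spec[fE _ _] ef.
by apply: val_inj; rewrite eE fE ef.
Qed.

Lemma card_incident x : (#|[pred e : edge G | x \in val e]| <= degree x)%N.
Proof.
rewrite -cardsE -(card_in_imset (f := fun e => other_end e x)).
  apply: subset_leq_card; apply/fintype.subsetP => y /imsetP[e]; rewrite !inE => xe ->.
  by have [] := other_end_spec xe.
by move=> e f; rewrite !inE => xe xf; exact: other_end_inj.
Qed.

Definition within S M := [forall e in M, val e \subset S].

Definition matching_in S M := is_matching M && within S M.

Lemma withinP S M : reflect (forall e, e \in M -> val e \subset S) (within S M).
Proof. exact: forall_inP. Qed.

Lemma is_matchingP M : reflect
  (forall e f, e \in M -> f \in M -> e != f -> [disjoint val e & val f])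
  (is_matching M).
Proof.
apply: (iffP idP) => [/forall_inP H e f eM fM ef|H].
  by have /forall_inP/(_ _ fM)/implyP := H _ eM; apply.
apply/forall_inP => e eM; apply/forall_inP => f fM; apply/implyP; exact: H.
Qed.

Lemma matched_setU1 e M x : matched (e |: M) x = (x \in val e) || matched M x.
Proof.
apply/exists_inP/orP => [[f]|[xe|/exists_inP[f fM xf]]].
- rewrite !inE => /orP[/eqP ->|fM xf]; [by left|right].
  by apply/exists_inP; exists f.
- by exists e => //; rewrite !inE eqxx.
- by exists f => //; rewrite !inE fM orbT.
Qed.

Lemma matching_in_unmatched S x M :
  matching_in S M && ~~ matched M x = matching_in (S :\ x) M.
Proof.
rewrite /matching_in -andbA; congr andb; apply/andP/withinP.
  move=> [/withinP MS xM] e eM; rewrite finset.subsetD1 MS//=.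
  by apply: contra xM => xe; apply/exists_inP; exists e.
move=> MS; split.
  by apply/withinP => e /MS; rewrite finset.subsetD1 => /andP[].
by apply/exists_inP => -[e /MS]; rewrite finset.subsetD1 => /andP[_ /negP].
Qed.

Lemma edge_notin_matching_in S e M : matching_in (S :\: val e) M -> e \notin M.
Proof.
move=> /andP[_ /withinP MS]; apply/negP => /MS.
have [a [b [_ eE]]] := edgeP e.
by move=> /fintype.subsetP/(_ a); rewrite eE !inE eqxx => /(_ isT).
Qed.

(** Matchings of S that contain e correspond to matchings of S deprived of both
    endpoints of e.  The last conjunct makes the statement fit a reindexing by
    N |-> e |: N with left inverse M |-> M :\ e. *)
Lemma matching_in_setU1 S e N : val e \subset S ->
  (matching_in S (e |: N) && (e \in e |: N)) && ((e |: N) :\ e == N) =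
  matching_in (S :\: val e) N.
Proof.
move=> eS; rewrite finset.setU11 andbT; apply/andP/idP.
  move=> [/andP[/is_matchingP mN /withinP wN] /eqP eN].
  have neN : e \notin N by rewrite -eN !inE eqxx.
  have inN f : f \in N -> f \in e |: N by move=> fN; rewrite !inE fN orbT.
  apply/andP; split; first by apply/is_matchingP => f g /inN fN /inN; exact: mN.
  apply/withinP => f fN; rewrite finset.subsetD wN ?inN//=.
  apply: mN; [exact: inN|exact: finset.setU11|].
  by apply: contraNneq neN => <-.
move=> oN; have neN := edge_notin_matching_in oN.
split; last by rewrite finset.setU1K.
have /andP[/is_matchingP mN /withinP wN] := oN.
have dis f : f \in N -> [disjoint val f & val e].
  by move=> /wN; rewrite finset.subsetD => /andP[].
apply/andP; split.
  apply/is_matchingP => f g; rewrite !inE => /orP[/eqP ->|fN] /orP[/eqP ->|gN].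
  - by rewrite eqxx.
  - by move=> _; rewrite disjoint_sym dis.
  - by move=> _; exact: dis.
  - exact: mN.
apply/withinP => f; rewrite !inE => /orP[/eqP ->//|/wN].
by rewrite finset.subsetD => /andP[].
Qed.

Lemma matching_card_incident S M x : matching_in S M ->
  (\sum_(e : edge G | [&& x \in val e, val e \subset S & e \in M]) 1)%N = matched M x.
Proof.
move=> /andP[/is_matchingP mM /withinP wM].
have [/exists_inP[e eM xe]|nm] := boolP (matched M x).
  rewrite (big_pred1 e) => [//|f] /=; apply/and3P/eqP => [[xf _ fM]|->]; last by rewrite wM.
  apply/eqP; apply: contraT => fe.
  have := mM _ _ fM eM fe => /pred0P/(_ x) /=.
  by rewrite xf xe.
rewrite big_pred0// => e; apply/and3P => -[xe _ eM].
by move/negP: nm; apply; apply/exists_inP; exists e.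
Qed.

(** Each edge of a matching covers two vertices and no vertex is covered twice. *)
Lemma matching_double_card M : is_matching M -> (\sum_(x : G) matched M x = #|M| * 2)%N.
Proof.
move=> mM; have oM : matching_in [set: G] M.
  by rewrite /matching_in mM; apply/withinP => e _; exact: finset.subsetT.
transitivity (\sum_(x : G) \sum_(e : edge G | [&& x \in val e, val e \subset [set: G] & e \in M]) 1)%N.
  by apply: eq_bigr => x _; rewrite (matching_card_incident x oM).
rewrite (exchange_big_dep (mem M))/=; last by move=> x e _ /and3P[].
rewrite -sum_nat_const; apply: eq_bigr => e eM.
have [a [b [ab eE]]] := edgeP e.
rewrite sum1dep_card -(_ : #|val e| = 2%N).
  by apply: eq_card => x; rewrite finset.in_set finset.subsetT eM !andbT.
by rewrite eE cards2; case: eqP ab => // ->; rewrite adj_irrefl.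
Qed.

End EdgeBasics.

(** * Partition functions and the vertex recursion *)

Section PartitionFunctions.
Variables (R : realType) (G : sgraph) (w : edge G -> R) (nu : G -> R).
Implicit Types (e f : edge G) (x y v : G) (S : {set G}) (M : {set edge G}).
Implicit Types g : {set edge G} -> R.

Definition matching_weight S M : R :=
  expR (\sum_(e in M) w e + \sum_(x in S | ~~ matched M x) nu x).

(** The observable g is kept arbitrary so that the partition function and the sums
    counting dimers obey one recursion, [matching_sum_rec]. *)
Definition matching_sum g S : R := \sum_(M | matching_in S M) g M * matching_weight S M.

Definition partition_in S : R := matching_sum (fun=> 1) S.

Lemma matching_sum_unmatched g S x : x \in S ->
  \sum_(M | matching_in S M && ~~ matched M x) g M * matching_weight S M =
  expR (nu x) * matching_sum g (S :\ x).
Proof.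
move=> xS; rewrite mulr_sumr; apply: eq_big => [M|M].
  exact: matching_in_unmatched.
move=> /andP[_ nm]; rewrite mulrCA; congr (_ * _).
rewrite /matching_weight -expRD; congr expR; rewrite addrCA; congr (_ + _).
rewrite (bigD1 x)/=; last by rewrite xS.
by congr (_ + _); apply: eq_bigl => y; rewrite !inE andbC andbA.
Qed.

Lemma matching_sum_edge g S e : val e \subset S ->
  \sum_(M | matching_in S M && (e \in M)) g M * matching_weight S M =
  expR (w e) * matching_sum (fun M => g (e |: M)) (S :\: val e).
Proof.
move=> eS; rewrite (reindex_onto (fun N => e |: N) (fun M => M :\ e)); last first.
  by move=> M /andP[_ eM]; rewrite finset.setD1K.
rewrite mulr_sumr; apply: eq_big => [N|N]; first exact: matching_in_setU1.
rewrite matching_in_setU1// => oN; rewrite mulrCA; congr (_ * _).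
have neN := edge_notin_matching_in oN.
rewrite /matching_weight -expRD; congr expR; rewrite big_setU1//= addrA; congr (_ + _).
apply: eq_bigl => y; rewrite matched_setU1 !inE negb_or.
by rewrite andbCA andbA.
Qed.

(** Either x is a monomer, and can be deleted, or x is covered by exactly one edge
    of the matching, and both endpoints of that edge can be deleted. *)
Lemma matching_sum_rec g S x : x \in S ->
  matching_sum g S = expR (nu x) * matching_sum g (S :\ x) +
    \sum_(e : edge G | (x \in val e) && (val e \subset S))
       expR (w e) * matching_sum (fun M => g (e |: M)) (S :\: val e).
Proof.
move=> xS; rewrite {1}/matching_sum (bigID (fun M => matched M x))/= addrC matching_sum_unmatched//.
congr (_ + _).
transitivity (\sum_(M | matching_in S M)
   \sum_(e : edge G | [&& x \in val e, val e \subset S & e \in M]) g M * matching_weight S M).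
  rewrite big_mkcondr; apply: eq_bigr => M oM.
  have := matching_card_incident x oM; case: ifP => _ /= H.
    rewrite -[LHS]mulr1 -[1]/(1%:R) -H natr_sum mulr_sumr.
    by apply: eq_bigr => e _; rewrite mulr1.
  have H0 := elimT eqP (introT eqP H); rewrite big1// => e eP.
  by move/eqP: H; rewrite sum_nat_eq0 => /forall_inP/(_ _ eP).
rewrite (exchange_big_dep (fun e => (x \in val e) && (val e \subset S)))/=.
  apply: eq_bigr => e /andP[xe eS]; rewrite -matching_sum_edge//.
  by apply: eq_bigl => M; rewrite xe eS.
by move=> M e _ /and3P[-> ->].
Qed.

Lemma matching_weight_gt0 S M : 0 < matching_weight S M. Proof. exact: expR_gt0. Qed.

Lemma partition_in_gt0 S : 0 < partition_in S.
Proof.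
rewrite /partition_in /matching_sum (bigD1 finset.set0)/=.
  rewrite mul1r ltr_pwDl ?matching_weight_gt0// sumr_ge0// => M _.
  by rewrite mul1r ltW// matching_weight_gt0.
apply/andP; split; first by apply/is_matchingP => e f; rewrite inE.
by apply/withinP => e; rewrite inE.
Qed.
Hint Resolve partition_in_gt0 : core.

Lemma partition_in_neq0 S : partition_in S != 0. Proof. by rewrite gt_eqF. Qed.

Lemma partition_in_rec S x : x \in S ->
  partition_in S = expR (nu x) * partition_in (S :\ x) +
    \sum_(e : edge G | (x \in val e) && (val e \subset S)) expR (w e) * partition_in (S :\: val e).
Proof. exact: matching_sum_rec. Qed.

Definition dimers S : R := matching_sum (fun M => #|M|%:R) S / partition_in S.

Lemma matching_sum_card_rec S x : x \in S ->
  matching_sum (fun M => #|M|%:R) S = expR (nu x) * matching_sum (fun M => #|M|%:R) (S :\ x) +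
    \sum_(e : edge G | (x \in val e) && (val e \subset S))
       expR (w e) * (partition_in (S :\: val e) * (1 + dimers (S :\: val e))).
Proof.
move=> xS; rewrite (matching_sum_rec _ xS); congr (_ + _).
apply: eq_bigr => e _; congr (_ * _).
rewrite mulrDr mulr1 /dimers mulrCA divff ?partition_in_neq0// mulr1.
rewrite /partition_in /matching_sum -big_split; apply: eq_bigr => M oM /=.
by rewrite cardsU1 (edge_notin_matching_in oM) natrD mulrDl.
Qed.

Lemma edge_setD S e x : x \in val e -> S :\: val e = (S :\ x) :\ other_end e x.
Proof.
move=> /other_end_spec[-> _ _]; apply/setP => y; rewrite !inE negb_or.
by rewrite andbCA andbA.
Qed.

Lemma edge_subset S e x : x \in val e -> x \in S ->
  (val e \subset S) = (other_end e x \in S :\ x).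
Proof.
move=> /other_end_spec[-> xo _] xS.
by rewrite finset.subUset !finset.sub1set xS !inE xo.
Qed.

(** With Z the partition function, conditioning on the edge e that covers x shows
    that Z(S) times the difference is the sum over e of
    w_e Z(S \ e) (1 - (dimers (S \ x) - dimers (S \ e))).  Here S \ e is S \ x
    without one more vertex, so by induction every bracket lies in the unit
    interval, and the sum lies between 0 and the part of Z(S) where x is
    covered. *)
Lemma dimers_setD1 S x : 0 <= dimers S - dimers (S :\ x) <= 1.
Proof.
have [n] := ubnP #|S|; elim: n S x => // n IH S x Sn.
have [xS|xS] := boolP (x \in S); last first.
  suff -> : S :\ x = S by rewrite subrr lexx ler01.
  by apply/setP => y; rewrite !inE; case: eqP => // ->; rewrite (negbTE xS).
have S1n : (#|S :\ x| < n)%N.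
  by rewrite -ltnS (leq_trans _ Sn)// ltnS [leqRHS](cardsD1 x) xS.
(* c is the part of the partition function where x is covered; b is
   partition_in S times the difference to be bounded. *)
pose c := \sum_(e : edge G | (x \in val e) && (val e \subset S)) expR (w e) * partition_in (S :\: val e).
pose b := \sum_(e : edge G | (x \in val e) && (val e \subset S)) expR (w e) *
  (partition_in (S :\: val e) * (1 - (dimers (S :\ x) - dimers (S :\: val e)))).
have bc : 0 <= b <= c.
  have H e : (x \in val e) && (val e \subset S) ->
      0 <= 1 - (dimers (S :\ x) - dimers (S :\: val e)) <= 1.
    move=> /andP[xe eS]; rewrite (edge_setD _ xe).
    have := IH (S :\ x) (other_end e x) S1n; lra.
  apply/andP; split.
    apply: sumr_ge0 => e /H /andP[h _]; rewrite mulr_ge0 ?expR_ge0// mulr_ge0//.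
    exact: ltW.
  apply: ler_sum => e /H /andP[_ h]; rewrite ler_wpM2l ?expR_ge0//.
  by rewrite ler_piMr// ltW.
have cZ : c <= partition_in S.
  by rewrite (partition_in_rec xS) lerDr mulr_ge0 ?expR_ge0// ltW.
have -> : dimers S - dimers (S :\ x) = b / partition_in S.
  have dE S' : matching_sum (fun M => #|M|%:R) S' = dimers S' * partition_in S'.
    by rewrite divfK ?partition_in_neq0.
  have -> : b = \sum_(e : edge G | (x \in val e) && (val e \subset S))
      expR (w e) * (partition_in (S :\: val e) * (1 + dimers (S :\: val e)))
      - dimers (S :\ x) * c.
    by rewrite mulr_sumr -sumrB; apply: eq_bigr => e _; ring.
  apply: (mulIf (partition_in_neq0 S)); rewrite mulrBl [RHS]divfK ?partition_in_neq0// -dE.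
  by rewrite (matching_sum_card_rec xS) dE [in X in _ - X](partition_in_rec xS) -/c; ring.
have /andP[b0 bc'] := bc.
rewrite divr_ge0 ?(ltW (partition_in_gt0 _))//= ler_pdivrMr// mul1r.
exact: le_trans cZ.
Qed.

(** Gibbs probability that x is a monomer in the graph induced on S.  The value 0
    outside S lets the recursion below sum over all edges at x. *)
Definition monomer S x : R :=
  if x \in S then expR (nu x) * partition_in (S :\ x) / partition_in S else 0.

(** The Boltzmann factor of replacing two monomers by the dimer e. *)
Definition activity x e : R := expR (w e - nu x - nu (other_end e x)).

Lemma monomer_rec S x : x \in S ->
  monomer S x = (1 + \sum_(e : edge G | x \in val e) activity x e * monomer (S :\ x) (other_end e x))^-1.
Proof.
move=> xS; rewrite /monomer xS -[LHS]invrK invf_div; congr (_^-1).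
have a0 : expR (nu x) * partition_in (S :\ x) != 0.
  by rewrite mulf_neq0 ?partition_in_neq0// gt_eqF// expR_gt0.
rewrite (partition_in_rec xS) mulrDl divff//; congr (_ + _).
rewrite mulr_suml [LHS]big_mkcondr/=; apply: eq_bigr => e xe.
rewrite (edge_subset xe xS); case: ifP => [oS|]; last by rewrite mulr0.
rewrite (edge_setD _ xe) /activity !expRD !expRN.
by field; rewrite partition_in_neq0 !gt_eqF ?expR_gt0.
Qed.

Lemma activity_ge0 x e : 0 <= activity x e. Proof. exact: expR_ge0. Qed.

Lemma monomer_ge0 S x : 0 <= monomer S x.
Proof.
rewrite /monomer; case: ifP => // _; rewrite mulr_ge0 ?invr_ge0 ?mulr_ge0 ?expR_ge0//;
 exact: ltW.
Qed.

Lemma monomer_le1 S x : monomer S x <= 1.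
Proof.
have [xS|xS] := boolP (x \in S); last by rewrite /monomer (negbTE xS).
rewrite monomer_rec// invf_le1.
  by rewrite lerDl sumr_ge0// => e _; rewrite mulr_ge0 ?activity_ge0 ?monomer_ge0.
by rewrite ltr_pwDl// sumr_ge0// => e _; rewrite mulr_ge0 ?activity_ge0 ?monomer_ge0.
Qed.

(** Twice the number of dimers is the number of vertices that are not monomers. *)
Lemma dimers_monomer : dimers [set: G] = 2^-1 * \sum_x (1 - monomer [set: G] x).
Proof.
have -> : \sum_x (1 - monomer [set: G] x) =
    (\sum_x \sum_(M | matching_in [set: G] M) (matched M x)%:R * matching_weight [set: G] M) / partition_in [set: G].
  rewrite mulr_suml; apply: eq_bigr => x _.
  rewrite /monomer inE -(matching_sum_unmatched (fun=> 1)) ?inE//.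
  rewrite -[X in X - _](divff (partition_in_neq0 [set: G])) -mulrBl; congr (_ / _).
  rewrite {1}/partition_in /matching_sum (bigID (fun M => matched M x))/= addrK.
  rewrite big_mkcondr; apply: eq_bigr => M _.
  by case: matched; rewrite ?mul1r ?mul0r.
rewrite mulrA /dimers; congr (_ / _); rewrite exchange_big mulr_sumr.
apply: eq_bigr => M /andP[mM _].
rewrite -mulr_suml mulrA; congr (_ * _).
rewrite -natr_sum matching_double_card// natrM mulrC mulfK//.
Qed.

Lemma gibbs_mean_dimers :
  gibbs_mean w nu (fun M => #|M|%:R) = dimers [set: G].
Proof.
have wT M : matching_in [set: G] M = is_matching M.
  by rewrite /matching_in; apply/andb_idr => _; apply/withinP => e _; exact: finset.subsetT.
have bE M : boltzmann w nu M = matching_weight [set: G] M.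
  rewrite /boltzmann /matching_weight; congr (expR (_ + _)); apply: eq_bigl => x; by rewrite inE.
have pE : partition_function w nu = partition_in [set: G].
  by apply: eq_big => [M|M _]; [rewrite wT|rewrite mul1r bE].
rewrite /gibbs_mean /dimers mulr_suml.
apply: eq_big => [M|M _]; first by rewrite wT.
by rewrite /gibbs pE bE; ring.
Qed.

End PartitionFunctions.

(** * Contraction of relative distances *)

Section RelDist.
Context (R : realType).

(** Relative distance.  It is at most 1 on nonnegative numbers, also when one of
    them is 0, so contraction can start from a vertex whose monomer probability
    has been set to 0 by a deletion. *)
Definition reldist (a b : R) : R := `|a - b| / Num.max a b.

Lemma reldistC a b : reldist a b = reldist b a.
Proof. by rewrite /reldist distrC maxC. Qed.

Lemma reldist_ge0 a b : 0 <= a -> 0 <= b -> 0 <= reldist a b.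
Proof. by move=> a0 b0; rewrite divr_ge0// le_max a0. Qed.

Lemma reldist_le1 a b : 0 <= a -> 0 <= b -> reldist a b <= 1.
Proof.
wlog ab : a b / a <= b => [H a0 b0|a0 b0].
  by have [ab|/ltW ba] := leP a b; [exact: H|rewrite reldistC; exact: H].
rewrite /reldist (max_idPr ab) distrC ger0_norm ?subr_ge0//.
have [->|b1] := eqVneq b 0; first by rewrite invr0 mulr0.
by rewrite ler_pdivrMr ?mul1r ?gerBl// lt_def b1.
Qed.

Lemma reldistE a b : 0 <= a -> 0 <= b -> `|a - b| = reldist a b * Num.max a b.
Proof.
move=> a0 b0; rewrite /reldist; have [m0|m0] := eqVneq (Num.max a b) 0.
  rewrite m0 mulr0; have : a <= 0 by rewrite -m0 le_max lexx.
  have : b <= 0 by rewrite -m0 le_max lexx orbT.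
  move=> bn an; have -> : a = 0 by apply/eqP; rewrite eq_le an.
  by have -> : b = 0 by [apply/eqP; rewrite eq_le bn]; rewrite subrr normr0.
by rewrite divfK.
Qed.

(** If s >= s' are the two sums, the relative distance of 1 / (1 + s) and
    1 / (1 + s') is (s - s') / (1 + s).  Each term of s - s' is at most M times
    the corresponding term of s, and s / (1 + s) grows with s <= L. *)
Lemma reldist_contract (J : finType) (p : pred J) (lam a b : J -> R) (M L : R) :
  (forall j, 0 <= lam j) -> (forall j, 0 <= a j <= 1) -> (forall j, 0 <= b j <= 1) ->
  0 <= M -> (forall j, p j -> reldist (a j) (b j) <= M) ->
  L = \sum_(j | p j) lam j ->
  reldist (1 + \sum_(j | p j) lam j * a j)^-1 (1 + \sum_(j | p j) lam j * b j)^-1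
    <= L / (1 + L) * M.
Proof.
move=> lam0 a01 b01 M0 abM LE.
have L0 : 0 <= L by rewrite LE; exact: sumr_ge0.
have sum0 (c : J -> R) : (forall j, 0 <= c j <= 1) -> 0 <= \sum_(j | p j) lam j * c j <= L.
  move=> c01; apply/andP; split.
    by apply: sumr_ge0 => j _; rewrite mulr_ge0//; case/andP: (c01 j).
  by rewrite LE; apply: ler_sum => j _; rewrite ler_piMr//; case/andP: (c01 j).
wlog ba : a b a01 b01 abM / \sum_(j | p j) lam j * b j <= \sum_(j | p j) lam j * a j.
  move=> H; have [|/ltW] := leP (\sum_(j | p j) lam j * b j) (\sum_(j | p j) lam j * a j).
    exact: H.
  by move=> h; rewrite reldistC; apply: H => // j pj; rewrite reldistC abM.
have sM : \sum_(j | p j) lam j * a j - \sum_(j | p j) lam j * b j <=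
          M * \sum_(j | p j) lam j * a j.
  rewrite -sumrB mulr_sumr; apply: ler_sum => j pj.
  rewrite -mulrBr mulrCA ler_wpM2l//.
  have [[/andP[a0 _] /andP[b0 _]]] := (a01 j, b01 j).
  have [abj|/ltW baj] := leP (a j) (b j).
    by apply: (@le_trans _ _ 0); rewrite ?subr_le0 ?mulr_ge0.
  apply: (le_trans (ler_norm _)); rewrite reldistE// (max_idPl baj).
  by rewrite ler_wpM2r// abM.
have /andP[a0 aL] := sum0 _ a01; have /andP[b0 _] := sum0 _ b01.
move: (\sum_(j | p j) lam j * a j) (\sum_(j | p j) lam j * b j) a0 aL b0 ba sM.
move=> s s' s0 sL s'0 s's sM.
have p1 : 0 < 1 + s by rewrite ltr_pwDl.
have p2 : 0 < 1 + s' by rewrite ltr_pwDl.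
have p3 : 0 < 1 + L by rewrite ltr_pwDl.
rewrite /reldist (max_idPr _); last by rewrite lef_pV2 ?posrE// lerD2l.
rewrite distrC ger0_norm ?subr_ge0 ?lef_pV2 ?posrE ?lerD2l//.
rewrite (_ : _ / _ = (s - s') / (1 + s)); last by field; rewrite !gt_eqF.
rewrite ler_pdivrMr// (le_trans sM)// mulrAC [leRHS]mulrC ler_wpM2l//.
by rewrite mulrAC ler_pdivlMr// !mulrDr !mulr1 lerD// mulrC.
Qed.

Lemma bigmax_exp_le (J : Type) (r : seq J) (p : pred J) (m : J -> R) k :
  (forall j, 0 <= m j) ->
  (\big[Num.max/0]_(j <- r | p j) m j) ^+ k.+1 <= \sum_(j <- r | p j) m j ^+ k.+1.
Proof.
move=> m0; have H : 0 <= \big[Num.max/0]_(j <- r | p j) m j /\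
   (\big[Num.max/0]_(j <- r | p j) m j) ^+ k.+1 <= \sum_(j <- r | p j) m j ^+ k.+1.
  elim: r => [|j r [IH0 IH]]; first by rewrite !big_nil expr0n.
  rewrite !big_cons; case: ifP => // _.
  set M := \big[_/_]_(_ <- r | _) _ in IH0 IH *.
  split; first by rewrite le_max m0.
  have [_|_] := leP (m j) M; first by rewrite (le_trans IH)// lerDr exprn_ge0.
  by rewrite lerDl (le_trans _ IH)// exprn_ge0.
by case: H.
Qed.

End RelDist.

(** * Walk distance and volume growth *)

Section Reach.
Variable G : sgraph.

(** Vertices joined to x by a walk of length at most n. *)
Fixpoint reach n (x : G) : {set G} :=
  if n is n'.+1 then x |: \bigcup_(z | adj x z) reach n' z else [set x].

Lemma reachSP n x y : reflect (x = y \/ exists2 z, adj x z & y \in reach n z)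
  (y \in reach n.+1 x).
Proof.
rewrite /= !inE; apply: (iffP orP) => [[/eqP ->|/bigcupP[z xz yz]]|[->|[z xz yz]]].
- by left.
- by right; exists z.
- by left.
- by right; apply/bigcupP; exists z.
Qed.

Lemma reach_sub n x : reach n x \subset reach n.+1 x.
Proof.
elim: n x => [|n IH] x; apply/fintype.subsetP => y.
  by rewrite inE => /eqP ->; apply/reachSP; left.
move=> /reachSP[->|[z xz yz]]; apply/reachSP; first by left.
by right; exists z => //; apply: (fintype.subsetP (IH z)).
Qed.

Lemma reach_step n x y z : y \in reach n x -> adj y z -> z \in reach n.+1 x.
Proof.
elim: n x => [|n IH] x.
  by rewrite inE => /eqP -> xz; apply/reachSP; right; exists z; rewrite // inE.
move=> /reachSP[<- xz|[u xu yu] yz]; apply/reachSP; right.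
  by exists z => //; apply/reachSP; left.
by exists u => //; exact: IH.
Qed.

Lemma reach_sym n x y : (y \in reach n x) = (x \in reach n y).
Proof.
suff H : forall x y, y \in reach n x -> x \in reach n y by apply/idP/idP; exact: H.
elim: n => [|n IH] {}x {}y; first by rewrite !inE eq_sym.
move=> /reachSP[->|[z xz yz]]; first by apply/reachSP; left.
by apply: reach_step (IH _ _ yz) _; rewrite adj_sym.
Qed.

Lemma reach_walk n x y : y \in reach n x ->
  exists2 p : seq G, path (@adj G) x p /\ last x p = y & (size p <= n)%N.
Proof.
elim: n x => [|n IH] x; first by rewrite inE => /eqP ->; exists [::].
move=> /reachSP[->|[z xz yz]]; first by exists [::].
have [p [zp lp] pn] := IH _ yz.
by exists (z :: p) => //=; rewrite xz.
Qed.

Lemma reach_ball (R : realType) n x : reach n x \subset @ball_vertices R G x n%:R.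
Proof.
apply/fintype.subsetP => y /reach_walk[p xp pn]; rewrite inE.
apply: (@le_trans _ _ (size p)%:R%:E).
  by apply: ereal_inf_lbound; exists p.
by rewrite lee_fin ler_nat.
Qed.

Lemma card_reach_growth (R : realType) (A eps : R) n x : 0 < eps ->
  in_Growth G A eps -> #|reach n x|%:R <= A * expR (eps * n.+1%:R).
Proof.
move=> eps0 /(_ n.+1%:R) H.
have := subset_leq_card (fintype.subset_trans (reach_sub n x) (@reach_ball R n.+1 x)).
move=> h; apply: (le_trans _ (H _)); last by rewrite ler1n.
by rewrite ler_nat (leq_trans h)// /volume_growth leq_bigmax.
Qed.

(** Walk distance, capped at m so that it is finite between different components. *)
Definition capdist m x v : nat := find (fun n => v \in reach n x) (iota 0 m).

Lemma capdist_notin m x v n : (n < capdist m x v)%N -> v \notin reach n x.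
Proof.
move=> nd; have := before_find 0%N nd; rewrite nth_iota ?add0n.
  by move=> ->.
by apply: leq_trans nd _; rewrite -[leqRHS](size_iota 0 m) find_size.
Qed.

(** Either the cap is attained, or the distance n < m is itself one of the indices
    of the sum. *)
Lemma exp_capdist_le (R : realType) (rho : R) m x v : 0 <= rho ->
  rho ^+ capdist m x v <= rho ^+ m + \sum_(n < m) rho ^+ n * (v \in reach n x)%:R.
Proof.
move=> r0; have [H|H] := boolP (has (fun n => v \in reach n x) (iota 0 m)).
  have dm : (capdist m x v < m)%N by move: H; rewrite has_find size_iota.
  rewrite (bigD1 (Ordinal dm))//=.
  have := nth_find 0%N H; rewrite nth_iota// add0n => ->.
  rewrite mulr1 addrCA lerDl addr_ge0 ?exprn_ge0// sumr_ge0// => n _.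
  by rewrite mulr_ge0 ?exprn_ge0.
rewrite /capdist (hasNfind H) size_iota lerDl sumr_ge0// => n _.
by rewrite mulr_ge0 ?exprn_ge0.
Qed.

Lemma capdistC m x v : capdist m x v = capdist m v x.
Proof. by rewrite /capdist; apply: eq_find => n; rewrite reach_sym. Qed.

(** The number of vertices within distance n grows at rate eps at most, so the weight
    exp (- 2 eps n) leaves a geometric series of ratio exp (- eps). *)
Lemma sum_exp_capdist (R : realType) (A eps : R) m x : 0 < eps -> 0 < A ->
  in_Growth G A eps -> #|G|%:R * expR (- 2 * eps) ^+ m <= 1 ->
  \sum_v expR (- 2 * eps) ^+ capdist m x v <=
    1 + A * expR eps / (1 - expR (- eps)).
Proof.
move=> eps0 A0 gr Gm; set rho := expR _.
have r0 : 0 <= rho by exact: expR_ge0.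
apply: (@le_trans _ _ (\sum_(v : G) (rho ^+ m + \sum_(n < m) rho ^+ n * (v \in reach n x)%:R))).
  by apply: ler_sum => v _; exact: exp_capdist_le.
rewrite big_split/= lerD//; first by rewrite sumr_const -[leLHS]mulr_natl.
rewrite exchange_big/=.
have e1 : expR (- eps) < 1 by rewrite -expR0 ltr_expR oppr_lt0.
have step n : \sum_(v : G) rho ^+ n * (v \in reach n x)%:R <=
    A * expR eps * expR (- eps) ^+ n.
  rewrite -mulr_sumr -natr_sum -(_ : #|reach n x| = \sum_(v : G) (v \in reach n x))%N; last first.
    by rewrite -sum1_card big_mkcond; apply: eq_bigr => v _; case: (v \in _).
  apply: (@le_trans _ _ (rho ^+ n * (A * expR (eps * n.+1%:R)))).
    by rewrite ler_wpM2l ?exprn_ge0//; exact: card_reach_growth.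
  rewrite mulrCA -mulrA ler_pM2l// /rho -!expRM_natl -!expRD ler_expR.
  rewrite -[in leLHS]natr1; lra.
apply: (le_trans (ler_sum _ (fun (n : 'I_m) _ => step n))).
rewrite -mulr_sumr ler_wpM2l ?mulr_ge0 ?expR_ge0 ?(ltW A0)//.
have := subrX1 (expR (- eps)) m; rewrite (eq_bigr (fun n : 'I_m => expR (- eps) ^+ n)); last first.
  by move=> n _; rewrite ?expr1n ?mulr1.
move=> h; rewrite -[leRHS]mul1r ler_pdivlMr ?subr_gt0//.
have := exprn_ge0 m (expR_ge0 (- eps)); nra.
Qed.

End Reach.

(** * Decay of the influence of a deletion *)

Section Decay.
Variables (R : realType) (G : sgraph) (w : edge G -> R) (nu : G -> R).
Implicit Types (x v : G) (S : {set G}).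

Definition total_activity x : R := \sum_(e : edge G | x \in val e) activity w nu x e.

(** By [monomer_rec] it bounds the probability that x is covered, whatever the vertex
    set, and by [reldist_contract] it is the factor gained at x. *)
Definition contraction x : R := total_activity x / (1 + total_activity x).

(** Sum over the self-avoiding walks of length n in S starting at x of the s-th power of
    the product of the factors met.  Sums of powers replace the maximum of the
    products: they are easy to average, and a large s undoes the number of walks. *)
Fixpoint walks (s n : nat) S x : R :=
  if n is n'.+1 then
    contraction x ^+ s * \sum_(e : edge G | (x \in val e) && (other_end e x \in S :\ x))
                      walks s n' (S :\ x) (other_end e x)
  else 1.

Lemma total_activity_ge0 x : 0 <= total_activity x.
Proof. by apply: sumr_ge0 => e _; exact: activity_ge0. Qed.

Lemma contraction_ge0 x : 0 <= contraction x.
Proof. by rewrite divr_ge0 ?addr_ge0 ?total_activity_ge0. Qed.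

Lemma contraction_le1 x : contraction x <= 1.
Proof.
by rewrite ler_pdivrMr ?mul1r ?lerDr// ltr_pwDl// total_activity_ge0.
Qed.

(** Iterating [reldist_contract] along the recursion.  As long as v is out of reach
    the two recursions run over the same edges; at the end the relative distance
    is at most 1. *)
Lemma monomer_decay s n S x v :
  (forall m, (m < n)%N -> v \notin reach m x) -> x \in S ->
  reldist (monomer w nu S x) (monomer w nu (S :\ v) x) ^+ s.+1 <= walks s.+1 n S x.
Proof.
elim: n S x => [|n IH] S x vx xS /=.
  by rewrite exprn_ile1 ?reldist_ge0 ?reldist_le1 ?monomer_ge0.
have xv : x != v by have := vx 0%N isT; rewrite inE eq_sym.
have xSv : x \in S :\ v by rewrite !inE xv.
rewrite (monomer_rec _ _ xS) (monomer_rec _ _ xSv).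
have -> : (S :\ v) :\ x = (S :\ x) :\ v by apply/setP => y; rewrite !inE andbCA.
set a := fun e : edge G => monomer w nu (S :\ x) (other_end e x).
set b := fun e : edge G => monomer w nu ((S :\ x) :\ v) (other_end e x).
pose M := \big[Num.max/0]_(e : edge G | x \in val e) reldist (a e) (b e).
have ab0 e : 0 <= reldist (a e) (b e) by rewrite reldist_ge0 ?monomer_ge0.
have M0 : 0 <= M by apply: bigmax_ge_id.
have := @reldist_contract R _ (fun e : edge G => x \in val e) (activity w nu x) a b M
  (total_activity x) (activity_ge0 w nu x) => H.
apply: (@le_trans _ _ ((contraction x * M) ^+ s.+1)).
  have sg0 (c : edge G -> R) : (forall e, 0 <= c e) ->
      0 <= (1 + \sum_(e : edge G | x \in val e) activity w nu x e * c e)^-1.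
    move=> c0; rewrite invr_ge0 addr_ge0// sumr_ge0// => e _.
    by rewrite mulr_ge0 ?activity_ge0.
  apply: lerXn2r; [|by rewrite nnegrE mulr_ge0 ?contraction_ge0|].
    by rewrite nnegrE reldist_ge0// sg0// => e; exact: monomer_ge0.
  apply: H => //.
  - by move=> e; rewrite monomer_ge0 monomer_le1.
  - by move=> e; rewrite monomer_ge0 monomer_le1.
  - by move=> e xe; exact: (le_bigmax_cond _ (fun e => reldist (a e) (b e))).
rewrite exprMn ler_wpM2l ?exprn_ge0 ?contraction_ge0//.
apply: (le_trans (bigmax_exp_le _ _ _ ab0)).
rewrite [leRHS]big_mkcondr/=; apply: ler_sum => e xe; case: ifPn => [oS|oS].
  apply: IH => // m mn; apply: contra (vx m.+1 mn) => vo.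
  by apply/reachSP; right; exists (other_end e x) => //; have [] := other_end_spec xe.
have aE : a e = 0 by rewrite /a /monomer (negbTE oS).
have bE : b e = 0.
  by rewrite /b /monomer ifN//; apply: contra oS; rewrite 2!inE => /andP[].
by rewrite aE bE /reldist subrr normr0 mul0r expr0n.
Qed.

(** For y, t > 0 one has y <= t + y^(s+1) / t^s: either y <= t, or y / t >= 1 can be
    raised to the power s. *)
Lemma monomer_diff_le s n x v (t : R) : 0 < t ->
  (forall m, (m < n)%N -> v \notin reach m x) ->
  `|monomer w nu [set: G] x - monomer w nu ([set: G] :\ v) x| <=
    t + walks s.+1 n [set: G] x / t ^+ s.
Proof.
move=> t0 vx; have xT : x \in [set: G] by rewrite inE.
have := monomer_decay s vx xT; set a := monomer _ _ _ _; set b := monomer _ _ _ _ => H.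
have [a0 b0] : 0 <= a /\ 0 <= b by split; exact: monomer_ge0.
have rd0 := reldist_ge0 a0 b0.
have H1 : `|a - b| <= reldist a b.
  by rewrite reldistE// ler_piMr// ge_max !monomer_le1.
apply: (le_trans H1); set y := reldist a b in H rd0 *.
have [yt|ty] := leP y t.
  rewrite (le_trans yt)// lerDl divr_ge0 ?exprn_ge0 ?(ltW t0)//.
  by apply: le_trans H; rewrite exprn_ge0.
apply: (@le_trans _ _ (y ^+ s.+1 / t ^+ s)); last first.
  rewrite -[leLHS]add0r lerD ?(ltW t0)// ler_wpM2r// invr_ge0 exprn_ge0 ?(ltW t0)//.
rewrite ler_pdivlMr ?exprn_gt0// exprS ler_wpM2l//.
by rewrite lerXn2r ?nnegrE// ltW.
Qed.

End Decay.

(** * Configurations of independent weights and coordinate averages *)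

Section ConfigSpace.
Local Open Scope classical_set_scope.
Context (R : realType) (I : finType).

(** The product sigma-algebra on configurations is generated by boxes, a family
    stable under intersection on which independence determines the law. *)
Definition boxes : set (set (I -> R)) :=
  [set B | exists C : I -> set R,
     (forall i, measurable (C i)) /\ B = [set x | forall i, C i (x i)]].

Definition cfg := g_sigma_algebraType boxes.
HB.instance Definition _ := Measurable.on cfg.

(** Resampling the coordinate i. *)
Definition upd (x : I -> R) (i : I) (u : R) : cfg :=
  fun j => if j == i then u else x j.

Lemma updE (x : cfg) i u j : upd x i u j = if j == i then u else x j.
Proof. by []. Qed.

Lemma upd_upd (x : cfg) i u v : upd (upd x i u) i v = upd x i v.
Proof. by apply/funext => j; rewrite !updE; case: eqP. Qed.

Lemma updC (x : cfg) i j u v : i != j ->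
  upd (upd x i u) j v = upd (upd x j v) i u.
Proof.
move=> ij; apply/funext => k; rewrite !updE.
by case: eqP => [->|//]; case: eqP => // ji; rewrite ji eqxx in ij.
Qed.

Lemma measurable_coord (i : I) : measurable_fun setT (fun x : cfg => x i).
Proof.
move=> _ B mB; rewrite setTI; apply: sub_sigma_algebra.
exists (fun j => if j == i then B else setT); split.
  by move=> j; case: ifP.
rewrite eqEsubset; split=> [x /= Bx j|x /= /(_ i)]; last by rewrite eqxx.
by case: eqP => [->|].
Qed.

Lemma measurable_to_cfg d (T : measurableType d) (Y : T -> cfg) :
  (forall i, measurable_fun setT (fun t => Y t i)) -> measurable_fun setT Y.
Proof.
move=> mY; apply: (@measurability _ _ T cfg setT Y boxes erefl) => _ [B [C [mC ->]] <-].
rewrite setTI.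
rewrite [X in measurable X](_ : _ =
    \bigcap_(i in [set: I]) ((fun t => Y t i) @^-1` C i)); last first.
  by rewrite eqEsubset; split=> t /= H i => [_|]; exact: H.
apply: fin_bigcap_measurable => [|i _]; first exact: finite_finset.
by rewrite -[X in measurable X]setTI; exact: mY.
Qed.

Lemma measurable_upd (i : I) :
  measurable_fun setT (fun z : cfg * R => upd z.1 i z.2).
Proof.
apply: measurable_to_cfg => j; rewrite /upd.
case: (j == i); first exact: measurable_snd.
exact: (measurableT_comp (measurable_coord j) measurable_fst).
Qed.

(** Every function of the configuration that is averaged below has this form, so
    integrability is never an issue. *)
Definition bdd_meas (h : cfg -> R) :=
  measurable_fun setT h /\ exists K, forall x, `|h x| <= K.

End ConfigSpace.

Section BoundedMeasurable.
Local Open Scope classical_set_scope.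
Context (R : realType) (I : finType).
Implicit Types h g : cfg R I -> R.

Lemma bdd_meas_cst (c : R) : bdd_meas (fun _ : cfg R I => c).
Proof. by split; [exact: measurable_cst|exists `|c|]. Qed.

Lemma bdd_meas_comp (phi : R -> R) h : measurable_fun setT phi ->
  (forall K, exists K', forall y, `|y| <= K -> `|phi y| <= K') ->
  bdd_meas h -> bdd_meas (phi \o h).
Proof.
move=> mphi bphi [mh [K hK]]; split; first exact: measurableT_comp.
have [K' K'P] := bphi K; exists K' => x; exact: K'P.
Qed.

Lemma bdd_measD h g : bdd_meas h -> bdd_meas g -> bdd_meas (fun x => h x + g x).
Proof.
move=> [mh [K hK]] [mg [K' gK]]; split; first exact: measurable_funD.
by exists (K + K') => x; rewrite (le_trans (ler_normD _ _))// lerD.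
Qed.

Lemma bdd_measM h g : bdd_meas h -> bdd_meas g -> bdd_meas (fun x => h x * g x).
Proof.
move=> [mh [K hK]] [mg [K' gK]]; split; first exact: measurable_funM.
by exists (K * K') => x; rewrite normrM ler_pM.
Qed.

Lemma bdd_measZ (c : R) h : bdd_meas h -> bdd_meas (fun x => c * h x).
Proof. by move=> gh; apply: bdd_measM => //; exact: bdd_meas_cst. Qed.

Lemma bdd_measN h : bdd_meas h -> bdd_meas (fun x => - h x).
Proof.
move=> /(bdd_measZ (-1)); under eq_fun do rewrite mulN1r; exact.
Qed.

Lemma bdd_measB h g : bdd_meas h -> bdd_meas g -> bdd_meas (fun x => h x - g x).
Proof. by move=> gh gg; apply: bdd_measD => //; exact: bdd_measN. Qed.

Lemma bdd_meas_norm h : bdd_meas h -> bdd_meas (fun x => `|h x|).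
Proof.
move=> [mh [K hK]]; split; first exact: measurableT_comp.
by exists K => x; rewrite normr_id.
Qed.

Lemma bdd_meas_sum (J : Type) (s : seq J) (p : pred J) (h : J -> cfg R I -> R) :
  (forall j, bdd_meas (h j)) -> bdd_meas (fun x => \sum_(j <- s | p j) h j x).
Proof.
move=> gh; elim: s => [|j s IH].
  by under eq_fun do rewrite big_nil; exact: bdd_meas_cst.
under eq_fun do rewrite big_cons.
by case: (p j) => //; exact: bdd_measD.
Qed.

Lemma bdd_meas_prod (J : Type) (s : seq J) (p : pred J) (h : J -> cfg R I -> R) :
  (forall j, bdd_meas (h j)) -> bdd_meas (fun x => \prod_(j <- s | p j) h j x).
Proof.
move=> gh; elim: s => [|j s IH].
  by under eq_fun do rewrite big_nil; exact: bdd_meas_cst.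
under eq_fun do rewrite big_cons.
by case: (p j) => //; exact: bdd_measM.
Qed.

Lemma bdd_meas_exp h n : bdd_meas h -> bdd_meas (fun x => h x ^+ n).
Proof.
move=> gh; elim: n => [|n IH].
  by under eq_fun do rewrite expr0; exact: bdd_meas_cst.
by under eq_fun do rewrite exprS; exact: bdd_measM.
Qed.

Lemma measure_probT d (T : measurableType d) (P : probability T R) :
  fine ((P : {measure set T -> \bar R}) setT) = 1.
Proof. exact: (congr1 fine (probability_setT P)). Qed.

Lemma bounded_integrable d (T : measurableType d) (P : probability T R)
  (f : T -> R) (K : R) : measurable_fun setT f -> (forall t, `|f t| <= K) ->
  P.-integrable setT (EFin \o f).
Proof.
move=> mf fK; apply: measurable_bounded_integrable => //.
  by rewrite -ge0_fin_numE ?fin_num_measure.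
by exists K; split; [exact: num_real|move=> M /ltW KM t _ /=; exact: le_trans KM].
Qed.

Lemma bdd_meas_integrable d (T : measurableType d) (P : probability T R)
  (Y : T -> cfg R I) h : measurable_fun setT Y -> bdd_meas h ->
  P.-integrable setT (EFin \o (fun t => h (Y t))).
Proof.
move=> mY [mh [K hK]]; apply: (@bounded_integrable _ _ _ _ K) => //.
exact: (measurableT_comp mh mY).
Qed.

End BoundedMeasurable.

Section Averaging.
Local Open Scope classical_set_scope.
Context (R : realType) (I : finType) (mu : I -> probability R R).
Implicit Types h g : cfg R I -> R.

(** Average over the coordinate i.  For an independent configuration this is the
    conditional expectation given all other coordinates. *)
Definition avg (i : I) h : cfg R I -> R :=
  fun x => \int[mu i]_u h (upd x i u).

Lemma measurable_upd2 (x : cfg R I) i : measurable_fun setT (fun u : R => upd x i u).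
Proof. exact: (measurable_fun_pair2 x (measurable_upd i)). Qed.

Lemma avg_integrable h i x : bdd_meas h ->
  (mu i).-integrable setT (EFin \o (fun u => h (upd x i u))).
Proof. by move=> gh; apply: bdd_meas_integrable => //; exact: measurable_upd2. Qed.
Hint Resolve avg_integrable : core.

Lemma avg_cst c i x : avg i (fun=> c) x = c.
Proof.
by rewrite /avg Rintegral_cst// measure_probT mulr1.
Qed.

Lemma avg_indep h i : (forall x u, h (upd x i u) = h x) -> avg i h = h.
Proof.
move=> hi; apply/funext => x; rewrite /avg.
by under eq_Rintegral do rewrite hi; exact: avg_cst.
Qed.

Lemma avg_upd h i x u : avg i h (upd x i u) = avg i h x.
Proof. by rewrite /avg; apply: eq_Rintegral => v _; rewrite upd_upd. Qed.

Lemma avgD h g i x : bdd_meas h -> bdd_meas g ->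
  avg i (fun y => h y + g y) x = avg i h x + avg i g x.
Proof. by move=> gh gg; rewrite /avg RintegralD//; exact: avg_integrable. Qed.

Lemma avgB h g i x : bdd_meas h -> bdd_meas g ->
  avg i (fun y => h y - g y) x = avg i h x - avg i g x.
Proof. by move=> gh gg; rewrite /avg RintegralB//; exact: avg_integrable. Qed.

Lemma avgMl h g i x : bdd_meas g -> (forall x u, h (upd x i u) = h x) ->
  avg i (fun y => h y * g y) x = h x * avg i g x.
Proof.
move=> gg hi; rewrite /avg; under eq_Rintegral do rewrite hi.
by rewrite RintegralZl//; exact: avg_integrable.
Qed.

Lemma avgMr h g i x : bdd_meas g -> (forall x u, h (upd x i u) = h x) ->
  avg i (fun y => g y * h y) x = avg i g x * h x.
Proof.
by move=> gg hi; under eq_fun do rewrite mulrC; rewrite avgMl// mulrC.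
Qed.

Lemma le_avg h g i x : bdd_meas h -> bdd_meas g -> (forall x, h x <= g x) ->
  avg i h x <= avg i g x.
Proof.
by move=> gh gg hg; apply: le_Rintegral => //; exact: avg_integrable.
Qed.

Lemma ler_norm_avg h i x : bdd_meas h -> `|avg i h x| <= avg i (fun y => `|h y|) x.
Proof. by move=> gh; apply: le_normr_Rintegral => //; exact: avg_integrable. Qed.

Lemma norm_avg_le h i K x : bdd_meas h -> (forall x, `|h x| <= K) -> `|avg i h x| <= K.
Proof.
move=> gh hK; apply: (le_trans (ler_norm_avg _ _ gh)).
rewrite -[leRHS](avg_cst K i x); apply: le_avg => //; first exact: bdd_meas_norm.
exact: bdd_meas_cst.
Qed.

(** Tonelli's theorem gives measurability for nonnegative functions, hence the
    shift of h by one of its bounds. *)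
Lemma bdd_meas_avg h i : bdd_meas h -> bdd_meas (avg i h).
Proof.
move=> gh; split; last first.
  by have [_ [K hK]] := gh; exists K => x; exact: norm_avg_le.
have [mh [K hK]] := gh.
have h0 (z : cfg R I * R) : (0 <= (h (upd z.1 i z.2) + K)%:E)%E.
  by rewrite lee_fin; have := hK (upd z.1 i z.2); rewrite ler_norml => /andP[]; lra.
have mf : measurable_fun setT (fun z : cfg R I * R => (h (upd z.1 i z.2) + K)%:E).
  apply/measurable_EFinP; apply: measurable_funD => //.
  exact: (measurableT_comp mh (measurable_upd i)).
have mF := measurable_fun_fubini_tonelli_F (m2 := mu i) _ mf h0.
rewrite (_ : avg i h = (fun x => fine (fubini_F (mu i) (fun z : cfg R I * R => (h (upd z.1 i z.2) + K)%:E) x) - K)).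
  apply: measurable_funB => //; exact: (measurableT_comp (@fine_measurable R setT measurableT) mF).
apply/funext => x; rewrite /fubini_F/=.
rewrite -[fine _]/(avg i (fun y => h y + K) x) avgD//; last exact: bdd_meas_cst.
by rewrite avg_cst addrK.
Qed.

(** Fubini's theorem. *)
Lemma avgC h i j x : bdd_meas h -> avg i (avg j h) x = avg j (avg i h) x.
Proof.
move=> gh; have [->//|ij] := eqVneq i j.
have mY : measurable_fun setT (fun z : R * R => upd (upd x i z.1) j z.2).
  have m1 : measurable_fun setT (fun z : R * R => (upd x i z.1, z.2)).
    apply: measurable_fun_pair; last exact: measurable_snd.
    exact: (measurableT_comp (measurable_upd2 x i) measurable_fst).
  exact: (measurableT_comp (measurable_upd j) m1).
have iE : forall (f : cfg R I -> R) (k : I) (y : cfg R I), bdd_meas f ->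
    (\int[mu k]_u (f (upd y k u))%:E)%E = (avg k f y)%:E.
  move=> f k y gf; rewrite /avg /Rintegral fineK//.
  exact: integrable_fin_num (avg_integrable _ _ gf).
have [mh [K hK]] := gh.
have int : (mu i \x mu j)%E.-integrable setT
    (EFin \o (fun z : R * R => h (upd (upd x i z.1) j z.2))).
  apply: measurable_bounded_integrable => //.
  - have : ((mu i \x mu j)%E ([set: R] `*` [set: R]) < +oo)%E.
      by rewrite product_measure1E// -ge0_fin_numE ?mule_ge0// fin_numM// fin_num_measure.
    by rewrite setXTT.
  - exact: (measurableT_comp mh mY).
  - exists K; split; first exact: num_real.
    by move=> M /ltW KM z _ /=; exact: le_trans KM.
have := Fubini int; rewrite /fubini_F /fubini_G /=.
under eq_integral do rewrite iE//.
under [RHS]eq_integral => v _.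
  under eq_integral do rewrite updC//.
  rewrite iE//.
  over.
rewrite !iE; [|exact: bdd_meas_avg..].
by move=> [].
Qed.

End Averaging.

Section Expectation.
Local Open Scope classical_set_scope.
Context (R : realType) (I : finType) (mu : I -> probability R R).
Context d (T : measurableType d) (P : probability T R) (X : I -> {RV P >-> R}).
Hypothesis lawX : forall i, has_law (X i) (mu i).
Hypothesis indX : mutually_independent X.
Implicit Types h g : cfg R I -> R.

Definition config_of (t : T) : cfg R I := fun i => X i t.

Definition Ex h : R := \int[P]_t h (config_of t).

Lemma measurable_config_of : measurable_fun setT config_of.
Proof. by apply: measurable_to_cfg => i; exact: measurable_funPT. Qed.

Lemma Ex_integrable h : bdd_meas h -> P.-integrable setT (EFin \o (fun t => h (config_of t))).
Proof. by apply: bdd_meas_integrable; exact: measurable_config_of. Qed.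

Lemma ExE h : bdd_meas h -> (\int[P]_t (h (config_of t))%:E)%E = (Ex h)%:E.
Proof.
move=> gh; rewrite /Ex /Rintegral fineK//.
exact: integrable_fin_num (Ex_integrable gh).
Qed.

Lemma prob_box (C : I -> set R) : (forall i, measurable (C i)) ->
  P [set t | forall i, C i (X i t)] = (\prod_i mu i (C i))%E.
Proof.
move=> mC; have := indX [set: I]%SET mC.
rewrite (_ : [set t | _] = [set t | forall i, C i (X i t)]); last first.
  by rewrite eqEsubset; split=> t /= H i => [|_]; apply: H; rewrite ?inE.
move=> ->; apply: eq_big => [i|i _]; first by rewrite inE.
by rewrite -lawX.
Qed.

(** Resampling one coordinate from its own law preserves the joint law: both laws
    give a box the product of the marginal masses. *)
Lemma resample_law i (B : set (cfg R I)) : measurable B ->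
  pushforward P config_of B =
  pushforward (P \x mu i)%E (fun z : T * R => upd (config_of z.1) i z.2) B.
Proof.
move=> mB.
have mu2 : measurable_fun setT (fun z : T * R => upd (config_of z.1) i z.2).
  have m1 : measurable_fun setT (fun z : T * R => (config_of z.1, z.2)).
    apply: measurable_fun_pair; last exact: measurable_snd.
    exact: (measurableT_comp measurable_config_of measurable_fst).
  exact: (measurableT_comp (measurable_upd i) m1).
pose m1 := measure_function_pushforward__canonical__measure_function_Measure P measurable_config_of.
pose m2 := measure_function_pushforward__canonical__measure_function_Measure (P \x mu i)%E mu2.
have := @measure_unique _ R (cfg R I) (@boxes R I) (fun=> setT) erefl.
move=> /(_ _ _ _ m1 m2); apply => //.
- move=> _ _ [C [mC ->]] [C' [mC' ->]]; exists (fun j => C j `&` C' j); split.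
    by move=> j; exact: measurableI.
  rewrite eqEsubset; split=> x /= => [[H H'] j|H]; first by split.
  by split=> j; have [] := H j.
- move=> _; exists (fun=> setT); split=> //.
  by rewrite eqEsubset; split.
- by rewrite bigcup_const//; exists 0%N.
- move=> _ [C [mC ->]].
  change (P [set t | forall j, C j (X j t)] = (P \x mu i)%E
    [set z : T * R | forall j, C j (upd (config_of z.1) i z.2 j)]).
  rewrite (prob_box mC).
  pose C' j := if j == i then setT else C j.
  have mC' j : measurable (C' j) by rewrite /C'; case: eqP.
  rewrite [X in (_ \x _)%E X](_ : _ = [set t | forall j, C' j (X j t)] `*` C i); last first.
    rewrite eqEsubset; split=> -[t u] /= => [H|[H H'] j].
      split=> [j|]; last by have := H i; rewrite updE eqxx.
      by rewrite /C'; case: eqP => // ji; have := H j; rewrite updE; case: eqP.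
    by rewrite updE; have := H j; rewrite /C'; case: eqP => // ->.
  rewrite product_measure1E//; last first.
    rewrite -[X in measurable X]setTI.
    apply: (measurable_config_of measurableT (Y := [set x | forall j, C' j (x j)])).
    by apply: sub_sigma_algebra; exists C'; split.
  rewrite [X in (_ = X * _)%E](prob_box mC') (bigD1 i)//= [in RHS](bigD1 i)//= {1}/C' eqxx.
  rewrite [X in (_ = X * _ * _)%E](_ : _ = 1%E); last exact: (probability_setT (mu i)).
  rewrite mul1e muleC; congr (_ * _)%E.
  by apply: eq_bigr => j ji; rewrite /C' (negbTE ji).
- by move=> _; rewrite /= /pushforward preimage_setT -ge0_fin_numE ?fin_num_measure.
Qed.

Lemma Ex_avg h i : bdd_meas h -> Ex (avg mu i h) = Ex h.
Proof.
move=> gh; have [mh [K hK]] := gh.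
pose f := fun z : T * R => upd (config_of z.1) i z.2.
have mf : measurable_fun setT f.
  have m1 : measurable_fun setT (fun z : T * R => (config_of z.1, z.2)).
    apply: measurable_fun_pair; last exact: measurable_snd.
    exact: (measurableT_comp measurable_config_of measurable_fst).
  exact: (measurableT_comp (measurable_upd i) m1).
have int : (P \x mu i)%E.-integrable setT (EFin \o (h \o f)).
  apply: measurable_bounded_integrable => //.
  - have : ((P \x mu i)%E ([set: T] `*` [set: R]) < +oo)%E.
      by rewrite product_measure1E// -ge0_fin_numE ?mule_ge0// fin_numM// fin_num_measure.
    by rewrite setXTT.
  - exact: (measurableT_comp mh mf).
  - exists K; split; first exact: num_real.
    by move=> M /ltW KM z _ /=; exact: le_trans KM.
rewrite /Ex /Rintegral; congr fine.
transitivity (\int[P]_x fubini_F (mu i) (EFin \o (h \o f)) x)%E.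
  apply: eq_integral => t _; rewrite /fubini_F /avg /Rintegral fineK//.
  exact: integrable_fin_num (avg_integrable mu i (config_of t) gh).
rewrite (integral12_prod_meas1 int).
have mhE : measurable_fun setT (EFin \o h) by exact/measurable_EFinP.
transitivity (\int[pushforward (P \x mu i)%E f]_y (h y)%:E)%E.
  by rewrite integral_pushforward//= preimage_setT.
transitivity (\int[pushforward P config_of]_y (h y)%:E)%E.
  apply: eq_measure_integral => [|? A mA _]; first exact: measurable_config_of.
  exact: (esym (resample_law i mA)).
rewrite (integral_pushforward measurable_config_of mhE)// ?preimage_setT//.
exact: Ex_integrable.
Qed.

Lemma Ex_cst c : Ex (fun=> c) = c.
Proof. by rewrite /Ex Rintegral_cst// measure_probT mulr1. Qed.

Lemma ExD h g : bdd_meas h -> bdd_meas g -> Ex (fun x => h x + g x) = Ex h + Ex g.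
Proof. by move=> gh gg; rewrite /Ex RintegralD//; exact: Ex_integrable. Qed.

Lemma ExB h g : bdd_meas h -> bdd_meas g -> Ex (fun x => h x - g x) = Ex h - Ex g.
Proof. by move=> gh gg; rewrite /Ex RintegralB//; exact: Ex_integrable. Qed.

Lemma ExZ c h : bdd_meas h -> Ex (fun x => c * h x) = c * Ex h.
Proof. by move=> gh; rewrite /Ex RintegralZl//; exact: Ex_integrable. Qed.

Lemma le_Ex h g : bdd_meas h -> bdd_meas g -> (forall x, h x <= g x) -> Ex h <= Ex g.
Proof. by move=> gh gg hg; apply: le_Rintegral => //; exact: Ex_integrable. Qed.

Lemma ler_norm_Ex h : bdd_meas h -> `|Ex h| <= Ex (fun x => `|h x|).
Proof. by move=> gh; apply: le_normr_Rintegral => //; exact: Ex_integrable. Qed.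

Lemma Ex_sum (J : Type) (s : seq J) (h : J -> cfg R I -> R) :
  (forall j, bdd_meas (h j)) -> Ex (fun x => \sum_(j <- s) h j x) = \sum_(j <- s) Ex (h j).
Proof.
move=> gh; elim: s => [|j s IH].
  by rewrite big_nil; under [X in Ex X]eq_fun do rewrite big_nil; exact: Ex_cst.
under [X in Ex X]eq_fun do rewrite big_cons.
by rewrite big_cons ExD//= ?IH//; exact: bdd_meas_sum.
Qed.

End Expectation.

(** * Martingale differences and covariances *)

Section IteratedAverages.
Local Open Scope classical_set_scope.
Context (R : realType) (I : finType) (mu : I -> probability R R).
Context d (T : measurableType d) (P : probability T R) (X : I -> {RV P >-> R}).
Hypothesis lawX : forall i, has_law (X i) (mu i).
Hypothesis indX : mutually_independent X.
Implicit Types h g : cfg R I -> R.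
Local Notation A := (avg mu).
Local Notation E := (Ex X).

(** The head of the list is averaged first. *)
Definition iter_avg (l : seq I) h : cfg R I -> R := foldl (fun g i => A i g) h l.

Lemma bdd_meas_iter_avg l h : bdd_meas h -> bdd_meas (iter_avg l h).
Proof.
by elim: l h => //= i l IH h gh; apply: IH; exact: bdd_meas_avg.
Qed.

Lemma iter_avgB l h g x : bdd_meas h -> bdd_meas g ->
  iter_avg l (fun y => h y - g y) x = iter_avg l h x - iter_avg l g x.
Proof.
elim: l h g => //= i l IH h g gh gg.
rewrite (_ : A i _ = (fun y => A i h y - A i g y)).
  by rewrite IH//; exact: bdd_meas_avg.
by apply/funext => y; rewrite avgB.
Qed.

Lemma avg_sum i (s : seq I) (g : I -> cfg R I -> R) : (forall k, bdd_meas (g k)) ->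
  A i (fun x => \sum_(k <- s) g k x) = (fun x => \sum_(k <- s) A i (g k) x).
Proof.
move=> gg; apply/funext => x; elim: s => [|k s IH].
  by under [X in A i X]eq_fun do rewrite big_nil; rewrite big_nil avg_cst.
under [X in A i X]eq_fun do rewrite big_cons.
by rewrite big_cons avgD//= ?IH//; exact: bdd_meas_sum.
Qed.

Lemma iter_avg_sum l (s : seq I) (g : I -> cfg R I -> R) : (forall k, bdd_meas (g k)) ->
  iter_avg l (fun x => \sum_(k <- s) g k x) = (fun x => \sum_(k <- s) iter_avg l (g k) x).
Proof.
elim: l g => //= i l IH g gg; rewrite avg_sum// IH// => k; exact: bdd_meas_avg.
Qed.

Lemma avg_iter_avg i l h : bdd_meas h -> A i (iter_avg l h) = iter_avg l (A i h).
Proof.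
elim: l h => //= j l IH h gh; rewrite IH; last exact: bdd_meas_avg.
by congr (iter_avg l _); apply/funext => x; rewrite avgC.
Qed.

Lemma Ex_iter_avg l h : bdd_meas h -> E (iter_avg l h) = E h.
Proof.
elim: l h => //= i l IH h gh; rewrite IH; last exact: bdd_meas_avg.
exact: Ex_avg.
Qed.

Lemma norm_iter_avg_le l h K x : bdd_meas h -> (forall x, `|h x| <= K) ->
  `|iter_avg l h x| <= K.
Proof.
elim: l h => //= i l IH h gh hK; apply: IH; first exact: bdd_meas_avg.
by move=> y; exact: norm_avg_le.
Qed.

Lemma Ex_norm_avg_le i h : bdd_meas h -> E (fun x => `|A i h x|) <= E (fun x => `|h x|).
Proof.
move=> gh; rewrite -[leRHS](Ex_avg lawX indX i (bdd_meas_norm gh)).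
apply: le_Ex; [exact/bdd_meas_norm/bdd_meas_avg|exact/bdd_meas_avg/bdd_meas_norm|].
by move=> x; exact: ler_norm_avg.
Qed.

Lemma Ex_norm_iter_avg_le l h : bdd_meas h ->
  E (fun x => `|iter_avg l h x|) <= E (fun x => `|h x|).
Proof.
elim: l h => //= i l IH h gh.
by apply: (le_trans (IH _ (bdd_meas_avg _ _ gh))); exact: Ex_norm_avg_le.
Qed.

Lemma iter_avg_upd l h i x u : bdd_meas h -> i \in l -> iter_avg l h (upd x i u) = iter_avg l h x.
Proof.
elim: l h x => //= j l IH h x gh; rewrite inE.
have [->|ij] := eqVneq i j => /= [_|il]; last by rewrite IH//; exact: bdd_meas_avg.
by rewrite -avg_iter_avg// avg_upd.
Qed.

(** After averaging over all coordinates the function depends on none of them, hence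
    is constant, and averaging preserves the mean. *)
Lemma iter_avg_enum h x : bdd_meas h -> iter_avg (enum I) h x = E h.
Proof.
move=> gh; have upd0 y i u : iter_avg (enum I) h (upd y i u) = iter_avg (enum I) h y.
  by rewrite iter_avg_upd// mem_enum.
have cst y : iter_avg (enum I) h y = iter_avg (enum I) h x.
  suff H (s : seq I) :
      iter_avg (enum I) h (fun i => if i \in s then y i else x i) = iter_avg (enum I) h x.
    rewrite -(H (enum I)); congr (iter_avg _ _ _); apply/funext => i.
    by rewrite mem_enum.
  elim: s => [|i s IH]; first by congr (iter_avg _ _ _).
  rewrite -[RHS]IH -[RHS](upd0 _ i (y i)); congr (iter_avg _ _ _).
  by apply/funext => j; rewrite updE inE; case: eqP => [->|].
rewrite -(Ex_iter_avg (enum I) gh) -[LHS](Ex_cst X).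
by congr (E _); apply/funext => y.
Qed.

(** Difference of two successive conditional means of h when the coordinates are
    averaged out one by one, from the last to the first: the coordinates after i
    have been averaged, and i is being averaged. *)
Definition mart_diff h i : cfg R I -> R :=
  iter_avg (drop (index i (enum I)).+1 (enum I)) (fun x => h x - A i h x).

Lemma bdd_meas_residual h i : bdd_meas h -> bdd_meas (fun x => h x - A i h x).
Proof. by move=> gh; apply: bdd_measB => //; exact: bdd_meas_avg. Qed.
Hint Resolve bdd_meas_residual : core.

Lemma bdd_meas_mart_diff h i : bdd_meas h -> bdd_meas (mart_diff h i).
Proof. by move=> gh; exact/bdd_meas_iter_avg/bdd_meas_residual. Qed.

Lemma iter_avg_telescope l h x : bdd_meas h -> uniq l ->
  h x - iter_avg l h x =
  \sum_(i <- l) iter_avg (drop (index i l).+1 l) (fun x => h x - A i h x) x.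
Proof.
move=> gh; elim: l => [|j l IH] /=; first by rewrite big_nil subrr.
move=> /andP[jl ul]; rewrite big_cons eqxx drop0 /= iter_avgB//; last exact: bdd_meas_avg.
rewrite (eq_big_seq (fun i => iter_avg (drop (index i l).+1 l) (fun x => h x - A i h x) x)).
  by rewrite -IH//; ring.
by move=> i il /=; case: eqP => // ji; rewrite ji il in jl.
Qed.

Lemma mart_diff_sum h x : bdd_meas h -> h x - E h = \sum_i mart_diff h i x.
Proof.
move=> gh; rewrite -[in LHS](iter_avg_enum x gh) iter_avg_telescope ?enum_uniq//.
by rewrite big_enum.
Qed.

Lemma avg_mart_diff h i x : bdd_meas h -> A i (mart_diff h i) x = 0.
Proof.
move=> gh; rewrite /mart_diff avg_iter_avg//; last exact: bdd_meas_residual.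
rewrite (_ : A i _ = fun=> 0); first elim: (drop _ _) => //= j l IH.
  by rewrite (_ : A j _ = fun=> 0)//; apply/funext => y; exact: avg_cst.
apply/funext => y; rewrite avgB//; last exact: bdd_meas_avg.
by rewrite [A i (A i h)]avg_indep ?subrr// => z u; exact: avg_upd.
Qed.

(** Sum the differences of h to h - E h.  As the i-th one has mean 0 in the coordinate
    i, subtracting from g its average over i leaves the i-th mean unchanged. *)
Lemma covariance_mart_diff h g : bdd_meas h -> bdd_meas g ->
  E (fun x => (h x - E h) * g x) =
  \sum_i E (fun x => mart_diff h i x * (g x - A i g x)).
Proof.
move=> gh gg.
transitivity (E (fun x => \sum_i mart_diff h i x * g x)).
  by congr (E _); apply/funext => x; rewrite mart_diff_sum// mulr_suml.
rewrite Ex_sum; last by move=> i; apply: bdd_measM => //; exact: bdd_meas_mart_diff.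
apply: eq_bigr => i _; apply/eqP; rewrite -subr_eq0 -ExB; first last.
- by apply: bdd_measM; [exact: bdd_meas_mart_diff|exact: bdd_meas_residual].
- by apply: bdd_measM => //; exact: bdd_meas_mart_diff.
have gA : bdd_meas (A i g) by exact: bdd_meas_avg.
rewrite (_ : (fun x => _) = (fun x => mart_diff h i x * A i g x)); last first.
  by apply/funext => x; ring.
rewrite -(Ex_avg lawX indX i); last by apply: bdd_measM => //; exact: bdd_meas_mart_diff.
rewrite (_ : A i _ = fun=> 0) ?Ex_cst//; apply/funext => x.
rewrite avgMr ?avg_mart_diff ?mul0r//; first exact: bdd_meas_mart_diff.
by move=> y u; exact: avg_upd.
Qed.

End IteratedAverages.

(** * Normal approximation for functions of independent variables *)

Section SteinCoefficient.
Local Open Scope classical_set_scope.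
Context (R : realType) (I : finType) (mu : I -> probability R R).
Context d (T : measurableType d) (P : probability T R) (X : I -> {RV P >-> R}).
Hypothesis lawX : forall i, has_law (X i) (mu i).
Hypothesis indX : mutually_independent X.
Local Notation A := (avg mu).
Local Notation E := (Ex X).
Variable F : cfg R I -> R.
Hypothesis gF : bdd_meas F.
Hypothesis oscF : forall x i u, `|F x - F (upd x i u)| <= 1.
Local Notation v k := (fun x => F x - A k F x).
Local Notation D k := (mart_diff mu F k).

Let gv k : bdd_meas (v k). Proof. exact: bdd_meas_residual. Qed.
Let gD k : bdd_meas (D k). Proof. exact: bdd_meas_mart_diff. Qed.

Lemma residualE h k x : bdd_meas h -> h x - A k h x = \int[mu k]_u (h x - h (upd x k u)).
Proof.
move=> gh; rewrite RintegralB//; last exact: avg_integrable.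
  by congr (_ - _); rewrite Rintegral_cst// measure_probT mulr1.
apply: (@bounded_integrable _ _ _ _ _ `|h x|) => //.
Qed.

Lemma norm_residual_le1 k x : `|v k x| <= 1.
Proof.
rewrite /= residualE//.
have int : (mu k).-integrable setT (EFin \o (fun u => F x - F (upd x k u))).
  apply: (@bounded_integrable _ _ _ _ _ 1) => //.
  apply: measurable_funB => //; apply: (measurableT_comp gF.1).
  exact: measurable_upd2.
apply: (le_trans (le_normr_Rintegral measurableT int)).
rewrite -[leRHS](_ : \int[mu k]_u 1 = 1); last first.
  by rewrite Rintegral_cst// measure_probT mulr1.
apply: le_Rintegral => //.
- exact: integrable_norm int.
- by apply: (@bounded_integrable _ _ _ _ _ 1) => // t; rewrite normr1.
Qed.

Lemma norm_mart_diff_le1 k x : `|D k x| <= 1.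
Proof. by apply: norm_iter_avg_le => // y; exact: norm_residual_le1. Qed.

(** The random variable T such that E ((F - E F) f(F)) is close to E (f'(F) T). *)
Definition stein_coef : cfg R I -> R := fun x => \sum_k D k x * v k x.

Lemma bdd_meas_stein_coef : bdd_meas stein_coef.
Proof. by apply: bdd_meas_sum => k; exact: bdd_measM. Qed.

Let tau k := fun x => D k x * v k x.
Let gtau k : bdd_meas (tau k). Proof. exact: bdd_measM. Qed.
Let delta i k := fun x => tau k x - A i (tau k) x.
Let gdelta i k : bdd_meas (delta i k). Proof. exact: bdd_meas_residual. Qed.

Lemma Ex_norm_prod_le h g K : bdd_meas h -> bdd_meas g -> (forall x, `|g x| <= K) ->
  E (fun x => `|h x * g x|) <= K * E (fun x => `|h x|).
Proof.
move=> gh gg gK; rewrite -ExZ; last exact: bdd_meas_norm.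
apply: le_Ex; [exact/bdd_meas_norm/bdd_measM|exact/bdd_measZ/bdd_meas_norm|].
by move=> x; rewrite normrM mulrC ler_wpM2r.
Qed.

(** Leibniz rule for 1 - A_i on the product D_k v_k.  Since A_i commutes with the
    averages that define D_k, the difference (1 - A_i) D_k is an average of
    (1 - A_i) v_k, hence not larger in mean. *)
Lemma Ex_delta_le i k : E (fun x => `|delta i k x|) <=
  3 * E (fun x => `|v k x - A i (v k) x|).
Proof.
set b := E (fun x => `|v k x - A i (v k) x|).
pose w x := D k x - A i (D k) x.
have gw : bdd_meas w by exact: bdd_meas_residual.
have gvi : bdd_meas (fun x => v k x - A i (v k) x) by apply: bdd_measB => //; exact: bdd_meas_avg.
have gAD : bdd_meas (A i (D k)) by exact: bdd_meas_avg.
have wE : w = iter_avg mu (drop (index k (enum I)).+1 (enum I))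
               (fun x => v k x - A i (v k) x).
  apply/funext => x; rewrite iter_avgB//; last exact: bdd_meas_avg.
  by rewrite -avg_iter_avg.
have wb : E (fun x => `|w x|) <= b by rewrite wE; exact: Ex_norm_iter_avg_le.
have dE x : delta i k x = (w x * v k x + (v k x - A i (v k) x) * A i (D k) x)
   - A i (fun y => w y * v k y) x.
  have -> : A i (fun y => w y * v k y) x = A i (tau k) x - A i (D k) x * A i (v k) x.
    rewrite (_ : (fun y => w y * v k y) = (fun y => tau k y - A i (D k) y * v k y)).
      rewrite (@avgB _ _ mu (tau k) (fun y => A i (D k) y * v k y))//; last exact: (bdd_measM gAD (gv k)).
      by rewrite (@avgMl _ _ mu (A i (D k)) (v k))// => z u; exact: avg_upd.
    by apply/funext => y; rewrite /w /tau; ring.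
  by rewrite /delta /w /tau; ring.
have gwv : bdd_meas (fun x => w x * v k x) by exact: (bdd_measM gw (gv k)).
have gvA : bdd_meas (fun x => (v k x - A i (v k) x) * A i (D k) x) by exact: (bdd_measM gvi gAD).
have gAwv : bdd_meas (A i (fun y => w y * v k y)) by exact: bdd_meas_avg.
apply: (@le_trans _ _ (E (fun x => (`|w x * v k x| + `|(v k x - A i (v k) x) * A i (D k) x|)
   + `|A i (fun y => w y * v k y) x|))).
  apply: le_Ex; first exact: bdd_meas_norm.
    by apply: bdd_measD; [apply: bdd_measD|]; exact: bdd_meas_norm.
  move=> x; rewrite dE; apply: (le_trans (ler_normB _ _)); rewrite lerD2r.
  exact: ler_normD.
rewrite ExD; [|by apply: bdd_measD; exact: bdd_meas_norm|exact: bdd_meas_norm].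
rewrite ExD; [|exact: bdd_meas_norm..].
have h1 : E (fun x => `|w x * v k x|) <= b.
  apply: (le_trans (@Ex_norm_prod_le w (v k) 1 _ _ _)) => //.
    by move=> x; exact: norm_residual_le1.
  by rewrite mul1r; exact: wb.
have h2 : E (fun x => `|(v k x - A i (v k) x) * A i (D k) x|) <= b.
  apply: (le_trans (@Ex_norm_prod_le _ (A i (D k)) 1 _ _ _)) => //.
    by move=> x; apply: norm_avg_le => // y; exact: norm_mart_diff_le1.
  by rewrite mul1r; exact: lexx.
have h3 := le_trans (Ex_norm_avg_le lawX indX i gwv) h1.
lra.
Qed.

Variable b : I -> I -> R.
Hypothesis b0 : forall i k, 0 <= b i k.
Hypothesis betab : forall i k,
  E (fun x => `|v k x - A i (v k) x|) <= b i k ^+ 2.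

(** Expanding both factors over k and k', each term is bounded by 6 b_ik^2 and by
    6 b_ik'^2, because one factor can be estimated in mean and the other by its
    supremum 2; hence by 6 b_ik b_ik'. *)
Lemma Ex_mart_diff_stein_coef_le i :
  E (fun x => mart_diff mu stein_coef i x * (stein_coef x - A i stein_coef x)) <=
  6 * (\sum_k b i k) ^+ 2.
Proof.
(* the coordinates averaged out in the i-th martingale difference *)
pose l := drop (index i (enum I)).+1 (enum I).
have resE x : stein_coef x - A i stein_coef x = \sum_k delta i k x.
  rewrite /delta sumrB; congr (_ - _).
  by rewrite /stein_coef (avg_sum mu i _ gtau).
have mdE x : mart_diff mu stein_coef i x = \sum_k iter_avg mu l (delta i k) x.
  rewrite /mart_diff -/l (_ : (fun x => _) = (fun x => \sum_k delta i k x)); last exact/funext.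
  by rewrite (iter_avg_sum mu l _ (gdelta i)).
have -> : (fun x => mart_diff mu stein_coef i x * (stein_coef x - A i stein_coef x)) =
    (fun x => \sum_k \sum_k' iter_avg mu l (delta i k) x * delta i k' x).
  apply/funext => x; rewrite resE mdE mulr_suml.
  by apply: eq_bigr => k _; rewrite mulr_sumr.
have gav k : bdd_meas (iter_avg mu l (delta i k)) by exact: bdd_meas_iter_avg.
rewrite Ex_sum; last by move=> k; apply: bdd_meas_sum => k'; exact: bdd_measM.
rewrite expr2 mulr_suml mulr_sumr; apply: ler_sum => k _.
rewrite Ex_sum; last by move=> k'; exact: bdd_measM.
rewrite mulr_sumr mulr_sumr; apply: ler_sum => k' _.
have d2 j x : `|delta i j x| <= 2.
  rewrite /delta (le_trans (ler_normB _ _))//.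
  have t1 y : `|tau j y| <= 1.
    by rewrite normrM mulr_ile1// ?norm_mart_diff_le1 ?norm_residual_le1.
  by rewrite -[2]/(1 + 1) lerD// norm_avg_le.
have de j : E (fun x => `|delta i j x|) <= 3 * b i j ^+ 2.
  by apply: (le_trans (Ex_delta_le i j)); rewrite ler_pM2l.
have gp : bdd_meas (fun x => iter_avg mu l (delta i k) x * delta i k' x) by exact: bdd_measM.
have m1 : E (fun x => iter_avg mu l (delta i k) x * delta i k' x) <= 6 * b i k ^+ 2.
  apply: (le_trans (ler_norm _)); apply: (le_trans (ler_norm_Ex X gp)).
  apply: (le_trans (@Ex_norm_prod_le _ (delta i k') 2 _ _ _)) => //.
  rewrite -[6](_ : 2 * 3 = 6) -?mulrA; last by ring.
  rewrite ler_pM2l//; apply: (le_trans (Ex_norm_iter_avg_le lawX indX l (gdelta i k))).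
  exact: de.
have m2 : E (fun x => iter_avg mu l (delta i k) x * delta i k' x) <= 6 * b i k' ^+ 2.
  apply: (le_trans (ler_norm _)); apply: (le_trans (ler_norm_Ex X gp)).
  under [X in E X]eq_fun do rewrite mulrC.
  apply: (le_trans (@Ex_norm_prod_le (delta i k') _ 2 _ (gav k) _)) => //.
    by move=> x; exact: norm_iter_avg_le.
  rewrite -[6](_ : 2 * 3 = 6) -?mulrA; last by ring.
  by rewrite ler_pM2l//; exact: de.
have [kk'|kk'] := leP (b i k) (b i k').
  apply: (le_trans m1); rewrite ler_pM2l// expr2 ler_wpM2l//.
by apply: (le_trans m2); rewrite ler_pM2l// expr2 ler_wpM2r// ltW.
Qed.

Variable B : R.
Hypothesis sumb : forall i, \sum_k b i k <= B.

Lemma Ex_stein_coef : E stein_coef = E (fun x => (F x - E F) ^+ 2).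
Proof.
rewrite /stein_coef Ex_sum; last by move=> k; exact: bdd_measM.
rewrite -(covariance_mart_diff lawX indX gF gF).
have gc : bdd_meas (fun x => F x - E F) by apply: bdd_measB => //; exact: bdd_meas_cst.
apply/eqP; rewrite eq_sym -subr_eq0 -ExB; [|exact: bdd_meas_exp|exact: bdd_measM].
rewrite (_ : (fun x => _) = (fun x => - E F * (F x - E F))); last first.
  by apply/funext => x; ring.
by rewrite ExZ// ExB//; [rewrite Ex_cst subrr mulr0|exact: bdd_meas_cst].
Qed.

(** The covariance identity, now applied to T itself. *)
Lemma Var_stein_coef_le :
  E (fun x => (stein_coef x - E stein_coef) ^+ 2) <= 6 * #|I|%:R * B ^+ 2.
Proof.
have gT := bdd_meas_stein_coef.
have gc : bdd_meas (fun x => stein_coef x - E stein_coef) by apply: bdd_measB => //; exact: bdd_meas_cst.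
have -> : E (fun x => (stein_coef x - E stein_coef) ^+ 2) =
          E (fun x => (stein_coef x - E stein_coef) * stein_coef x).
  apply/eqP; rewrite -subr_eq0 -ExB; [|exact: bdd_meas_exp|exact: bdd_measM].
  rewrite (_ : (fun x => _) = (fun x => - E stein_coef * (stein_coef x - E stein_coef))); last first.
    by apply/funext => x; ring.
  by rewrite ExZ// ExB//; [rewrite Ex_cst subrr mulr0|exact: bdd_meas_cst].
rewrite (covariance_mart_diff lawX indX gT gT).
apply: (@le_trans _ _ (\sum_(i : I) 6 * B ^+ 2)).
  apply: ler_sum => i _; apply: (le_trans (Ex_mart_diff_stein_coef_le i)).
  rewrite ler_pM2l// ler_pXn2r// ?nnegrE ?sumr_ge0//.
  by apply: (le_trans _ (sumb i)); rewrite sumr_ge0.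
by rewrite sumr_const -[leLHS]mulr_natl mulrCA mulrA.
Qed.

(** Pointwise, 2 lam |h| <= lam^2 + h^2.  With lam the standard deviation this is
    the Cauchy-Schwarz inequality up to the constant. *)
Lemma Ex_norm_le_AMGM h lam : bdd_meas h -> 0 < lam ->
  E (fun x => `|h x|) <= 2^-1 * (lam + lam^-1 * E (fun x => h x ^+ 2)).
Proof.
move=> gh l0.
have gh2 : bdd_meas (fun x => h x ^+ 2) by exact: bdd_meas_exp.
rewrite -{1}(Ex_cst X lam) -ExZ// -ExD; [|exact: bdd_meas_cst|exact: bdd_measZ].
rewrite -ExZ; last by apply: bdd_measD; [exact: bdd_meas_cst|exact: bdd_measZ].
apply: le_Ex; [exact: bdd_meas_norm|..].
  by apply/bdd_measZ/bdd_measD; [exact: bdd_meas_cst|exact: bdd_measZ].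
move=> x /=; rewrite -subr_ge0.
rewrite (_ : _ - _ = 2^-1 * lam^-1 * (lam - `|h x|) ^+ 2).
  by rewrite mulr_ge0 ?sqr_ge0// mulr_ge0 ?invr_ge0 ?ltW.
by rewrite -[h x ^+ 2]real_normK ?num_real//; field; rewrite gt_eqF.
Qed.

Hypothesis B0 : 0 < B.

Lemma Ex_stein_coef_dev : E (fun x => `|stein_coef x - E stein_coef|) <= 4 * Num.sqrt #|I|%:R * B.
Proof.
have [I0|I0] := posnP #|I|.
  have st x : stein_coef x = 0.
    by rewrite /stein_coef big1// => k _; have := card0_eq I0 k; rewrite inE.
  rewrite (_ : (fun x => _) = fun=> 0).
    by rewrite Ex_cst !mulr_ge0// ltW.
  rewrite (_ : stein_coef = fun=> 0); last exact/funext.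
  by apply/funext => x; rewrite Ex_cst subrr normr0.
have sI : 0 < Num.sqrt (#|I|%:R : R) by rewrite sqrtr_gt0 ltr0n.
have gc : bdd_meas (fun x => stein_coef x - E stein_coef).
  by apply: bdd_measB; [exact: bdd_meas_stein_coef|exact: bdd_meas_cst].
have l0 : 0 < Num.sqrt #|I|%:R * B by exact: mulr_gt0.
apply: (le_trans (Ex_norm_le_AMGM gc l0)).
set V := E _; have VB : V <= 6 * #|I|%:R * B ^+ 2 by exact: Var_stein_coef_le.
have e : Num.sqrt (#|I|%:R : R) ^+ 2 = #|I|%:R by rewrite sqr_sqrtr.
move: e VB sI l0; move: (Num.sqrt _) => s e VB s0 l0.
have : (s * B)^-1 * V <= 6 * (s * B).
  rewrite ler_pdivrMl// (le_trans VB)// -e.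
  by rewrite [leRHS](_ : _ = 6 * s ^+ 2 * B ^+ 2)//; ring.
nra.
Qed.

Variables (f fd : R -> R) (K1 K2 : R).
Hypothesis mf : measurable_fun setT f.
Hypothesis mfd : measurable_fun setT fd.
Hypothesis fdK1 : forall x, `|fd x| <= K1.
Hypothesis taylor : forall x y, `|f y - f x - fd x * (y - x)| <= K2 * (y - x) ^+ 2.
Variable s : R.
Hypothesis s0 : 0 < s.
Hypothesis sV : s ^+ 2 = E (fun x => (F x - E F) ^+ 2).

Let W x := (F x - E F) / s.

(** By the covariance identity E (W f(W)) is a sum over k of terms D_k (1 - A_k) f(W).
    The Taylor expansion replaces (1 - A_k) f(W) by f'(W) v_k / s up to
    K2 / s^2, since one coordinate moves F by at most 1.  What remains is
    E (f'(W) (s^2 - T)) / s^2, controlled by the deviation of T from its mean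
    s^2. *)
Lemma stein_discrepancy :
  `|E (fun x => fd (W x) - W x * f (W x))| <=
  4 * K1 * s ^- 2 * Num.sqrt #|I|%:R * B + #|I|%:R * K2 * s ^- 3.
Proof.
have K20 : 0 <= K2.
  by have := taylor 0 1; rewrite subr0 expr1n !mulr1; exact: le_trans.
have K10 : 0 <= K1 by exact: le_trans (fdK1 0).
have gW : bdd_meas W.
  rewrite /W; under eq_fun do rewrite mulrC; apply: bdd_measZ.
  by apply: bdd_measB => //; exact: bdd_meas_cst.
have gfW : bdd_meas (f \o W).
  apply: bdd_meas_comp => // K; exists (`|f 0| + K1 * K + K2 * K ^+ 2) => y yK.
  have := taylor 0 y; rewrite subr0 => t.
  have -> : f y = f 0 + fd 0 * y + (f y - f 0 - fd 0 * y) by ring.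
  apply: (le_trans (ler_normD _ _)); apply: lerD.
    apply: (le_trans (ler_normD _ _)); rewrite lerD2l normrM.
    by rewrite ler_pM.
  apply: (le_trans t); rewrite ler_wpM2l// -[y ^+ 2]real_normK ?num_real//.
  by rewrite ler_pXn2r// ?nnegrE// (le_trans _ yK).
have gfdW : bdd_meas (fd \o W) by apply: bdd_meas_comp => // K; exists K1 => y _.
have gWf : bdd_meas (fun x => W x * f (W x)) by exact: bdd_measM.
(* r k is the Taylor remainder averaged over the coordinate k. *)
pose r k x := (f (W x) - A k (f \o W) x) - fd (W x) / s * v k x.
have gr k : bdd_meas (r k).
  apply: bdd_measB; first by apply: bdd_measB => //; exact: bdd_meas_avg.
  apply: bdd_measM => //; under eq_fun do rewrite mulrC; exact: bdd_measZ.
have rK k x : `|r k x| <= K2 * s ^- 2.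
  pose q u := (f (W x) - f (W (upd x k u))) - fd (W x) / s * (F x - F (upd x k u)).
  have qK u : `|q u| <= K2 * s ^- 2.
    have Wd : W (upd x k u) - W x = (F (upd x k u) - F x) / s by rewrite /W; ring.
    have -> : q u = - (f (W (upd x k u)) - f (W x)
        - fd (W x) * (W (upd x k u) - W x)) by rewrite Wd /q; ring.
    rewrite normrN; apply: (le_trans (taylor _ _)); rewrite ler_wpM2l//.
    rewrite (_ : _ ^+ 2 = (F x - F (upd x k u)) ^+ 2 * s ^- 2); last first.
      by rewrite Wd; field; rewrite gt_eqF.
    rewrite -[leRHS]mul1r ler_wpM2r ?invr_ge0 ?exprn_ge0 ?(ltW s0)//.
    by rewrite -real_normK ?num_real// expr_le1.
  have mW : measurable_fun setT (fun u => W (upd x k u)).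
    exact: (measurableT_comp gW.1 (measurable_upd2 x k)).
  have mF : measurable_fun setT (fun u => F (upd x k u)).
    exact: (measurableT_comp gF.1 (measurable_upd2 x k)).
  have int1 : (mu k).-integrable setT (EFin \o (fun u => f (W x) - f (W (upd x k u)))).
    have [K hK] := gfW.2.
    apply: (@bounded_integrable _ _ _ _ _ (K + K)).
      apply: measurable_funB => //; exact: (measurableT_comp mf mW).
    by move=> u; rewrite (le_trans (ler_normB _ _))// lerD//; exact: hK.
  have int2 : (mu k).-integrable setT (EFin \o (fun u => F x - F (upd x k u))).
    by apply: (@bounded_integrable _ _ _ _ _ 1) => //; exact: measurable_funB.
  have int3 : (mu k).-integrable setT (EFin \o (fun u => fd (W x) / s * (F x - F (upd x k u)))).
    apply: (@bounded_integrable _ _ _ _ _ `|fd (W x) / s|) => //.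
      by apply: measurable_funM => //; exact: measurable_funB.
    by move=> u; rewrite normrM ler_piMr.
  have -> : r k x = \int[mu k]_u q u.
    have e1 : f (W x) - A k (f \o W) x = \int[mu k]_u (f (W x) - f (W (upd x k u))).
      exact: (residualE k x gfW).
    have e2 : F x - A k F x = \int[mu k]_u (F x - F (upd x k u)).
      exact: (residualE k x gF).
    by rewrite /r /= e1 e2 /q [RHS]RintegralB// RintegralZl.
  have intq : (mu k).-integrable setT (EFin \o q).
    apply: (@bounded_integrable _ _ _ _ _ (K2 * s ^- 2)) => //.
    apply: measurable_funB.
      by apply: measurable_funB => //; exact: (measurableT_comp mf mW).
    by apply: measurable_funM => //; exact: measurable_funB.
  apply: (le_trans (le_normr_Rintegral measurableT intq)).
  rewrite -[leRHS](_ : \int[mu k]_u (K2 * s ^- 2) = K2 * s ^- 2); last first.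
    by rewrite Rintegral_cst// measure_probT mulr1.
  apply: le_Rintegral => //; first exact: integrable_norm intq.
  apply: (@bounded_integrable _ _ _ _ _ `|K2 * s ^- 2|) => //.
have eqW : E (fun x => W x * f (W x)) =
    E (fun x => s ^- 2 * (fd (W x) * stein_coef x)) + E (fun x => s^-1 * \sum_k D k x * r k x).
  have -> : E (fun x => W x * f (W x)) = s^-1 * E (fun x => (F x - E F) * (f \o W) x).
    rewrite -ExZ; last by apply: bdd_measM => //; apply: bdd_measB => //; exact: bdd_meas_cst.
    by congr (E _); apply/funext => x; rewrite /W /=; ring.
  rewrite (covariance_mart_diff lawX indX gF gfW).
  rewrite -ExD; first last.
  - by apply/bdd_measZ/bdd_meas_sum => k; exact: bdd_measM.
  - by apply/bdd_measZ/bdd_measM => //; exact: bdd_meas_stein_coef.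
  rewrite -Ex_sum; last by move=> k; apply: bdd_measM => //; exact: bdd_meas_residual.
  rewrite -ExZ; last by apply: bdd_meas_sum => k; apply: bdd_measM => //; exact: bdd_meas_residual.
  congr (E _); apply/funext => x.
  rewrite /stein_coef !mulr_sumr -big_split; apply: eq_bigr => k _ /=.
  by rewrite /r /=; field; rewrite gt_eqF.
rewrite ExB// eqW opprD addrA.
have gT := bdd_meas_stein_coef.
have e1 : `|E (fd \o W) - E (fun x => s ^- 2 * (fd (W x) * stein_coef x))| <=
    4 * K1 * s ^- 2 * Num.sqrt #|I|%:R * B.
  rewrite -ExB//; last by apply/bdd_measZ/bdd_measM.
  have -> : (fun x => (fd \o W) x - s ^- 2 * (fd (W x) * stein_coef x)) =
     (fun x => - (s ^- 2) * ((stein_coef x - E stein_coef) * (fd \o W) x)).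
    by apply/funext => x; rewrite Ex_stein_coef -sV/=; field; rewrite gt_eqF.
  have gc : bdd_meas (fun x => stein_coef x - E stein_coef).
    by apply: bdd_measB => //; exact: bdd_meas_cst.
  rewrite ExZ; last exact: bdd_measM.
  rewrite normrM normrN [`|s ^- 2|]ger0_norm; last by rewrite invr_ge0 exprn_ge0// ltW.
  rewrite [leRHS](_ : _ = s ^- 2 * (K1 * (4 * Num.sqrt #|I|%:R * B))); last by ring.
  apply: ler_wpM2l; first by rewrite invr_ge0 exprn_ge0// ltW.
  apply: (le_trans (ler_norm_Ex X _)); first exact: bdd_measM.
  apply: (le_trans (@Ex_norm_prod_le _ (fd \o W) K1 _ _ _)) => //.
    by move=> x; exact: fdK1.
  by rewrite ler_wpM2l//; exact: Ex_stein_coef_dev.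
have e2 : `|E (fun x => s^-1 * \sum_k D k x * r k x)| <= #|I|%:R * K2 * s ^- 3.
  have gs : bdd_meas (fun x => \sum_k D k x * r k x) by apply: bdd_meas_sum => k; exact: bdd_measM.
  rewrite ExZ// normrM [`|s^-1|]ger0_norm; last by rewrite invr_ge0 ltW.
  rewrite [leRHS](_ : _ = s^-1 * (#|I|%:R * (K2 * s ^- 2))); last first.
    by field; rewrite gt_eqF.
  apply: ler_wpM2l; first by rewrite invr_ge0 ltW.
  apply: (le_trans (ler_norm_Ex X gs)).
  rewrite -[leRHS](Ex_cst X); apply: le_Ex; [exact: bdd_meas_norm|exact: bdd_meas_cst|].
  move=> x; apply: (le_trans (ler_norm_sum _ _ _)).
  rewrite mulr_natl -sumr_const; apply: ler_sum => k _.
  rewrite normrM -[leRHS]mul1r ler_pM//; exact: norm_mart_diff_le1.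
by apply: (le_trans (ler_normB _ _)); exact: lerD.
Qed.

End SteinCoefficient.

(** * The monomer-dimer model as a function of the weights *)

Section ProductExpectation.
Context (R : realType) (I : finType) (mu : I -> probability R R).
Context d (T : measurableType d) (P : probability T R) (X : I -> {RV P >-> R}).
Hypothesis lawX : forall i, has_law (X i) (mu i).
Hypothesis indX : mutually_independent X.

Lemma bdd_meas_coord (g : R -> R) (i : I) : measurable_fun [set: R]%classic g ->
  (exists K, forall u, `|g u| <= K) -> bdd_meas (fun c : cfg R I => g (c i)).
Proof.
move=> mg [K gK]; split; last by exists K.
exact: (measurableT_comp mg (measurable_coord i)).
Qed.

(** Average over the coordinates one after the other. *)
Lemma Ex_prod (g : I -> R -> R) (p : seq I) : uniq p ->
  (forall i, measurable_fun [set: R]%classic (g i)) ->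
  (forall i, exists K, forall u, `|g i u| <= K) ->
  Ex X (fun c => \prod_(i <- p) g i (c i)) =
  \prod_(i <- p) (\int[mu i]_u g i u)%R.
Proof.
move=> + mg bg; elim: p => [_|i p IH /= /andP[ip up]].
  rewrite big_nil -[RHS](Ex_cst X 1); congr (Ex X _).
  by apply/funext => c; rewrite big_nil.
have gg j : bdd_meas (fun c : cfg R I => g j (c j)) by exact: bdd_meas_coord.
have gp : bdd_meas (fun c : cfg R I => \prod_(j <- p) g j (c j)) by exact: bdd_meas_prod.
rewrite big_cons -IH// -ExZ//.
rewrite (_ : (fun c => _) = (fun c => g i (c i) * \prod_(j <- p) g j (c j))); last first.
  by apply/funext => c; rewrite big_cons.
rewrite -(Ex_avg lawX indX i); last exact: bdd_measM.
congr (Ex X _); apply/funext => c.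
rewrite (@avgMr _ _ mu (fun c => \prod_(j <- p) g j (c j)) (fun c => g i (c i)))//.
  by congr (_ * _); rewrite /avg; apply: eq_Rintegral => u _; rewrite updE eqxx.
move=> y u; apply: eq_big_seq => j jp; rewrite updE.
by case: eqP => // ji; rewrite -ji jp in ip.
Qed.

End ProductExpectation.

Section MeasurableModel.
Context (R : realType) (G : sgraph).
Local Notation I := (edge G + G)%type.
Implicit Types (c : cfg R I) (S : {set G}) (x v : G).

Definition ew c : edge G -> R := fun e => c (inl e).
Definition vw c : G -> R := fun x => c (inr x).

Definition monomer_at S x c : R := monomer (ew c) (vw c) S x.
Definition dimers_at S c : R := dimers (ew c) (vw c) S.
Definition walks_at s n S x c : R := walks (ew c) (vw c) s n S x.
Definition contraction_at x c : R := contraction (ew c) (vw c) x.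

Lemma measurable_sum_coord (J : Type) (r : seq J) (p : pred J) (h : J -> cfg R I -> R) :
  (forall j, measurable_fun [set: cfg R I]%classic (h j)) ->
  measurable_fun [set: cfg R I]%classic (fun c => \sum_(j <- r | p j) h j c).
Proof.
move=> mh; elim: r => [|j r IH].
  by under [X in measurable_fun _ X]eq_fun do rewrite big_nil; exact: measurable_cst.
under [X in measurable_fun _ X]eq_fun do rewrite big_cons.
by case: (p j) => //; exact: measurable_funD.
Qed.

Lemma measurable_inv_pos (h : cfg R I -> R) : (forall c, 0 < h c) ->
  measurable_fun [set: cfg R I]%classic h ->
  measurable_fun [set: cfg R I]%classic (fun c => (h c)^-1).
Proof.
move=> h0 mh; rewrite (_ : (fun c => _) = (fun c => expR (- ln (h c)))).
  apply: measurableT_comp => //; apply: measurableT_comp => //.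
  by apply: measurableT_comp mh; exact: measurable_ln.
by apply/funext => c; rewrite expRN lnK ?posrE.
Qed.

Lemma measurable_partition_in S :
  measurable_fun [set: cfg R I]%classic (fun c => partition_in (ew c) (vw c) S).
Proof.
apply: measurable_sum_coord => M; apply: measurable_funM => //.
apply: measurableT_comp => //; apply: measurable_funD.
  by apply: measurable_sum_coord => e; exact: measurable_coord.
by apply: measurable_sum_coord => x; exact: measurable_coord.
Qed.

Lemma bdd_meas_monomer S x : bdd_meas (monomer_at S x).
Proof.
split; last first.
  by exists 1 => c; rewrite ger0_norm ?monomer_ge0 ?monomer_le1.
rewrite /monomer_at /monomer; case: (x \in S); last exact: measurable_cst.
apply: measurable_funM.
  apply: measurable_funM; last exact: measurable_partition_in.
  by apply: measurableT_comp => //; exact: measurable_coord.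
by apply: measurable_inv_pos; [move=> c; exact: partition_in_gt0|exact: measurable_partition_in].
Qed.

Lemma bdd_meas_dimers : bdd_meas (dimers_at [set: G]).
Proof.
rewrite (_ : dimers_at _ = fun c => 2^-1 * \sum_x (1 - monomer_at [set: G] x c)).
  by apply/bdd_measZ/bdd_meas_sum => x; apply: bdd_measB; [exact: bdd_meas_cst|exact: bdd_meas_monomer].
by apply/funext => c; exact: dimers_monomer.
Qed.

Lemma bdd_meas_contraction x : bdd_meas (contraction_at x).
Proof.
split; last first.
  by exists 1 => c; rewrite ger0_norm ?contraction_ge0 ?contraction_le1.
have mA : measurable_fun [set: cfg R I]%classic (fun c => total_activity (ew c) (vw c) x).
  apply: measurable_sum_coord => e; apply: measurableT_comp => //.
  by apply: measurable_funB; [apply: measurable_funB|]; exact: measurable_coord.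
apply: measurable_funM => //; apply: measurable_inv_pos.
  by move=> c; rewrite ltr_pwDl// total_activity_ge0.
exact: measurable_funD.
Qed.

Lemma bdd_meas_walks s n S x : bdd_meas (walks_at s n S x).
Proof.
elim: n S x => [|n IH] S x; first exact: bdd_meas_cst.
apply: (bdd_measM (bdd_meas_exp s (bdd_meas_contraction x))).
by apply: bdd_meas_sum => e; exact: IH.
Qed.

Lemma matching_sum_local g S (w w' : edge G -> R) (nu nu' : G -> R) :
  (forall e : edge G, val e \subset S -> w e = w' e) -> (forall x, x \in S -> nu x = nu' x) ->
  matching_sum w nu g S = matching_sum w' nu' g S.
Proof.
move=> ww nn; apply: eq_bigr => M /andP[_ /withinP MS]; congr (_ * expR _); congr (_ + _).
  by apply: eq_bigr => e /MS /ww.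
by apply: eq_bigr => x /andP[/nn].
Qed.

Definition touches (i : I) v : bool :=
  match i with inl e => v \in val e | inr y => y == v end.

Lemma matching_sum_at_local g S i v c u : touches i v ->
  matching_sum (ew (upd c i u)) (vw (upd c i u)) g (S :\ v) = matching_sum (ew c) (vw c) g (S :\ v).
Proof.
move=> iv; apply: matching_sum_local => [e|x xS]; rewrite /ew /vw updE; case: eqP => // ie.
  by move: iv; rewrite -ie /= => ve; rewrite finset.subsetD1 ve andbF.
by move: iv xS; rewrite -ie /= => /eqP ->; rewrite !inE eqxx.
Qed.

Lemma monomer_at_local S x i v c u : touches i v ->
  monomer_at (S :\ v) x (upd c i u) = monomer_at (S :\ v) x c.
Proof.
move=> iv; rewrite /monomer_at /monomer; case: ifP => // xS.
have xv : x != v by move: xS; rewrite !inE => /andP[].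
rewrite (_ : (S :\ v) :\ x = (S :\ x) :\ v); last first.
  by apply/setP => y; rewrite !inE andbCA.
rewrite /partition_in !(matching_sum_at_local _ _ _ _ iv) /vw updE; case: eqP => // xi.
by move: iv xv; rewrite -xi /= => ->.
Qed.

(** Deleting the endpoint v of i removes every dependence on the weight i, and both
    configurations are within the unit interval above the common value. *)
Lemma dimers_osc i v c u : touches i v ->
  `|dimers_at [set: G] c - dimers_at [set: G] (upd c i u)| <= 1.
Proof.
move=> iv.
have := dimers_setD1 (ew c) (vw c) [set: G] v.
have := dimers_setD1 (ew (upd c i u)) (vw (upd c i u)) [set: G] v.
have -> : dimers (ew (upd c i u)) (vw (upd c i u)) ([set: G] :\ v) =
          dimers (ew c) (vw c) ([set: G] :\ v).
  by rewrite /dimers /partition_in !(matching_sum_at_local _ _ _ _ iv).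
rewrite /dimers_at => /andP[a1 a2] /andP[b1 b2]; rewrite ler_norml; lra.
Qed.

Lemma touched (i : I) : exists v, touches i v.
Proof.
case: i => [e|x]; last by exists x => /=.
by have [a [b [_ eE]]] := edgeP e; exists a; rewrite /= eE !inE eqxx.
Qed.

(** Distances between weights are measured between chosen endpoints. *)
Definition anchor (i : I) : G := xchoose (touched i).

Lemma anchorP i : touches i (anchor i).
Proof. exact: xchooseP. Qed.

(** The weights on which the contraction factor at x depends. *)
Definition near_var x (i : I) : bool :=
  match i with inl e => x \in val e | inr z => (z == x) || adj x z end.

Variable D : nat.
Hypothesis degD : forall x : G, (degree x <= D)%N.
Hypothesis D1 : (1 <= D)%N.

Lemma card_near_var x : (#|near_var x| <= 2 * D + 1)%N.
Proof.
rewrite -sum1_card big_sumType/= (@leq_trans (D + (1 + D))%N)//; last first.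
  by rewrite mul2n -addnn addnCA addnC.
rewrite leq_add//; first by rewrite sum1_card; apply: leq_trans (card_incident x) (degD x).
rewrite sum1_card.
have -> : #|[pred z : G | (z == x) || adj x z]| = #|x |: [set y | adj x y]|.
  by apply: eq_card => z; rewrite !inE.
by rewrite cardsU1 leq_add ?leq_b1//; exact: degD.
Qed.

Lemma card_var_near (i : I) : (#|[pred x | near_var x i]| <= D.+1)%N.
Proof.
case: i => [e|z] /=.
  have [a [b [ab eE]]] := edgeP e.
  by rewrite eE cards2; case: (_ != _).
have -> : #|[pred x | (z == x) || adj x z]| = #|z |: [set y | adj z y]|.
  by apply: eq_card => x; rewrite !inE eq_sym adj_sym.
by rewrite cardsU1 -add1n leq_add ?leq_b1//; exact: degD.
Qed.

Lemma card_anchor v : (#|[pred i | anchor i == v]| <= D.+1)%N.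
Proof.
apply: (@leq_trans #|[pred i | touches i v]|).
  by apply/subset_leq_card/fintype.subsetP => i; rewrite !inE => /eqP <-; exact: anchorP.
rewrite -sum1_card big_sumType/= -[leqRHS]addn1.
rewrite leq_add//.
  by rewrite sum1_card; apply: leq_trans (card_incident v) (degD v).
by rewrite sum1_card card1.
Qed.

End MeasurableModel.

(** * Exponential decay in mean *)

Section Penalty.
Context (R : realType).

(** Equals 1 for the weights of size at most K and the inverse of th for the others. *)
Definition penalty (th K u : R) : R := th^-1 ^+ (K < `|u|)%R.

Lemma penaltyE th K u :
  penalty th K u = 1 + (th^-1 - 1) * \1_[set u : R | K < `|u|]%classic u.
Proof.
rewrite /penalty indicE.
case: (boolP (K < `|u|)) => h; rewrite ?expr1 ?expr0.
  by rewrite mem_set// mulr1 addrC subrK.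
by rewrite memNset ?mulr0 ?addr0//; exact/negP.
Qed.

Lemma measurable_penalty th K : measurable_fun [set: R]%classic (penalty th K).
Proof.
rewrite (_ : penalty th K = fun u => 1 + (th^-1 - 1) * \1_[set u : R | K < `|u|]%classic u); last first.
  by apply/funext => u; exact: penaltyE.
apply: measurable_funD => //; apply: measurable_funM => //.
apply: measurable_indic.
have -> : ([set u : R | K < `|u|] = (@Num.norm R R) @^-1` `]K, +oo[)%classic.
  by apply/seteqP; split => u /=; rewrite in_itv/= andbT.
by rewrite -[X in measurable X]setTI; apply: normr_measurable.
Qed.

Lemma penalty_ge1 th K u : 0 < th -> th <= 1 -> 1 <= penalty th K u.
Proof. by move=> th0 th1; apply: exprn_ege1; rewrite invf_ge1. Qed.

Lemma penalty_le th K u : 0 < th -> th <= 1 -> penalty th K u <= th^-1.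
Proof.
move=> th0 th1; rewrite /penalty; case: (_ < _); rewrite ?expr1// expr0.
by rewrite invf_ge1.
Qed.

Lemma norm_penalty_exp_le th K u n : 0 < th -> th <= 1 ->
  `|penalty th K u ^+ n| <= th^-1 ^+ n.
Proof.
move=> th0 th1; have p0 : 0 <= penalty th K u.
  exact: le_trans (penalty_ge1 K u th0 th1).
rewrite ger0_norm ?exprn_ge0 ?invr_ge0 ?(ltW th0)//; apply: lerXn2r; rewrite ?nnegrE ?invr_ge0 ?(ltW th0)//.
exact: penalty_le.
Qed.

(** The penalty costs th^(-n) at most, with a probability that the fourth moment bounds
    by a multiple of K^(-4). *)
Lemma penalty_tail (mu : probability R R) (th : R) n : 0 < th -> th <= 1 ->
  finite_fourth_moment mu -> exists2 K0 : R, 0 < K0 & forall K, K0 <= K ->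
    (\int[mu]_u (penalty th K u ^+ n))%R <= 2.
Proof.
move=> th0 th1 m4.
pose M := (\int[mu]_u (u ^+ 4))%R.
have M0 : 0 <= M by apply: Rintegral_ge0 => u _; rewrite exprn_even_ge0.
pose k := th^-1 ^+ n.
have k0 : 0 < k by rewrite exprn_gt0// invr_gt0.
exists (1 + k * M) => [|K KK]; first by rewrite ltr_pwDl// mulr_ge0// ltW.
have K1 : 1 <= K by apply: le_trans KK; rewrite lerDl mulr_ge0// ltW.
have K0 : 0 < K by exact: lt_le_trans K1.
have le u : penalty th K u ^+ n <= 1 + k / K ^+ 4 * u ^+ 4.
  rewrite /penalty; case: ltP => uK; rewrite ?expr1 ?expr0.
    apply: (@le_trans _ _ (0 + k)); first by rewrite add0r.
    rewrite lerD// -mulrA ler_peMr ?(ltW k0)// mulrC ler_pdivlMr ?exprn_gt0// mul1r.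
    rewrite -[u ^+ 4]ger0_norm ?exprn_even_ge0// normrX.
    by rewrite lerXn2r ?nnegrE ?(ltW K0) ?(ltW uK).
  rewrite expr1n lerDl mulr_ge0 ?exprn_even_ge0//.
  by rewrite divr_ge0 ?exprn_ge0 ?invr_ge0 ?(ltW th0) ?(ltW K0).
have i1 : mu.-integrable [set: R]%classic (EFin \o (fun u => penalty th K u ^+ n)).
  apply: (@bounded_integrable _ _ _ _ _ k).
    by apply: measurable_funX; exact: measurable_penalty.
  by move=> u; exact: norm_penalty_exp_le.
have i2 : mu.-integrable [set: R]%classic (EFin \o (fun u : R => k / K ^+ 4 * u ^+ 4)).
  apply: eq_integrable (integrableZl measurableT (k / K ^+ 4) m4) => //.
have i0 : mu.-integrable [set: R]%classic (EFin \o (fun u : R => 1 : R)).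
  by apply: (@bounded_integrable _ _ _ _ _ 1) => // u; rewrite normr1.
apply: (@le_trans _ _ (\int[mu]_u (1 + k / K ^+ 4 * u ^+ 4))%R).
  apply: le_Rintegral => //.
  apply: eq_integrable (integrableD measurableT i0 i2) => //.
rewrite RintegralD// RintegralZl// Rintegral_cst// measure_probT mulr1 -/M.
rewrite -[2]/(1 + 1) lerD2l mulrAC ler_pdivrMr ?exprn_gt0// mul1r.
have := ler_eXnr (isT : (0 < 4)%N) K1.
by apply: le_trans; apply: le_trans KK; rewrite lerDr.
Qed.

End Penalty.

Section ExpectedDecay.
Context (R : realType) (G : sgraph) (D : nat).
Hypothesis degD : forall x : G, (degree x <= D)%N.
Hypothesis D1 : (1 <= D)%N.
Local Notation I := (edge G + G)%type.
Context (mu : I -> probability R R).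
Context d (T : measurableType d) (P : probability T R) (X : I -> {RV P >-> R}).
Hypothesis lawX : forall i, has_law (X i) (mu i).
Hypothesis indX : mutually_independent X.
Local Notation E := (Ex X).

Variables (th K : R) (s : nat).
Hypothesis th0 : 0 < th.
Hypothesis th1 : th <= 1.
Hypothesis thD : th * 2 ^+ (2 * D + 1) = (2 * D%:R)^-1.
Hypothesis tail : forall i, (\int[mu i]_u (penalty th K u ^+ D.+1))%R <= 2.
Hypothesis contractionK :
  (D%:R * expR (3 * K) / (1 + D%:R * expR (3 * K))) ^+ s.+1 <= th.

(** If all weights near x are of size at most K, the activities are at most exp (3 K)
    and the power s+1 was chosen so that the left side is at most th.  Otherwise one
    penalty compensates the factor th, and the left side is at most 1. *)
Lemma contraction_penalty x (c : cfg R I) :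
  contraction_at x c ^+ s.+1 <= th * \prod_(i | near_var x i) penalty th K (c i).
Proof.
have [bad|fine_] := boolP [exists i, near_var x i && (K < `|c i|)].
  have /existsP[i /andP[xi iK]] := bad.
  apply: (@le_trans _ _ 1); first by rewrite exprn_ile1 ?contraction_ge0 ?contraction_le1.
  rewrite (bigD1 i)//= {1}/penalty iK expr1 mulrA divff ?gt_eqF// mul1r.
  elim/big_ind: _ => [||j _]; [exact: lexx|exact: mulr_ege1|exact: penalty_ge1].
have cK i : near_var x i -> `|c i| <= K.
  by move=> xi; rewrite leNgt; apply: contra fine_ => iK; apply/existsP; exists i; rewrite xi.
rewrite big1 ?mulr1; last by move=> i xi; rewrite /penalty ltNge cK.
apply: le_trans contractionK; apply: lerXn2r; first by rewrite nnegrE contraction_ge0.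
  by rewrite nnegrE divr_ge0 ?addr_ge0 ?mulr_ge0 ?expR_ge0.
rewrite /contraction_at /contraction; set L := total_activity _ _ _.
have L0 : 0 <= L by exact: total_activity_ge0.
set B := D%:R * _; have LB : L <= B.
  apply: (@le_trans _ _ (\sum_(e : edge G | x \in val e) expR (3 * K))).
    apply: ler_sum => e xe; rewrite /activity ler_expR.
    have [_ _ xo] := other_end_spec xe.
    have h1 := cK (inl e) xe.
    have h2 := cK (inr x) (introT orP (or_introl (eqxx x))).
    have h3 := cK (inr (other_end e x)) (introT orP (or_intror xo)).
    move: h1 h2 h3; rewrite /ew /vw !ler_norml => /andP[? ?] /andP[? ?] /andP[? ?]; lra.
  rewrite sumr_const -[leLHS]mulr_natl ler_wpM2r ?expR_ge0// ler_nat.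
  exact: leq_trans (card_incident x) (degD x).
have p1 : 0 < 1 + L by rewrite ltr_pwDl.
have p2 : 0 < 1 + B by rewrite ltr_pwDl// (le_trans L0).
rewrite ler_pdivrMr// mulrAC ler_pdivlMr// !mulrDr !mulr1 (mulrC B) lerD2r.
exact: LB.
Qed.

(** A weight is near at most D+1 vertices, so its penalties along p multiply to a power
    D+1 at most, of mean at most 2.  At most (2 D + 1) #|p| weights occur, and th
    is chosen so that th 2^(2 D + 1) = 1 / (2 D). *)
Lemma Ex_contraction_prod (p : seq G) : uniq p ->
  E (fun c => \prod_(x <- p) contraction_at x c ^+ s.+1) <= (2 * D%:R)^-1 ^+ size p.
Proof.
move=> up; (* the weights that occur in the contraction factors along p *)
pose U := [seq i <- enum {: I} | has (fun x => near_var x i) p].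
pose pen c (i : I) := penalty th K (c i : R).
have pen1 c i : 1 <= pen c i by exact: penalty_ge1.
have gpen i : bdd_meas (fun c : cfg R I => penalty th K (c i) ^+ D.+1).
  apply: bdd_meas_exp; apply: (bdd_meas_coord (g := penalty th K)); first exact: measurable_penalty.
  exists th^-1 => u; rewrite ger0_norm; first exact: penalty_le.
  by apply: le_trans (penalty_ge1 K u th0 th1).
apply: (@le_trans _ _ (E (fun c => th ^+ size p * \prod_(i <- U) pen c i ^+ D.+1))).
  apply: le_Ex.
  - by apply: bdd_meas_prod => x; apply: bdd_meas_exp; exact: bdd_meas_contraction.
  - by apply/bdd_measZ/bdd_meas_prod => i; exact: gpen.
  move=> c; apply: (@le_trans _ _ (\prod_(x <- p) (th * \prod_(i | near_var x i) pen c i))).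
    apply: ler_prod => x _; rewrite exprn_ge0 ?contraction_ge0//=; exact: contraction_penalty.
  rewrite big_split/= big_const_seq count_predT iter_mulr_1 ler_wpM2l ?exprn_ge0 ?(ltW th0)//.
  rewrite (exchange_big_dep predT)//=.
  rewrite /U big_filter big_enum_cond/= [leRHS]big_mkcond/=.
  apply: ler_prod => i _; apply/andP; split.
    by apply: prodr_ge0 => x _; apply: le_trans (pen1 c i).
  have [hi|hi] := boolP (has _ p); last first.
    rewrite big1_seq// => x /andP[xi xp]; case/negP: hi; apply/hasP; by exists x.
  rewrite big_const_seq iter_mulr_1; apply: ler_weXn2l; first exact: pen1.
  apply: leq_trans (card_var_near degD D1 i).
  rewrite -size_filter -(card_uniqP (filter_uniq _ up)).
  by apply/subset_leq_card/fintype.subsetP => x; rewrite mem_filter => /andP[xi _]; rewrite inE.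
rewrite ExZ; last by apply: bdd_meas_prod => i; exact: gpen.
rewrite (Ex_prod lawX indX (g := fun i u => penalty th K u ^+ D.+1)); first last.
- by move=> i; exists (th^-1 ^+ D.+1) => u; exact: norm_penalty_exp_le.
- by move=> i; apply: measurable_funX; exact: measurable_penalty.
- by rewrite filter_uniq// enum_uniq.
have sU : (size U <= size p * (2 * D + 1))%N.
  rewrite /U size_filter -sum1_count big_enum_cond/=.
  apply: (@leq_trans (\sum_(i : I) \sum_(x <- p | near_var x i) 1)%N).
    rewrite big_mkcond; apply: leq_sum => i _; case: ifP => // hi.
    by rewrite sum1_count -has_count.
  rewrite (exchange_big_dep predT)//=.
  rewrite [leqRHS](_ : _ = \sum_(x <- p) (2 * D + 1))%N; last first.
    by rewrite big_const_seq count_predT iter_addn_0 mulnC.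
  apply: leq_sum => x _.
  by rewrite sum1_card; exact: card_near_var.
apply: (@le_trans _ _ (th ^+ size p * 2 ^+ size U)).
  rewrite ler_wpM2l ?exprn_ge0 ?(ltW th0)//.
  rewrite -[2 ^+ size U](_ : \prod_(i <- U) 2 = _); last first.
    by rewrite big_const_seq count_predT iter_mulr_1.
  apply: ler_prod => i _; rewrite tail andbT Rintegral_ge0// => u _.
  by rewrite exprn_ge0// (le_trans _ (penalty_ge1 K u th0 th1)).
rewrite -thD exprMn ler_wpM2l ?exprn_ge0 ?(ltW th0)//.
by rewrite -exprM ler_weXn2l ?ler1n// mulnC.
Qed.

(** Induction on n, the prefix p recording the vertices already visited: at each step
    there are at most D choices, and the visited vertices stay distinct because
    they are removed from S. *)
Lemma Ex_walks_prod n (p : seq G) (S : {set G}) x : uniq p ->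
  {in p, forall y, y \notin S} -> x \in S ->
  E (fun c => (\prod_(y <- p) contraction_at y c ^+ s.+1) * walks_at s.+1 n S x c) <=
  D%:R ^+ n * (2 * D%:R)^-1 ^+ (size p + n).
Proof.
elim: n p S x => [|n IH] p S x up pS xS.
  rewrite expr0 mul1r addn0 (_ : (fun c => _) = (fun c => \prod_(y <- p) contraction_at y c ^+ s.+1)).
    exact: Ex_contraction_prod.
  by apply/funext => c; rewrite mulr1.
pose inc : seq (edge G) :=
  [seq e : edge G <- enum {: edge G} | (x \in val e) && (other_end e x \in S :\ x)].
have gp (q : seq G) : bdd_meas (fun c : cfg R I => \prod_(y <- q) contraction_at y c ^+ s.+1).
  by apply: bdd_meas_prod => y; apply: bdd_meas_exp; exact: bdd_meas_contraction.
rewrite (_ : (fun c => _) = (fun c : cfg R I =>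
    \sum_(e <- inc)
      ((\prod_(y <- x :: p) contraction_at y c ^+ s.+1) * walks_at s.+1 n (S :\ x) (other_end e x) c))); last first.
  apply/funext => c; rewrite /walks_at /= /inc big_filter big_enum_cond/= -mulr_sumr.
  by rewrite big_cons mulrA; congr (_ * _); rewrite mulrC.
rewrite Ex_sum; last by move=> e; apply: bdd_measM => //; exact: bdd_meas_walks.
apply: (@le_trans _ _ (\sum_(e <- inc)
   (D%:R ^+ n * (2 * D%:R)^-1 ^+ (size p + n.+1)))).
  rewrite big_seq [leRHS]big_seq; apply: ler_sum => e.
  rewrite /inc mem_filter => /andP[/andP[xe oS] _].
  rewrite addnS -addSn; apply: IH => //=.
    by rewrite up andbT; apply/negP => /pS; rewrite xS.
  move=> y; rewrite inE => /orP[/eqP ->|/pS yS]; first by rewrite !inE eqxx.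
  by rewrite !inE (negbTE yS) andbF.
rewrite big_const_seq count_predT iter_addr_0 -[leLHS]mulr_natl mulrA exprS.
rewrite ler_wpM2r ?exprn_ge0 ?invr_ge0 ?mulr_ge0// ler_wpM2r ?exprn_ge0// ler_nat.
rewrite /inc size_filter -sum1_count big_enum_cond/= sum1_card.
apply: leq_trans (leq_trans (card_incident x) (degD x)).
by apply/subset_leq_card/fintype.subsetP => e; rewrite !inE => /andP[].
Qed.

Lemma Ex_walks n x : E (walks_at s.+1 n [set: G] x) <= 2^-1 ^+ n.
Proof.
have : E (fun c => (\prod_(y <- [::]) contraction_at y c ^+ s.+1) *
    walks_at s.+1 n [set: G] x c) <= D%:R ^+ n * (2 * D%:R)^-1 ^+ (0 + n).
  by apply: (@Ex_walks_prod n [::]); rewrite ?inE.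
under [X in E X]eq_fun do rewrite big_nil mul1r.
move=> /le_trans; apply.
rewrite add0n -exprMn invfM mulrCA divff ?mulr1//.
by rewrite pnatr_eq0 -lt0n.
Qed.

(** With t = exp (- 8 rate n), the bound t + 2^(-n) / t^s of [monomer_diff_le] is at most
    2 t as soon as t^(s+1) = exp (- n / 2) is at least 2^(-n). *)
Definition rate : R := (16 * s.+1%:R)^-1.

Lemma rate_gt0 : 0 < rate. Proof. by rewrite invr_gt0 mulr_gt0. Qed.

Lemma Ex_monomer_diff n x v : (forall m, (m < n)%N -> v \notin reach m x) ->
  E (fun c => `|monomer_at [set: G] x c - monomer_at ([set: G] :\ v) x c|) <=
  2 * (expR (- 2 * rate) ^+ n) ^+ 4.
Proof.
move=> vx; pose t := (expR (- 2 * rate) ^+ n) ^+ 4.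
have t0 : 0 < t by rewrite !exprn_gt0// expR_gt0.
have gw : bdd_meas (@walks_at R G s.+1 n [set: G] x) by exact: bdd_meas_walks.
apply: (@le_trans _ _ (E (fun c => t + (t ^+ s)^-1 * walks_at s.+1 n [set: G] x c))).
  apply: le_Ex.
  - by apply: bdd_meas_norm; apply: bdd_measB; exact: bdd_meas_monomer.
  - by apply: bdd_measD; [exact: bdd_meas_cst|exact: bdd_measZ].
  - by move=> c; rewrite mulrC; exact: monomer_diff_le.
rewrite ExD; [|exact: bdd_meas_cst|exact: bdd_measZ].
rewrite Ex_cst ExZ// mulr2n mulrDl mul1r -/t lerD2l.
rewrite ler_pdivrMl ?exprn_gt0 ?expR_gt0//.
apply: (le_trans (Ex_walks n x)).
have -> : t ^+ s * t = (expR (- 2 * rate) ^+ (4 * s.+1)) ^+ n.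
  by rewrite -exprSr /t -!exprM [in RHS]mulnC.
rewrite -expRM_natl lerXn2r ?nnegrE ?expR_ge0//.
rewrite (_ : _ * _ = - 2^-1); last first.
  rewrite /rate natrM; field; by rewrite addrC natr1 pnatr_eq0.
apply: le_trans (expR_ge1Dx _); lra.
Qed.

End ExpectedDecay.

(** * Second differences of the mean number of dimers *)

Section SecondDifference.
Context (R : realType) (G : sgraph) (D : nat).
Hypothesis degD : forall x : G, (degree x <= D)%N.
Hypothesis D1 : (1 <= D)%N.
Local Notation I := (edge G + G)%type.
Context (mu : I -> probability R R).
Context d (T : measurableType d) (P : probability T R) (X : I -> {RV P >-> R}).
Hypothesis lawX : forall i, has_law (X i) (mu i).
Hypothesis indX : mutually_independent X.
Local Notation E := (Ex X).
Local Notation A := (avg mu).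
Variables (th K : R) (s : nat).
Hypothesis th0 : 0 < th.
Hypothesis th1 : th <= 1.
Hypothesis thD : th * 2 ^+ (2 * D + 1) = (2 * D%:R)^-1.
Hypothesis tail : forall i, (\int[mu i]_u (penalty th K u ^+ D.+1))%R <= 2.
Hypothesis contractionK :
  (D%:R * expR (3 * K) / (1 + D%:R * expR (3 * K))) ^+ s.+1 <= th.
Variable m : nat.

Local Notation F := (@dimers_at R G [set: G]).

(** Its fourth power bounds the effect on r_x of resampling the weight i, see
    [Ex_monomer_residual].  The fourth root absorbs two square roots: that of a
    geometric mean of two influences, and that by which second differences enter
    [Var_stein_coef_le]. *)
Definition influence (x : G) (i : I) : R := expR (- 2 * rate R s) ^+ capdist m x (anchor i).

Lemma influence_ge0 x i : 0 <= influence x i.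
Proof. by rewrite exprn_ge0// expR_ge0. Qed.

Lemma Ex_norm_residual_le i (h : cfg R I -> R) : bdd_meas h ->
  E (fun c => `|h c - A i h c|) <= 2 * E (fun c => `|h c|).
Proof.
move=> gh; have gA : bdd_meas (A i h) by exact: bdd_meas_avg.
apply: (@le_trans _ _ (E (fun c => `|h c| + `|A i h c|))).
  apply: le_Ex => [||c].
  - by apply/bdd_meas_norm/bdd_measB.
  - by apply: bdd_measD; exact: bdd_meas_norm.
  - exact: ler_normB.
rewrite ExD; [|exact: bdd_meas_norm..].
rewrite [leRHS]mulr_natl mulr2n lerD2l.
exact: Ex_norm_avg_le.
Qed.

(** The difference from the graph without the anchor of i differs from r_x by a function
    that does not depend on i, so r_x can be replaced by this difference. *)
Lemma Ex_monomer_residual i x :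
  E (fun c => `|monomer_at [set: G] x c - A i (monomer_at [set: G] x) c|) <= 4 * influence x i ^+ 4.
Proof.
pose v := anchor i; have iv := anchorP i.
have gm : bdd_meas (@monomer_at R G [set: G] x) by exact: bdd_meas_monomer.
have gv : bdd_meas (@monomer_at R G ([set: G] :\ v) x) by exact: bdd_meas_monomer.
pose h c := @monomer_at R G [set: G] x c - monomer_at ([set: G] :\ v) x c.
have gh : bdd_meas h by exact: bdd_measB.
have -> : (fun c => `|monomer_at [set: G] x c - A i (monomer_at [set: G] x) c|) =
          (fun c => `|h c - A i h c|).
  apply/funext => c; congr `| _ |; rewrite /h avgB//.
  rewrite (@avg_indep _ _ mu (monomer_at ([set: G] :\ v) x)); first by ring.
  by move=> y u; exact: monomer_at_local.
apply: (le_trans (Ex_norm_residual_le i gh)).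
have H := Ex_monomer_diff degD D1 lawX indX th0 th1 thD tail contractionK
  (@capdist_notin G m x v).
rewrite -[4]/(2 * 2)%:R natrM -mulrA ler_pM2l//; exact: H.
Qed.

(** The operators 1 - A_i and 1 - A_k commute and each at most doubles the mean, so
    the better of the two influences can be used; the minimum is bounded by the
    geometric mean. *)
Lemma Ex_second_residual_monomer i k x (u := fun j c =>
    @monomer_at R G [set: G] x c - A j (monomer_at [set: G] x) c) :
  E (fun c => `|u k c - A i (u k) c|) <= 8 * (influence x i * influence x k) ^+ 2.
Proof.
have gm : bdd_meas (@monomer_at R G [set: G] x) by exact: bdd_meas_monomer.
have gu j : bdd_meas (u j) by apply: bdd_measB => //; exact: bdd_meas_avg.
have h1 : E (fun c => `|u k c - A i (u k) c|) <= 8 * influence x k ^+ 4.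
  apply: (le_trans (Ex_norm_residual_le i (gu k))).
  by rewrite -[8]/(2 * 4)%:R natrM -mulrA ler_pM2l//; exact: Ex_monomer_residual.
have h2 : E (fun c => `|u k c - A i (u k) c|) <= 8 * influence x i ^+ 4.
  have -> : (fun c => `|u k c - A i (u k) c|) = (fun c => `|u i c - A k (u i) c|).
    apply/funext => c; congr `| _ |; rewrite /u !avgB//; [|exact: bdd_meas_avg..].
    by rewrite (avgC mu i k)//; ring.
  apply: (le_trans (Ex_norm_residual_le k (gu i))).
  by rewrite -[8]/(2 * 4)%:R natrM -mulrA ler_pM2l//; exact: Ex_monomer_residual.
have [a0 b0] := (influence_ge0 x i, influence_ge0 x k).
have -> : (influence x i * influence x k) ^+ 2 = influence x i ^+ 2 * influence x k ^+ 2 by rewrite exprMn.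
have [ab|/ltW ba] := leP (influence x i ^+ 2) (influence x k ^+ 2).
  apply: (le_trans h2); rewrite ler_pM2l// -[4%N]/(2 * 2)%N exprM.
  by rewrite ler_wpM2l ?sqr_ge0.
apply: (le_trans h1); rewrite ler_pM2l// -[4%N]/(2 * 2)%N exprM.
by rewrite ler_wpM2r ?sqr_ge0.
Qed.

(** Its square bounds the mean of |(1 - A_i)(1 - A_k) F|. *)
Definition pair_influence (i k : I) : R := 2 * \sum_(x : G) influence x i * influence x k.

Lemma Ex_second_residual i k (v := fun j c => F c - A j F c) :
  E (fun c => `|v k c - A i (v k) c|) <= pair_influence i k ^+ 2.
Proof.
pose u x j c := @monomer_at R G [set: G] x c - A j (monomer_at [set: G] x) c.
have gm x : bdd_meas (@monomer_at R G [set: G] x) by exact: bdd_meas_monomer.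
have gu x j : bdd_meas (u x j) by apply: bdd_measB => //; exact: bdd_meas_avg.
have gF := bdd_meas_dimers R G.
have vE j c : v j c = - 2^-1 * \sum_(x <- enum G) u x j c.
  have FE : F = (fun c => 2^-1 * \sum_(x <- enum G) (1 - monomer_at [set: G] x c)).
    by apply/funext => y; rewrite big_enum; exact: dimers_monomer.
  have g1 x : bdd_meas (fun c => 1 - @monomer_at R G [set: G] x c).
    by apply: bdd_measB => //; exact: bdd_meas_cst.
  have AF : A j F c = 2^-1 * \sum_(x <- enum G) (1 - A j (monomer_at [set: G] x) c).
    rewrite FE (@avgMl _ _ mu (fun=> 2^-1))//; last exact: bdd_meas_sum.
    congr (_ * _); elim: (enum G) => [|x l IH].
      under [X in A j X]eq_fun do rewrite big_nil; by rewrite big_nil avg_cst.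
    under [X in A j X]eq_fun do rewrite big_cons.
    rewrite big_cons avgD//= ?IH//; last exact: bdd_meas_sum.
    by rewrite avgB// ?avg_cst//; exact: bdd_meas_cst.
  rewrite /v AF {1}FE -mulrBr -sumrB mulNr -mulrN -sumrN; congr (_ * _).
  by apply: eq_bigr => x _; rewrite /u; ring.
have gv j : bdd_meas (v j) by apply: bdd_measB => //; exact: bdd_meas_avg.
have dE c : v k c - A i (v k) c = - 2^-1 * \sum_(x <- enum G) (u x k c - A i (u x k) c).
  have -> : A i (v k) c = - 2^-1 * \sum_(x <- enum G) A i (u x k) c.
    rewrite (_ : v k = fun c => - 2^-1 * \sum_(x <- enum G) u x k c); last exact/funext.
    rewrite (@avgMl _ _ mu (fun=> - 2^-1))//; last exact: bdd_meas_sum.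
    congr (_ * _); elim: (enum G) => [|x l IH].
      under [X in A i X]eq_fun do rewrite big_nil; by rewrite big_nil avg_cst.
    under [X in A i X]eq_fun do rewrite big_cons.
    by rewrite big_cons avgD//= ?IH//; exact: bdd_meas_sum.
  by rewrite vE -mulrBr -sumrB.
have gd x : bdd_meas (fun c => u x k c - A i (u x k) c) by apply: bdd_measB => //; exact: bdd_meas_avg.
apply: (@le_trans _ _ (E (fun c => 2^-1 * \sum_(x <- enum G) `|u x k c - A i (u x k) c|))).
  apply: le_Ex => [||c].
  - by apply: bdd_meas_norm; apply: bdd_measB => //; exact: bdd_meas_avg.
  - by apply/bdd_measZ/bdd_meas_sum => x; exact: bdd_meas_norm.
  - rewrite dE normrM normrN [`|2^-1|]gtr0_norm ?invr_gt0// ler_pM2l ?invr_gt0//.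
    exact: ler_norm_sum.
rewrite ExZ; last by apply: bdd_meas_sum => x; exact: bdd_meas_norm.
rewrite Ex_sum; last by move=> x; exact: bdd_meas_norm.
apply: (@le_trans _ _ (2^-1 * \sum_(x <- enum G) 8 * (influence x i * influence x k) ^+ 2)).
  by rewrite ler_pM2l ?invr_gt0//; apply: ler_sum => x _; exact: Ex_second_residual_monomer.
rewrite -mulr_sumr mulrA [2^-1 * 8](_ : _ = 4); last by lra.
rewrite /pair_influence exprMn -natrX ler_pM2l// big_enum/=.
rewrite [leRHS]expr2 mulr_suml; apply: ler_sum => x _.
rewrite expr2 ler_wpM2l ?mulr_ge0 ?influence_ge0// (bigD1 x)//= lerDl.
by rewrite sumr_ge0// => y _; rewrite mulr_ge0 ?influence_ge0.
Qed.

Variable S : R.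
Hypothesis S0 : 0 < S.
Hypothesis sumS : forall x, \sum_(v : G) expR (- 2 * rate R s) ^+ capdist m x v <= S.

(** At most D + 1 weights share an anchor. *)
Lemma sum_influence_var x : \sum_i influence x i <= D.+1%:R * S.
Proof.
rewrite (partition_big (@anchor G) predT)//=.
apply: (@le_trans _ _ (\sum_(v : G) D.+1%:R * expR (- 2 * rate R s) ^+ capdist m x v)).
  apply: ler_sum => v _.
  rewrite (eq_bigr (fun=> expR (- 2 * rate R s) ^+ capdist m x v)); last first.
    by move=> i /eqP <-.
  rewrite sumr_const -[leLHS]mulr_natl ler_wpM2r ?exprn_ge0 ?expR_ge0// ler_nat.
  exact: card_anchor.
by rewrite -mulr_sumr ler_wpM2l.
Qed.

Lemma sum_pair_influence i : \sum_k pair_influence i k <= 2 * D.+1%:R * S ^+ 2.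
Proof.
rewrite /pair_influence -mulr_sumr -mulrA ler_pM2l// exchange_big/=.
apply: (@le_trans _ _ (\sum_(x : G) influence x i * (D.+1%:R * S))).
  by apply: ler_sum => x _; rewrite -mulr_sumr ler_wpM2l ?influence_ge0// sum_influence_var.
rewrite -mulr_suml [leRHS](_ : _ = S * (D.+1%:R * S)); last by ring.
rewrite ler_wpM2r ?mulr_ge0 ?(ltW S0)//.
apply: le_trans (sumS (anchor i)); apply: ler_sum => x _.
by rewrite /influence capdistC.
Qed.

Variables (f fd : R -> R) (K1 K2 : R).
Hypothesis mf : measurable_fun [set: R]%classic f.
Hypothesis mfd : measurable_fun [set: R]%classic fd.
Hypothesis fdK1 : forall x, `|fd x| <= K1.
Hypothesis taylor : forall x y, `|f y - f x - fd x * (y - x)| <= K2 * (y - x) ^+ 2.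
Variable sg : R.
Hypothesis sg0 : 0 < sg.
Hypothesis sgV : sg ^+ 2 = E (fun x => (F x - E F) ^+ 2).

Lemma dimers_stein_discrepancy :
  `|E (fun c => fd ((F c - E F) / sg) - (F c - E F) / sg * f ((F c - E F) / sg))| <=
  8 * D.+1%:R * S ^+ 2 * K1 * sg ^- 2 * Num.sqrt #|{: I}|%:R
  + #|{: I}|%:R * K2 * sg ^- 3.
Proof.
have := @stein_discrepancy _ _ mu _ _ _ X lawX indX F (bdd_meas_dimers R G)
  (fun x i u => dimers_osc x u (anchorP i)) pair_influence
  (fun i k => _) (fun i k => Ex_second_residual i k)
  (2 * D.+1%:R * S ^+ 2) sum_pair_influence _ f fd K1 K2 mf mfd fdK1 taylor sg sg0 sgV.
move=> H; apply: le_trans (H _ _) _.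
- by move=> i k; rewrite mulr_ge0// sumr_ge0// => x _; rewrite mulr_ge0 ?influence_ge0.
- by rewrite !mulr_gt0// exprn_gt0.
rewrite lerD2r le_eqVlt; apply/orP; left; apply/eqP; ring.
Qed.

End SecondDifference.

Local Open Scope classical_set_scope.

(** * Stein's differential equation *)

Section SteinEquation.
Context (R : realType).
Implicit Types (x y t s : R).
Notation leb := (@lebesgue_measure R).

Definition gpdf x : R := normal_pdf 0 1 x.

Lemma gpdfE x : gpdf x = normal_peak 1 * expR (- x ^+ 2 / 2).
Proof.
rewrite /gpdf normal_pdfE ?oner_neq0// /normal_fun subr0 expr1n; congr (_ * expR _).
Qed.

Lemma gpdf_gt0 x : 0 < gpdf x.
Proof. by rewrite gpdfE mulr_gt0 ?expR_gt0// normal_peak_gt0// oner_neq0. Qed.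

Lemma gpdf_opp x : gpdf (- x) = gpdf x.
Proof. by rewrite !gpdfE sqrrN. Qed.

Lemma is_derive_gpdf x : is_derive x 1 gpdf (- x * gpdf x).
Proof.
have -> : gpdf = fun x => normal_peak 1 * expR (- x ^+ 2 / 2).
  by apply/funext => y; rewrite gpdfE.
apply: is_derive_eq.
rewrite /GRing.scale/=; lra.
Qed.

(** x <= 1 + x^2 / 2 <= exp (x^2 / 2). *)
Lemma gpdf_small (e : R) : 0 < e -> exists M, forall x, M <= x -> gpdf x <= e.
Proof.
move=> e0; exists (normal_peak 1 / e) => x xM.
have p0 : 0 < normal_peak (1 : R) by rewrite normal_peak_gt0// oner_neq0.
have x0 : 0 < x by apply: lt_le_trans xM; rewrite divr_gt0.
rewrite gpdfE mulNr expRN ler_pdivrMr ?expR_gt0//.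
have : x <= expR (x ^+ 2 / 2).
  apply: le_trans (expR_ge1Dx _).
  by have := sqr_ge0 (x - 1); rewrite sqrrB1; lra.
move=> h; apply: (@le_trans _ _ (e * x)); last by rewrite ler_pM2l.
by rewrite mulrC -ler_pdivrMr.
Qed.

(** The condition at infinity that excludes the solutions of the homogeneous equation
    psi' = x psi. *)
Definition vanishing (psi : R -> R) :=
  forall e, 0 < e -> exists M, forall x, M <= x -> `|gpdf x * psi x| <= e.

Lemma bounded_vanishing psi B : 0 < B -> (forall x, `|psi x| <= B) -> vanishing psi.
Proof.
move=> B0 pB e e0; have [M MP] := gpdf_small (divr_gt0 e0 B0).
exists M => x xM; rewrite normrM gtr0_norm ?gpdf_gt0//.
have := MP _ xM; rewrite ler_pdivlMr// => h; apply: le_trans h.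
by rewrite ler_pM2l ?gpdf_gt0.
Qed.

Lemma MVT_everywhere (f fd : R -> R) x y : x < y ->
  (forall t, is_derive t 1 f (fd t)) ->
  exists2 c, x < c < y & f y - f x = fd c * (y - x).
Proof.
move=> xy df; have [|c] := @MVT R f fd x y xy (fun t _ => df t).
  apply: continuous_subspaceT => t.
  by apply: differentiable_continuous; apply/derivable1_diffP; have [] := df t.
by rewrite in_itv /= => cxy; exists c.
Qed.

(** If psi x > K / x, the function gpdf t * (psi t - K / x) is positive at x,
    nondecreasing for t >= x, and becomes arbitrarily small: a contradiction. *)
Lemma ode_upper (psi psid : R -> R) K x : 0 < x -> vanishing psi ->
  (forall t, is_derive t 1 psi (psid t)) ->
  (forall t, `|psid t - t * psi t| <= K) -> x * psi x <= K.
Proof.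
move=> x0 vp dp pK; have K0 : 0 <= K by exact: le_trans (pK 0).
rewrite leNgt; apply/negP => Kp.
pose G t := gpdf t * (psi t - K / x).
pose Gd t := gpdf t * (psid t - t * psi t + t * (K / x)).
have dG t : is_derive t 1 G (Gd t).
  have dpt := dp t; have dgt := is_derive_gpdf t.
  rewrite /G; apply: is_derive_eq; rewrite /Gd /GRing.scale/=; ring.
have Gx : 0 < G x.
  by rewrite mulr_gt0 ?gpdf_gt0// subr_gt0 ltr_pdivrMr// mulrC.
have [M MP] := vp _ (divr_gt0 Gx (ltr0n _ 2)).
pose y := Num.max M (x + 1).
have xy : x < y by rewrite lt_max ltrDl ltr01 orbT.
have yM : M <= y by rewrite le_max lexx.
have [c /andP[xc cy] Ge] := MVT_everywhere xy dG.
have Gc : 0 <= Gd c.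
  rewrite mulr_ge0 ?(ltW (gpdf_gt0 _))//.
  have h1 : K <= c * (K / x).
    by rewrite mulrC -mulrA ler_peMr// mulrC ler_pdivlMr// mul1r ltW.
  by have := pK c; rewrite ler_norml => /andP[h2 _]; lra.
have GxGy : G x <= G y.
  by rewrite -subr_ge0 Ge mulr_ge0// subr_ge0 ltW.
have Gy : G y <= G x / 2.
  apply: le_trans (MP _ yM); apply: le_trans (ler_norm _).
  rewrite /G ler_pM2l ?gpdf_gt0// gerBl divr_ge0// ltW//.
lra.
Qed.

(** [ode_upper] for psi, - psi and their reflections at the origin. *)
Lemma ode_bound (psi psid : R -> R) K x : vanishing psi ->
  vanishing (fun t => psi (- t)) ->
  (forall t, is_derive t 1 psi (psid t)) ->
  (forall t, `|psid t - t * psi t| <= K) -> `|x * psi x| <= K.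
Proof.
move=> vp vn dp pK; have K0 : 0 <= K by exact: le_trans (pK 0).
have vanN q : vanishing q -> vanishing (fun t => - q t).
  move=> vq e e0; have [M MP] := vq _ e0; exists M => y /MP.
  by rewrite mulrN normrN.
have dN t : is_derive t 1 (fun y => - psi y) (- psid t).
  by have dpt := dp t; apply: is_derive_eq.
have dR t : is_derive t 1 (fun y => psi (- y)) (- psid (- t)).
  have dpt : is_derive (- t) 1 psi (psid (- t)) by exact: dp.
  have dn : is_derive t 1 (-%R : R -> R) (-1) by exact: is_deriveNid.
  by have := @is_derive1_comp _ psi -%R t _ _ dpt dn; rewrite mulrN1.
have dNR t : is_derive t 1 (fun y => - psi (- y)) (psid (- t)).
  by have dpt := dR t; apply: is_derive_eq; rewrite opprK.
have kN t : `|- psid t - t * - psi t| <= K.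
  by have := pK t; rewrite !ler_norml mulrN => /andP[? ?]; apply/andP; split; lra.
have kR t : `|- psid (- t) - t * psi (- t)| <= K.
  have := pK (- t); rewrite !ler_norml mulNr => /andP[? ?].
  by apply/andP; split; lra.
have kNR t : `|psid (- t) - t * - psi (- t)| <= K.
  by have := pK (- t); rewrite mulNr mulrN.
have [->|x0] := eqVneq x 0; first by rewrite mul0r normr0.
rewrite ler_norml; have [xp|xn] : 0 < x \/ 0 < - x.
  by case: (ltgtP 0 x) x0 => // h _; [left|right; rewrite oppr_gt0].
- have h1 := ode_upper xp vp dp pK.
  have h2 := ode_upper xp (vanN _ vp) dN kN.
  by move: h1 h2; rewrite mulrN; lra.
- have h1 := ode_upper xn vn dR kR.
  have h2 := ode_upper xn (vanN _ vn) dNR kNR.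
  by move: h1 h2; rewrite mulrN opprK mulNr; lra.
Qed.

End SteinEquation.

(** * The Gaussian distribution function *)

Section GaussianCDF.
Context (R : realType).
Implicit Types (x y t s : R).
Notation leb := (@lebesgue_measure R).

Lemma gpdf_integrable : leb.-integrable setT (EFin \o @gpdf R).
Proof. exact: integrable_normal_pdf. Qed.

Lemma gpdf_integrableS (A : set R) : measurable A -> leb.-integrable A (EFin \o @gpdf R).
Proof. by move=> mA; apply: integrableS gpdf_integrable. Qed.

Lemma gpdf_Rintegral : \int[leb]_x gpdf x = 1.
Proof. by rewrite /Rintegral /gpdf integral_normal_pdf. Qed.

Definition gcdf x : R := \int[leb]_(t in `]-oo, x]) gpdf t.

Lemma PhiE x : Phi x = (gcdf x)%:E.
Proof.
rewrite /Phi /normal_prob /gcdf /Rintegral fineK//.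
exact: integrable_fin_num (gpdf_integrableS _).
Qed.

Lemma gcdf_split x : gcdf x + \int[leb]_(t in `]x, +oo[) gpdf t = 1.
Proof.
rewrite -(@Rintegral_itvB _ _ -oo%O +oo%O x)//; last first.
  by rewrite set_itvNyy; exact: gpdf_integrable.
by rewrite addrC subrK set_itvNyy gpdf_Rintegral.
Qed.

Let idTR : measurableTypeR R -> R := idfun.

#[local] HB.instance Definition _ :=
  @isMeasurableFun.Build _ _ _ _ idTR (@measurable_id _ _ setT).

Lemma gcdf_limits e : 0 < e -> exists M, forall x, M <= x ->
  1 - gcdf x <= e /\ gcdf (- x) <= e.
Proof.
move=> e0.
have cE : cdf (idTR : {RV (normal_prob (0:R) 1) >-> R}) = EFin \o gcdf.
  by apply/funext => x; exact: PhiE.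
have c1 : gcdf x @[x --> +oo] --> (1 : R).
  by have := cvg_cdfy1 (idTR : {RV (normal_prob (0:R) 1) >-> R}); rewrite cE => /fine_cvg.
have c0 : gcdf x @[x --> -oo] --> (0 : R).
  by have := cvg_cdfNy0 (idTR : {RV (normal_prob (0:R) 1) >-> R}); rewrite cE => /fine_cvg.
have /cvgrPdist_le/(_ _ e0) [M1 [_ H1]] := c1.
have /cvgrPdist_le/(_ _ e0) [M2 [_ H2]] := c0.
exists (Num.max M1 (- M2) + 1) => x xM; split.
  apply: le_trans (ler_norm _) (H1 _ _).
  by apply: lt_le_trans xM; rewrite ltr_pwDr// le_max lexx.
have := H2 (- x); rewrite sub0r normrN => H.
apply: le_trans (ler_norm _) (H _).
by rewrite ltrNl; apply: lt_le_trans xM; rewrite ltr_pwDr// le_max lexx orbT.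
Qed.

Lemma normal_peak_le1 : normal_peak (1 : R) <= 1.
Proof.
rewrite /normal_peak invf_le1 ?sqrtr_gt0; last first.
  by rewrite expr1n mul1r mulrn_wgt0// pi_gt0.
rewrite -[leLHS]sqrtr1 ler_wsqrtr// expr1n mul1r mulr2n.
have := pi_ge2 R; lra.
Qed.

(** The standard Gaussian density is at most 1. *)
Lemma gcdf_lip x (e : R) : 0 <= e -> gcdf (x + e) <= gcdf x + e.
Proof.
rewrite le_eqVlt => /predU1P[<-|e0]; first by rewrite !addr0.
rewrite -lerBlDl /gcdf Rintegral_itvB//; first last.
- by rewrite bnd_simp lerDl ltW.
- exact: gpdf_integrableS.
apply: (@le_trans _ _ (\int[leb]_(t in `]x, x + e]) 1)).
  apply: le_Rintegral => //; first exact: gpdf_integrableS.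
    apply/integrableP; split; first exact: measurable_cst.
    under eq_integral do rewrite /= normr1.
    rewrite integral_cst//= mul1e lebesgue_measure_itv/= lte_fin ltrDl e0.
    by rewrite ltry.
  move=> t _; apply: le_trans normal_peak_le1.
  by apply: normal_pdf_ub; exact: oner_neq0.
rewrite Rintegral_cst//= lebesgue_measure_itv/= lte_fin ltrDl e0 mul1r/=.
by rewrite addrC addKr.
Qed.

End GaussianCDF.

(** * Solution of Stein's equation for a Lipschitz function *)

Section SteinSolution.
Context (R : realType).
Implicit Types (x y t s : R).
Notation leb := (@lebesgue_measure R).

Variables (h : R -> R) (L : R).
Hypothesis h01 : forall x, 0 <= h x <= 1.
Hypothesis hL : forall x y, `|h x - h y| <= L * `|x - y|.
Hypothesis L1 : 1 <= L.

Let L0 : 0 < L. Proof. exact: lt_le_trans L1. Qed.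

Lemma lipschitz_continuous : continuous h.
Proof.
move=> x; apply/cvgrPdist_le => e e0; near=> y.
apply: (le_trans (hL _ _)); rewrite mulrC -ler_pdivlMr//.
near: y; apply: cvgr_dist_le => //; first exact: divr_gt0.
Unshelve. all: by end_near. Qed.

Let gE := @gpdf_gt0 R.

Lemma continuous_gpdf : continuous (@gpdf R).
Proof. exact: continuous_normal_pdf (oner_neq0 R). Qed.

Lemma weighted_integrable (k : R -> R) K : continuous k -> (forall x, `|k x| <= K) ->
  leb.-integrable setT (EFin \o (fun x => k x * gpdf x)).
Proof.
move=> ck kK.
have mk : measurable_fun setT k by exact: continuous_measurable_fun.
have mg : measurable_fun setT (@gpdf R) by exact: measurable_normal_pdf.
have iK : leb.-integrable setT (EFin \o (fun x => K * gpdf x)).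
  apply: eq_integrable (integrableZl measurableT K (gpdf_integrable R)) => //.
apply: le_integrable iK => //.
  by apply/measurable_EFinP; exact: measurable_funM.
move=> x _ /=; rewrite lee_fin !normrM [`|gpdf x|]gtr0_norm// ler_wpM2r ?(ltW (gE _))//.
by rewrite (le_trans (kK x))// ler_norm.
Qed.

Definition gmean : R := \int[leb]_x (h x * gpdf x).

Let h_integrable : leb.-integrable setT (EFin \o (fun x => h x * gpdf x)).
Proof.
apply: (@weighted_integrable _ 1); first exact: lipschitz_continuous.
by move=> x; rewrite ger0_norm; case/andP: (h01 x).
Qed.

Lemma gmean01 : 0 <= gmean <= 1.
Proof.
rewrite Rintegral_ge0/=; last first.
  by move=> x _; rewrite mulr_ge0 ?(ltW (gE _))//; case/andP: (h01 x).
rewrite -(gpdf_Rintegral R); apply: le_Rintegral => //; first exact: gpdf_integrable.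
by move=> x _; rewrite ler_piMl ?(ltW (gE _))//; case/andP: (h01 x).
Qed.

Definition centred x : R := h x - gmean.

Lemma centred_le1 x : `|centred x| <= 1.
Proof.
by rewrite /centred ler_norml; have /andP[? ?] := h01 x; have /andP[? ?] := gmean01;
  apply/andP; split; lra.
Qed.

Let continuous_centred : continuous centred.
Proof.
by move=> x; apply: (@cvgB _ R^o); [exact: lipschitz_continuous|exact: cvg_cst].
Qed.

Let c_integrable : leb.-integrable setT (EFin \o (fun x => centred x * gpdf x)).
Proof. exact: weighted_integrable centred_le1. Qed.

Let c_integrableS (A : set R) : measurable A ->
  leb.-integrable A (EFin \o (fun x => centred x * gpdf x)).
Proof. by move=> mA; apply: integrableS c_integrable. Qed.

Definition primitive x : R := \int[leb]_(t in `]-oo, x]) (centred t * gpdf t).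

Lemma is_derive_primitive x : is_derive x 1 primitive (centred x * gpdf x).
Proof.
have cc : {for x, continuous (fun t => centred t * gpdf t)}.
  by apply: cvgM; [exact: continuous_centred|exact: continuous_gpdf].
have x1 : x < x + 1 by rewrite ltrDl.
have [||d1 d2] := @continuous_FTC1 R (fun t => centred t * gpdf t) -oo%O x (x + 1) x1 _ _ cc.
- by apply: c_integrableS.
- by rewrite ltNyr.
by apply: (DeriveDef d1); rewrite -derive1E; exact: d2.
Qed.

Lemma primitive_left x : `|primitive x| <= gcdf x.
Proof.
apply: (le_trans (le_normr_Rintegral _ (c_integrableS _))) => //.
apply: le_Rintegral => //; first exact/integrable_norm/c_integrableS.
  exact: gpdf_integrableS.
move=> t _; rewrite normrM [`|gpdf t|]gtr0_norm// ler_piMl ?(ltW (gE _))//.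
exact: centred_le1.
Qed.

Lemma integral_centred : \int[leb]_x (centred x * gpdf x) = 0.
Proof.
under eq_Rintegral do rewrite mulrBl.
rewrite RintegralB//; last first.
  by apply: eq_integrable (integrableZl measurableT gmean (gpdf_integrable R)) => //.
rewrite RintegralZl//; last exact: gpdf_integrable.
by rewrite gpdf_Rintegral mulr1 subrr.
Qed.

(** The integral of the centred function over the whole line is 0. *)
Lemma primitive_right x : `|primitive x| <= 1 - gcdf x.
Proof.
have -> : primitive x = - \int[leb]_(t in `]x, +oo[) (centred t * gpdf t).
  rewrite -(@Rintegral_itvB _ _ -oo%O +oo%O x)//; last by rewrite set_itvNyy.
  by rewrite set_itvNyy integral_centred sub0r opprK.
rewrite normrN -(gcdf_split x) addrC addKr.
apply: (le_trans (le_normr_Rintegral _ (c_integrableS _))) => //.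
apply: le_Rintegral => //; first exact/integrable_norm/c_integrableS.
  exact: gpdf_integrableS.
move=> t _; rewrite normrM [`|gpdf t|]gtr0_norm// ler_piMl ?(ltW (gE _))//.
exact: centred_le1.
Qed.

(** The solution of f' - x f = h - gmean that is bounded at both ends. *)
Definition stein_f x : R := primitive x / gpdf x.
Definition stein_fd x : R := centred x + x * stein_f x.

Lemma is_derive_stein_f x : is_derive x 1 stein_f (stein_fd x).
Proof.
have g0 : gpdf x != 0 by rewrite gt_eqF.
have d1 := is_derive_primitive x.
have d2 := is_derive_gpdf x.
have d3 := @is_deriveV _ (@gpdf R) x _ 1 g0 d2.
rewrite /stein_f; apply: is_derive_eq.
rewrite /stein_fd /stein_f /GRing.scale/=; field.
exact: g0.
Qed.

Lemma gpdf_stein_f x : gpdf x * stein_f x = primitive x.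
Proof. by rewrite mulrC divfK// gt_eqF. Qed.

Lemma vanishing_stein_f : vanishing stein_f.
Proof.
move=> e /gcdf_limits[M MP]; exists M => x /MP[h1 _].
by rewrite gpdf_stein_f (le_trans (primitive_right x)).
Qed.

Lemma vanishing_stein_f_opp : vanishing (fun t => stein_f (- t)).
Proof.
move=> e /gcdf_limits[M MP]; exists M => x /MP[_ h1].
by rewrite -gpdf_opp gpdf_stein_f (le_trans (primitive_left _)).
Qed.

(** Stein's equation is the equation of [ode_bound] with right-hand side h - gmean. *)
Lemma xstein_f_le1 x : `|x * stein_f x| <= 1.
Proof.
apply: (ode_bound x vanishing_stein_f vanishing_stein_f_opp is_derive_stein_f).
by move=> t; rewrite /stein_fd addrK; exact: centred_le1.
Qed.

Lemma stein_fd_le2 x : `|stein_fd x| <= 2.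
Proof.
apply: (le_trans (ler_normD _ _)); rewrite -[2]/(1 + 1) lerD ?centred_le1//.
exact: xstein_f_le1.
Qed.

(** Outside the interval from -1 to 1 this follows from [xstein_f_le1]; inside, f
    differs from f 1 by at most 2 sup|f'|. *)
Lemma stein_f_le5 x : `|stein_f x| <= 5.
Proof.
have big y : 1 <= `|y| -> `|stein_f y| <= 1.
  move=> y1; apply: le_trans (xstein_f_le1 y); rewrite [`|y * _|]normrM.
  by rewrite ler_peMl.
have [x1|x1] := leP 1 `|x|; first by apply: (le_trans (big _ x1)); lra.
have /andP[xl xr] : -1 < x < 1 by move: x1; rewrite ltr_norml.
have [c _ fE] := MVT_everywhere xr is_derive_stein_f.
have b1 := big 1; rewrite normr1 lexx in b1; have {}b1 := b1 isT.
have b2 := stein_fd_le2 c.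
have : `|stein_fd c * (1 - x)| <= 2 * 2.
  rewrite normrM ler_pM// ger0_norm; lra.
rewrite -fE => b3.
have -> : stein_f x = stein_f 1 - (stein_f 1 - stein_f x) by ring.
apply: (le_trans (ler_normB _ _)); lra.
Qed.

(** The difference quotient of f solves the same differential equation, its right-hand
    side being f (x + dlt) plus the difference quotient of h.  This bounds its
    derivative by 2 (5 + L) without differentiating h. *)
Lemma stein_fd_shift x dlt : 0 < dlt ->
  `|stein_fd (x + dlt) - stein_fd x| <= 12 * L * dlt.
Proof.
move=> d0; pose psi t := (stein_f (t + dlt) - stein_f t) / dlt.
pose psid t := (stein_fd (t + dlt) - stein_fd t) / dlt.
have dpsi t : is_derive t 1 psi (psid t).
  have d1 := is_derive_stein_f t; have d2 := is_derive_stein_f (t + dlt).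
  have d3 : is_derive t 1 (fun y => stein_f (y + dlt)) (stein_fd (t + dlt)).
    have ds : is_derive t 1 (fun y : R => y + dlt) 1.
      by apply: is_derive_eq; rewrite addr0.
    by have := @is_derive1_comp _ stein_f (fun y => y + dlt) t _ _ d2 ds; rewrite mulr1.
  by rewrite /psi; apply: is_derive_eq; rewrite /psid /GRing.scale/=; ring.
have pb t : `|psi t| <= 10 / dlt.
  rewrite normrM [`|dlt^-1|]gtr0_norm ?invr_gt0// ler_pM2r ?invr_gt0//.
  apply: (le_trans (ler_normB _ _)).
  by have := stein_f_le5 (t + dlt); have := stein_f_le5 t; lra.
have B0 : 0 < 10 / dlt by exact: divr_gt0.
have v1 := bounded_vanishing B0 pb.
have v2 : vanishing (fun t => psi (- t)).
  by apply: (bounded_vanishing B0) => t; exact: pb.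
have kb t : `|psid t - t * psi t| <= 5 + L.
  have -> : psid t - t * psi t = stein_f (t + dlt) + (h (t + dlt) - h t) / dlt.
    by rewrite /psid /psi /stein_fd /centred; field; rewrite gt_eqF.
  apply: (le_trans (ler_normD _ _)); rewrite lerD ?stein_f_le5//.
  rewrite normrM [`|dlt^-1|]gtr0_norm ?invr_gt0// ler_pdivrMr//.
  by apply: (le_trans (hL _ _)); rewrite addrC addKr gtr0_norm.
have xb : `|x * psi x| <= 5 + L := ode_bound x v1 v2 dpsi kb.
have pd : `|psid x| <= 12 * L.
  have -> : psid x = (psid x - x * psi x) + x * psi x by ring.
  apply: (le_trans (ler_normD _ _)); have := kb x; move: xb L1; lra.
have -> : stein_fd (x + dlt) - stein_fd x = psid x * dlt.
  by rewrite divfK// gt_eqF.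
by rewrite normrM [`|dlt|]gtr0_norm// ler_pM2r.
Qed.

Lemma stein_fd_lip x y : `|stein_fd y - stein_fd x| <= 12 * L * `|y - x|.
Proof.
wlog xy : x y / x <= y => [H|].
  by have [/H|/ltW/H] := leP x y; rewrite // distrC [`|y - x|]distrC.
move: xy; rewrite le_eqVlt => /predU1P[->|xy]; first by rewrite !subrr normr0 mulr0.
rewrite [`|y - x|]gtr0_norm ?subr_gt0//.
have := @stein_fd_shift x (y - x); rewrite [x + (y - x)]addrC subrK subr_gt0; exact.
Qed.

Lemma stein_taylor x y :
  `|stein_f y - stein_f x - stein_fd x * (y - x)| <= 12 * L * (y - x) ^+ 2.
Proof.
have sq : (y - x) ^+ 2 = `|y - x| * `|y - x| by rewrite -expr2 real_normK ?num_real.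
have fin c : `|c - x| <= `|y - x| ->
    stein_f y - stein_f x = stein_fd c * (y - x) ->
    `|stein_f y - stein_f x - stein_fd x * (y - x)| <= 12 * L * (y - x) ^+ 2.
  move=> cx ->; rewrite -mulrBl normrM sq mulrA ler_wpM2r//.
  by apply: (le_trans (stein_fd_lip _ _)); rewrite ler_wpM2l// mulr_ge0// ltW.
case: (ltgtP x y) => xy.
- have [c /andP[xc cy] e] := MVT_everywhere xy is_derive_stein_f.
  by apply: (fin c) e; rewrite !gtr0_norm ?subr_gt0// lerD2r ltW.
- have [c /andP[yc cx] e] := MVT_everywhere xy is_derive_stein_f.
  apply: (fin c); last by rewrite -opprB e; ring.
  by rewrite !ltr0_norm ?subr_lt0// !opprB lerD2l lerN2 ltW.
- by apply: (fin x); rewrite xy ?lexx// !subrr mulr0.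
Qed.

Lemma stein_equation x : stein_fd x - x * stein_f x = h x - gmean.
Proof. by rewrite /stein_fd addrK. Qed.

Lemma measurable_stein_f : measurable_fun setT stein_f.
Proof.
apply: continuous_measurable_fun => x.
by apply: differentiable_continuous; apply/derivable1_diffP; have [] := is_derive_stein_f x.
Qed.

Lemma measurable_stein_fd : measurable_fun setT stein_fd.
Proof.
apply: measurable_funD; first exact: continuous_measurable_fun.
by apply: measurable_funM => //; exact: measurable_stein_f.
Qed.

End SteinSolution.

(** * Smoothed indicators and the Kolmogorov distance *)

Section Ramp.
Context (R : realType).
Implicit Types (x y t s : R).
Notation leb := (@lebesgue_measure R).

Variables (s eta : R).
Hypothesis eta0 : 0 < eta.
Hypothesis eta1 : eta <= 1.

(** Piecewise linear: 1 up to s and 0 from s + eta on. *)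
Definition ramp x : R := Num.max 0 (Num.min 1 (1 - (x - s) / eta)).

Lemma clampP (v : R) (c := Num.max 0 (Num.min 1 v)) :
  [\/ v <= 0 /\ c = 0, 0 <= v <= 1 /\ c = v | 1 <= v /\ c = 1].
Proof.
rewrite /c; have [v1|v1] := leP 1 v.
  by apply: Or33; split=> //; apply/max_idPr.
have [v0|v0] := leP v 0.
  by apply: Or31; split=> //.
by apply: Or32; split=> //; rewrite !ltW.
Qed.

Lemma ramp01 x : 0 <= ramp x <= 1.
Proof.
rewrite /ramp; move: (1 - (x - s) / eta) => v.
by have [[? ->]|[? ->]|[? ->]] := clampP v; lra.
Qed.

Lemma ramp_left x : x <= s -> ramp x = 1.
Proof.
move=> xs; have : (x - s) / eta <= 0 by rewrite ler_pdivrMr// mul0r subr_le0.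
rewrite /ramp; move: ((x - s) / eta) => a a0.
by have [[? ->]|[? ->]|[? ->]] := clampP (1 - a); lra.
Qed.

Lemma ramp_right x : s + eta <= x -> ramp x = 0.
Proof.
move=> xs; have : 1 <= (x - s) / eta by rewrite ler_pdivlMr// mul1r; lra.
rewrite /ramp; move: ((x - s) / eta) => a a0.
by have [[? ->]|[? ->]|[? ->]] := clampP (1 - a); lra.
Qed.

Lemma ramp_lip x y : `|ramp x - ramp y| <= eta^-1 * `|x - y|.
Proof.
have -> : eta^-1 * `|x - y| = `|(x - s) / eta - (y - s) / eta|.
  by rewrite -mulrBl normrM [`|eta^-1|]gtr0_norm ?invr_gt0// mulrC; congr (`| _ | * _); ring.
rewrite /ramp; move: ((x - s) / eta) ((y - s) / eta) => u v.
rewrite ler_norml; have := ler_norm (u - v); have := ler_norm (v - u); rewrite distrC.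
move=> h1 h2.
have [[? ->]|[? ->]|[? ->]] := clampP (1 - u);
  by have [[? ->]|[? ->]|[? ->]] := clampP (1 - v); apply/andP; split; lra.
Qed.

(** The ramp lies between the indicators of the half-lines ending at s and at
    s + eta. *)
Lemma gmean_ramp : gcdf s <= gmean ramp <= gcdf s + eta.
Proof.
have i1 : leb.-integrable setT (EFin \o (fun x => ramp x * gpdf x)).
  apply: (@weighted_integrable _ _ 1).
    apply: (@lipschitz_continuous _ _ eta^-1 ramp_lip); by rewrite invf_ge1.
  by move=> x; rewrite ger0_norm; case/andP: (ramp01 x).
have gm x : gcdf x = \int[leb]_t (\1_(`]-oo, x]%classic : set R) t * gpdf t).
  rewrite /gcdf Rintegral_mkcond; apply: eq_Rintegral => t _.
  rewrite patchE indicE; case: ifPn => tx; first by rewrite mul1r.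
  by rewrite mul0r.
have im x : leb.-integrable setT
    (EFin \o (fun t => \1_(`]-oo, x]%classic : set R) t * gpdf t)).
  apply: le_integrable (gpdf_integrable R) => //.
    apply/measurable_EFinP; apply: measurable_funM; first exact: measurable_indic.
    exact: measurable_normal_pdf.
  move=> t _ /=; rewrite lee_fin normrM ler_piMl//.
  by rewrite indicE ger0_norm// lern1; case: (_ \in _).
apply/andP; split.
  rewrite gm; apply: le_Rintegral => // t _.
  rewrite ler_wpM2r ?(ltW (gpdf_gt0 _))// indicE.
  case: (boolP (t \in _)) => [|_]; last by case/andP: (ramp01 t).
  by rewrite inE/= in_itv/= => ts; rewrite ramp_left.
apply: le_trans (gcdf_lip s (ltW eta0)).
rewrite gm; apply: le_Rintegral => // t _.
rewrite ler_wpM2r ?(ltW (gpdf_gt0 _))// indicE.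
case: (boolP (t \in _)) => [_|]; first by case/andP: (ramp01 t).
by rewrite notin_setE/= in_itv/= => /negP; rewrite -ltNge => /ltW/ramp_right ->.
Qed.

End Ramp.

Section Kolmogorov.
Context (R : realType) (I : finType) (mu : I -> probability R R).
Context d (T : measurableType d) (P : probability T R) (X : I -> {RV P >-> R}).
Local Notation E := (Ex X).
Variables (W : cfg R I -> R) (a b : R).
Hypothesis gW : bdd_meas W.
Hypothesis discrepancy : forall (f fd : R -> R) (K1 K2 : R),
  measurable_fun setT f -> measurable_fun setT fd ->
  (forall x, `|fd x| <= K1) ->
  (forall x y, `|f y - f x - fd x * (y - x)| <= K2 * (y - x) ^+ 2) ->
  `|E (fun c => fd (W c) - W c * f (W c))| <= a * K1 + b * K2.

Let event s := [set t | W (config_of X t) <= s].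

Lemma measurable_event s : measurable (event s).
Proof.
have mW : measurable_fun setT (fun t => W (config_of X t)).
  exact: (measurableT_comp gW.1 (measurable_config_of X)).
rewrite (_ : event s = (fun t => W (config_of X t)) @^-1` `]-oo, s]).
  by rewrite -[X in measurable X]setTI; apply: mW => //; exact: measurable_itv.
by apply/seteqP; split => t /=; rewrite in_itv.
Qed.

Definition below s : cfg R I -> R := fun c => (W c <= s)%R%:R.

Lemma bdd_meas_below s : bdd_meas (below s).
Proof.
split; last by exists 1 => c; rewrite /below; case: (W c <= s)%R; rewrite ?normr1 ?normr0.
have -> : below s = \1_(W @^-1` `]-oo, s]).
  apply/funext => c; rewrite /below indicE.
  case: (boolP (W c <= s)) => h; first by rewrite mem_set//= in_itv.
  by rewrite memNset//= in_itv/=; exact/negP.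
apply: measurable_indic; rewrite -[X in measurable X]setTI.
by apply: gW.1 => //; exact: measurable_itv.
Qed.

Lemma prob_below s : P (event s) = (E (below s))%:E.
Proof.
rewrite -ExE; last exact: bdd_meas_below.
transitivity (\int[P]_t (\1_(event s) t)%:E)%E.
  by rewrite integral_indic ?setIT//; exact: measurable_event.
apply: eq_integral => t _; congr EFin; rewrite indicE /below.
case: (boolP (W (config_of X t) <= s)) => h; first by rewrite mem_set.
by rewrite memNset//; exact/negP.
Qed.

Lemma ramp_expectation s eta : 0 < eta -> eta <= 1 ->
  `|E (fun c => ramp s eta (W c)) - gmean (ramp s eta)| <= 2 * a + 12 * eta^-1 * b.
Proof.
move=> e0 e1; have L1 : 1 <= eta^-1 by rewrite invf_ge1.
have h01 := ramp01 s eta.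
have hL := ramp_lip s e0.
have gr : bdd_meas (fun c => ramp s eta (W c)).
  apply: (@bdd_meas_comp _ _ (ramp s eta)) => //.
    by apply: continuous_measurable_fun; exact: lipschitz_continuous hL L1.
  by move=> K; exists 1 => y _; rewrite ger0_norm; case/andP: (h01 y).
have := discrepancy (measurable_stein_f h01 hL L1) (measurable_stein_fd h01 hL L1)
  (stein_fd_le2 h01 hL L1) (stein_taylor h01 hL L1).
rewrite (_ : (fun c => _) = (fun c => ramp s eta (W c) - gmean (ramp s eta))); last first.
  by apply/funext => c; exact: stein_equation.
rewrite ExB//; last exact: bdd_meas_cst.
rewrite Ex_cst => /le_trans; apply; rewrite le_eqVlt; apply/orP; left; apply/eqP; ring.
Qed.

(** Sandwich the indicator of W <= s between the ramps that start at s - eta and at s. *)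
Lemma kolmogorov_bound s eta : 0 < eta -> eta <= 1 ->
  `|E (below s) - gcdf s| <= 2 * a + 12 * eta^-1 * b + eta.
Proof.
move=> e0 e1.
have gr s' : bdd_meas (fun c => ramp s' eta (W c)).
  apply: (@bdd_meas_comp _ _ (ramp s' eta)) => //.
    apply: continuous_measurable_fun.
    by apply: (lipschitz_continuous (ramp_lip s' e0)); rewrite invf_ge1.
  by move=> K; exists 1 => y _; rewrite ger0_norm; case/andP: (ramp01 s' eta y).
have up : E (below s) <= E (fun c => ramp s eta (W c)).
  apply: le_Ex => // [|c]; first exact: bdd_meas_below.
  rewrite /below; case: (boolP (W c <= s)) => h; first by rewrite ramp_left.
  by case/andP: (ramp01 s eta (W c)).
have dn : E (fun c => ramp (s - eta) eta (W c)) <= E (below s).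
  apply: le_Ex => // [|c]; first exact: bdd_meas_below.
  rewrite /below; case: (boolP (W c <= s)) => h; first by case/andP: (ramp01 (s - eta) eta (W c)).
  by rewrite ramp_right// subrK ltW// ltNge.
have r1 := ramp_expectation s e0 e1.
have r2 := ramp_expectation (s - eta) e0 e1.
have /andP[_ m1] := gmean_ramp s e0 e1.
have /andP[m2 _] := gmean_ramp (s - eta) e0 e1.
have m3 := gcdf_lip (s - eta) (ltW e0); rewrite subrK in m3.
move: r1 r2; rewrite !ler_norml => /andP[? ?] /andP[? ?].
apply/andP; split; lra.
Qed.

End Kolmogorov.

(** Take eta = y; if x or y is at least 1 the claim follows from Z <= 1. *)
Lemma optimize_smoothing (R : realType) (Z a b x y : R) : Z <= 1 ->
  (forall eta, 0 < eta -> eta <= 1 -> Z <= 2 * a + 12 * eta^-1 * b + eta) ->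
  a <= x ^+ 2 -> b <= y ^+ 2 -> 0 <= x -> 0 < y -> Z <= 2 * x + 13 * y.
Proof.
move=> Z1 H ax by_ x0 y0.
have [x1|x1] := leP 1 x; first by lra.
have [y1|y1] := leP 1 y; first by lra.
apply: (le_trans (H _ y0 (ltW y1))).
have h1 : 12 * y^-1 * b <= 12 * y.
  by rewrite -mulrA ler_pM2l// ler_pdivrMl// -expr2.
have h2 : x ^+ 2 <= x by rewrite expr2 ler_piMr// ltW.
lra.
Qed.

(** * Choice of the constants and conclusion *)

Lemma exp_small (R : realType) (z e : R) : 0 <= z -> z < 1 -> 0 < e ->
  exists n, z ^+ n <= e.
Proof.
move=> z0 z1 e0; have : `|z| < 1 by rewrite ger0_norm.
move=> /cvg_expr/cvgrPdist_le/(_ _ e0)[n _ /(_ n (leqnn n))] /=.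
by rewrite sub0r normrN ger0_norm ?exprn_ge0// => h; exists n.
Qed.

(** Chosen in this order: th from D, then the threshold K from the tails of both laws,
    then the power s from the contraction factor reached with weights of size at
    most K. *)
Lemma decay_parameters (R : realType) (D : nat) (muE muV : probability R R) :
  (1 <= D)%N -> finite_fourth_moment muE -> finite_fourth_moment muV ->
  exists th K : R, exists s : nat,
  [/\ 0 < th, th <= 1, th * 2 ^+ (2 * D + 1) = (2 * D%:R)^-1,
      (\int[muE]_u (penalty th K u ^+ D.+1))%R <= 2 /\
      (\int[muV]_u (penalty th K u ^+ D.+1))%R <= 2
    & (D%:R * expR (3 * K) / (1 + D%:R * expR (3 * K))) ^+ s.+1 <= th].
Proof.
move=> D1 mE mV.
have D0 : 0 < D%:R :> R by rewrite ltr0n.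
pose th : R := (2 * D%:R)^-1 / 2 ^+ (2 * D + 1).
have p2 : 1 <= 2 ^+ (2 * D + 1) :> R by rewrite exprn_ege1// ler1n.
have th0 : 0 < th by rewrite divr_gt0 ?invr_gt0 ?mulr_gt0// exprn_gt0.
have th1 : th <= 1.
  rewrite ler_pdivrMr ?exprn_gt0// mul1r (le_trans _ p2)// invf_le1 ?mulr_gt0//.
  by rewrite -natrM ler1n muln_gt0.
have [K1 _ H1] := penalty_tail D.+1 th0 th1 mE.
have [K2 _ H2] := penalty_tail D.+1 th0 th1 mV.
pose K := Num.max K1 K2.
have B0 : 0 < D%:R * expR (3 * K) by rewrite mulr_gt0 ?expR_gt0.
have [|||s sP] := @exp_small R (D%:R * expR (3 * K) / (1 + D%:R * expR (3 * K))) th.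
- by rewrite divr_ge0 ?addr_ge0 ?(ltW B0).
- by rewrite ltr_pdivrMr ?mul1r ?ltrDr// addr_gt0.
- by [].
exists th, K, s; split=> //.
- by rewrite divfK// expf_neq0.
- by split; [apply: H1|apply: H2]; rewrite le_max lexx ?orbT.
- apply: le_trans sP; rewrite exprS ler_piMl ?exprn_ge0 ?divr_ge0 ?addr_ge0 ?(ltW B0)//.
  by rewrite ler_pdivrMr ?mul1r ?lerDr// addr_gt0.
Qed.

Definition weight_laws (R : realType) (G : sgraph) (muE muV : probability R R)
    (i : edge G + G) : probability R R :=
  match i with inl _ => muE | inr _ => muV end.

Section MatchingSize.
Context (R : realType) (G : sgraph) (muE muV : probability R R).
Context d (T : measurableType d) (P : probability T R).
Variables (w : edge G -> {RV P >-> R}) (nu : G -> {RV P >-> R}).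
Hypothesis iid : iid_weights muE muV w nu.
Local Notation X := (weight_family w nu).
Local Notation E := (Ex X).
Local Notation F := (@dimers_at R G [set: G]%SET).

Lemma iid_law i : has_law (X i) (weight_laws muE muV i).
Proof. by case: iid => lE lV _; case: i => [e|x]; [exact: lE|exact: lV]. Qed.

Lemma iid_indep : mutually_independent X. Proof. by case: iid. Qed.

Lemma mean_matching_sizeE t : mean_matching_size w nu t = F (config_of X t).
Proof. by rewrite /mean_matching_size gibbs_mean_dimers. Qed.

Lemma expectation_matching_size : fine 'E_P[mean_matching_size w nu] = E F.
Proof.
rewrite unlock /Ex /Rintegral; congr fine; apply: eq_integral => t _.
by rewrite mean_matching_sizeE.
Qed.

Lemma variance_matching_size :
  'V_P[mean_matching_size w nu] = (E (fun c => (F c - E F) ^+ 2))%:E.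
Proof.
rewrite /variance unlock expectation_matching_size unlock -ExE; last first.
  by apply/bdd_meas_exp/bdd_measB; [exact: bdd_meas_dimers|exact: bdd_meas_cst].
apply: eq_integral => t _; congr EFin.
change ((mean_matching_size w nu t - E F) * (mean_matching_size w nu t - E F) =
  (F (config_of X t) - E F) ^+ 2).
by rewrite mean_matching_sizeE expr2.
Qed.

Lemma standardizeE t : standardize P (mean_matching_size w nu) t =
  (F (config_of X t) - E F) / Num.sqrt (E (fun c => (F c - E F) ^+ 2)).
Proof.
by rewrite /standardize expectation_matching_size variance_matching_size mean_matching_sizeE.
Qed.

End MatchingSize.

Theorem theorem1p4 (R : realType) (D : nat) (hD : (1 <= D)%N)
    (muE muV : probability R R)
    (hE : finite_fourth_moment muE) (hV : finite_fourth_moment muV) :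
  exists eps : R, 0 < eps /\
  forall delta A : R, 0 < delta -> 0 < A ->
  exists c C : R, 0 < c /\ 0 < C /\
  forall (G : sgraph) (d : measure_display) (T : measurableType d)
    (P : probability T R)
    (w : edge G -> {RV P >-> R}) (nu : G -> {RV P >-> R}) (c0 : R),
  (0 < #|G|)%N ->
  (forall x : G, (degree x <= D)%N) ->
  delta * #|G|%:R <= #|edge_set G|%:R ->
  in_Growth G A eps ->
  iid_weights muE muV w nu ->
  0 < c0 ->
  ((c0 * #|edge_set G|%:R)%:E <= 'V_P[mean_matching_size w nu])%E ->
  forall r : R, 1 <= r ->
  (ereal_sup [set `| P [set t | (standardize P (mean_matching_size w nu) t <= s)%R]
                     - Phi s |
             | s in [set: R]]
   <= (C * c0 `^ (- 2^-1)
         * (expR (- (c * r))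
            + #|edge_set G|%:R `^ (- 4^-1) * (volume_growth G r)%:R ^+ 2)
       + C * c0 `^ (- (3 / 4)) * #|edge_set G|%:R `^ (- 4^-1))%:E)%E.
Proof.
have [th [K [s [th0 th1 thD [tailE tailV] contractionK]]]] := decay_parameters hD hE hV.
pose eps := rate R s; have eps0 : 0 < eps := rate_gt0 R s.
exists eps; split=> // delta A delta0 A0.
pose S := 1 + A * expR eps / (1 - expR (- eps)).
have S0 : 0 < S.
  rewrite ltr_pwDl// divr_ge0 ?mulr_ge0 ?(ltW A0) ?expR_ge0// subr_ge0.
  by rewrite -expR0 ler_expR oppr_le0 ltW.
(* There are at most kap * N weights, since #|G| <= N / delta. *)
pose kap := 1 + delta^-1.
have kap0 : 0 < kap by rewrite ltr_pwDl// invr_ge0 ltW.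
pose A1 := 8 * D.+1%:R * S ^+ 2.
have A10 : 0 < A1 by rewrite !mulr_gt0 ?exprn_gt0.
pose C1 := Num.sqrt (A1 * Num.sqrt kap); pose C2 := Num.sqrt kap.
have C10 : 0 < C1 by rewrite sqrtr_gt0 mulr_gt0// sqrtr_gt0.
have C20 : 0 < C2 by rewrite sqrtr_gt0.
exists 1, (2 * C1 + 13 * C2); split=> //; split; first by rewrite addr_gt0 ?mulr_gt0.
move=> G d T P w nu c0 G0 degD edgesG growth iid c00 varF r r1.
set N : R := #|edge_set G|%:R in varF edgesG *.
have N0 : 0 < N by apply: lt_le_trans edgesG; rewrite mulr_gt0// ltr0n.
have lawX := iid_law iid; have indX := iid_indep iid.
have tail (i : edge G + G) : (\int[weight_laws muE muV i]_u (penalty th K u ^+ D.+1))%R <= 2.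
  by case: i.
pose X := weight_family w nu; pose F := @dimers_at R G [set: G]%SET.
pose V := Ex X (fun c => (F c - Ex X F) ^+ 2).
have VE : 'V_P[mean_matching_size w nu] = V%:E by exact: variance_matching_size.
have VN : c0 * N <= V by rewrite -lee_fin -VE.
have V0 : 0 < V by apply: lt_le_trans VN; exact: mulr_gt0.
pose sg := Num.sqrt V.
have sg0 : 0 < sg by rewrite sqrtr_gt0.
have sgV : sg ^+ 2 = V by rewrite sqr_sqrtr// ltW.
(* The cap m on distances depends on G; it is so large that the vertices at
   capped distance contribute at most 1 to the sums of influences. *)
have rho1 : expR (- 2 * eps) < 1 by rewrite -expR0 ltr_expR mulNr oppr_lt0 mulr_gt0.
have Ginv : 0 < #|G|%:R^-1 :> R by rewrite invr_gt0 ltr0n.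
have [m mP] := exp_small (expR_ge0 (- 2 * eps)) rho1 Ginv.
have Gm : #|G|%:R * expR (- 2 * eps) ^+ m <= 1.
  by rewrite -ler_pdivlMl ?ltr0n// mulr1.
have sumS x : \sum_(v : G) expR (- 2 * rate R s) ^+ capdist m x v <= S.
  exact: sum_exp_capdist.
pose n : R := #|{: edge G + G}|%:R.
have nN : n <= kap * N.
  rewrite /n card_sum natrD mulrDl mul1r lerD//.
    by rewrite card_sig ler_nat; apply/subset_leq_card/fintype.subsetP => e; rewrite !inE.
  by rewrite ler_pdivlMl.
have n0 : 0 <= n by exact: ler0n.
pose W c := (F c - Ex X F) / sg.
have gW : bdd_meas W.
  rewrite /W; under eq_fun do rewrite mulrC; apply: bdd_measZ.
  by apply: bdd_measB; [exact: bdd_meas_dimers|exact: bdd_meas_cst].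
pose a := A1 * sg ^- 2 * Num.sqrt n; pose b := n * sg ^- 3.
have disc (f fd : R -> R) (K1 K2 : R) :
  measurable_fun setT f -> measurable_fun setT fd ->
  (forall x, `|fd x| <= K1) ->
  (forall x y, `|f y - f x - fd x * (y - x)| <= K2 * (y - x) ^+ 2) ->
  `|Ex X (fun c => fd (W c) - W c * f (W c))| <= a * K1 + b * K2.
  move=> mf mfd fdK taylor.
  have H := dimers_stein_discrepancy degD hD lawX indX th0 th1 thD tail contractionK S0 sumS
    mf mfd fdK taylor sg0 sgV.
  apply: (le_trans H); rewrite le_eqVlt; apply/orP; left; apply/eqP.
  by rewrite /a /b /A1 /n; ring.
(* Fourth roots turn all the real powers of the statement into integer ones:
   the standard deviation is at least q = u^2 v^2, a is at most x^2 and b at most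
   y^2. *)
pose u := c0 `^ 4^-1; pose v := N `^ 4^-1.
have u0 : 0 < u by exact: powR_gt0.
have v0 : 0 < v by exact: powR_gt0.
have u4 : u ^+ 4 = c0.
  by rewrite -powR_mulrn ?(ltW u0)// -powRrM mulVf// powRr1// ltW.
have v4 : v ^+ 4 = N.
  by rewrite -powR_mulrn ?(ltW v0)// -powRrM mulVf// powRr1// ltW.
have vE : N `^ (- 4^-1) = v^-1 by rewrite powRN.
have u2E : c0 `^ (- 2^-1) = u ^- 2.
  rewrite powRN; congr _^-1; rewrite -powR_mulrn ?(ltW u0)// -powRrM; congr (_ `^ _).
  by field.
have u3E : c0 `^ (- (3 / 4)) = u ^- 3.
  rewrite powRN; congr _^-1; rewrite -powR_mulrn ?(ltW u0)// -powRrM; congr (_ `^ _).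
  by field.
pose q := u ^+ 2 * v ^+ 2.
have q0 : 0 < q by rewrite mulr_gt0 ?exprn_gt0.
have qsg : q <= sg.
  rewrite -(ler_pXn2r (isT : (0 < 2)%N)) ?nnegrE ?(ltW q0) ?(ltW sg0)//.
  by rewrite sgV /q exprMn -!exprM u4 v4.
pose x := C1 * (u ^- 2 * v^-1); pose y := C2 * (u ^- 3 * v^-1).
have x0 : 0 < x by rewrite !mulr_gt0 ?invr_gt0 ?exprn_gt0.
have y0 : 0 < y by rewrite !mulr_gt0 ?invr_gt0 ?exprn_gt0.
have sqn : Num.sqrt n <= Num.sqrt kap * v ^+ 2.
  rewrite -[v ^+ 2]ger0_norm ?sqr_ge0// -sqrtr_sqr -sqrtrM ?(ltW kap0)//.
  by rewrite ler_wsqrtr// -exprM v4.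
have ax : a <= x ^+ 2.
  apply: (@le_trans _ _ (A1 * q ^- 2 * (Num.sqrt kap * v ^+ 2))).
    apply: ler_pM; [|exact: sqrtr_ge0| |exact: sqn].
      by rewrite mulr_ge0 ?invr_ge0 ?exprn_ge0 ?(ltW A10) ?(ltW sg0).
    apply: ler_wpM2l; first exact: ltW.
    rewrite lef_pV2 ?posrE ?exprn_gt0//.
    by apply: lerXn2r; rewrite ?nnegrE ?(ltW q0) ?(ltW sg0).
  have AK : 0 <= A1 * Num.sqrt kap by rewrite mulr_ge0 ?sqrtr_ge0// ltW.
  rewrite /x [leRHS]exprMn /C1 (sqr_sqrtr AK) le_eqVlt; apply/orP; left.
  by apply/eqP; rewrite /q; field; rewrite !gt_eqF.
have by_ : b <= y ^+ 2.
  apply: (@le_trans _ _ (kap * N * q ^- 3)).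
    apply: ler_pM; [exact: n0| |exact: nN|].
      by rewrite invr_ge0 exprn_ge0// ltW.
    rewrite lef_pV2 ?posrE ?exprn_gt0//.
    by apply: lerXn2r; rewrite ?nnegrE ?(ltW q0) ?(ltW sg0).
  rewrite /y [leRHS]exprMn /C2 (sqr_sqrtr (ltW kap0)) -v4 le_eqVlt; apply/orP; left.
  by apply/eqP; rewrite /q; field; rewrite !gt_eqF.
have Psi1 : 1 <= (volume_growth G r)%:R :> R.
  have /card_gt0P[z _] := G0.
  rewrite ler1n; apply: (@leq_trans #|@ball_vertices R G z r|).
    apply/card_gt0P; exists z; rewrite inE.
    apply: (@le_trans _ _ (0%:E)).
      by apply: ereal_inf_lbound; exists [::].
    by rewrite lee_fin (le_trans _ r1).
  by rewrite /volume_growth leq_bigmax.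
apply: ge_ereal_sup => _ [s' _ <-].
have -> : [set t | standardize P (mean_matching_size w nu) t <= s'] =
          [set t | W (config_of X t) <= s'].
  by apply/seteqP; split => t /=; rewrite (standardizeE).
rewrite (prob_below X gW) PhiE -EFinB abse_EFin lee_fin.
have Z1 : `|Ex X (below W s') - gcdf s'| <= 1.
  have p01 : 0 <= Ex X (below W s') <= 1.
    by rewrite -!lee_fin -(prob_below X gW) measure_ge0 probability_le1//; exact: (measurable_event X gW).
  have g01 : 0 <= gcdf s' <= 1.
    by rewrite -!lee_fin -PhiE measure_ge0 probability_le1.
  move: p01 g01 => /andP[? ?] /andP[? ?]; rewrite ler_norml; apply/andP; split; lra.
apply: (le_trans (optimize_smoothing Z1 _ ax by_ (ltW x0) y0)).
  by move=> eta eta0 eta1; exact: (kolmogorov_bound gW disc).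
rewrite vE u2E u3E.
set Psi2 : R := (volume_growth G r)%:R ^+ 2.
have Psi21 : 1 <= Psi2 by rewrite exprn_ege1.
have p0 : 0 <= u ^- 2 * v^-1 by rewrite mulr_ge0 ?invr_ge0 ?exprn_ge0 ?(ltW u0) ?(ltW v0).
have p0' : 0 <= u ^- 3 * v^-1 by rewrite mulr_ge0 ?invr_ge0 ?exprn_ge0 ?(ltW u0) ?(ltW v0).
have u2 : 0 <= u ^- 2 by rewrite invr_ge0 exprn_ge0// ltW.
rewrite lerD//.
  apply: (@le_trans _ _ ((2 * C1 + 13 * C2) * (u ^- 2 * v^-1))).
    rewrite /x mulrA ler_wpM2r// lerDl mulr_ge0// ltW//.
  rewrite -mulrA ler_wpM2l ?addr_ge0 ?mulr_ge0 ?(ltW C10) ?(ltW C20)//.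
  rewrite ler_wpM2l//.
  apply: (@le_trans _ _ (0 + v^-1 * Psi2)); last by rewrite lerD2r expR_ge0.
  by rewrite add0r ler_peMr// invr_ge0 ltW.
rewrite /y mulrA -[leRHS]mulrA ler_wpM2r// lerDr mulr_ge0// ltW//.
Qed.
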